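(* Let $E\subseteq F$ be smooth countable Borel equivalence relations on a standard Borel space $X$. If the equivalence relation $[\![\mathrm{lfs}(E,F)]\!]$ on $X/F$ does not admit a Borel parametrization, then there exist smooth countable Borel equivalence relations $E'\subseteq F'$ on some standard Borel space such that $\mathrm{gfs}(E,F)=\mathrm{gfs}(E',F')$ but $(E,F)\not\cong_B(E',F')$.
   Context: Countable Borel equivalence relation: Borel equivalence relation with countable classes; smooth: admits a Borel reduction to equality on some standard Borel space. $X/F$ carries the quotient Borel structure (sets $B$ with $\bigcup B$ Borel), which is standard Borel for smooth countable $F$. $(E,F)\cong_B(E',F')$ means there is a Borel bijection simultaneously reducing $E$ to $E'$ and $F$ to $F'$. For an $F$-class $C$, $\mathrm{lfs}(C)=\langle n_m:1\leq m\leq\omega\rangle$ with $n_m$ the number of $E$-classes in $C$ of cardinality exactly $m$. $S_f$ is the set of functions $\{1,\ldots,\omega\}\to\{0,\ldots,\omega\}$ not identically $0$. $[\![\mathrm{lfs}(E,F)]\!]$ on $X/F$: $C\sim C'\iff \mathrm{lfs}(C)=\mathrm{lfs}(C')$. $\mathrm{gfs}(E,F)(\alpha)$ is the number of $F$-classes with local fine shape $\alpha\in S_f$. With $\mathbb{C}^+=\{1,2,\ldots,\aleph_0,2^{\aleph_0}\}$, a Borel parametrization of an equivalence relation $D$ on a standard Borel space $Z$ is a Borel bijection $\phi:Z\to\bigsqcup_{\mathfrak m\in\mathbb{C}^+}(Z_{\mathfrak m}\times Y_{\mathfrak m})$ with $Z_{\mathfrak m}$ (possibly empty) standard Borel, $Y_{\mathfrak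 m}$ standard Borel of cardinality $\mathfrak m$, and $z\mathrel{D}z'\iff\pi_1\phi(z)=\pi_1\phi(z')$. *)

(* Defs.v *)
From mathcomp Require Import all_boot all_order all_algebra.
From mathcomp Require Import all_classical all_reals.
From mathcomp Require Import topology measure.

Set Implicit Arguments.
Unset Strict Implicit.
Unset Printing Implicit Defensive.

Local Open Scope classical_set_scope.
Local Open Scope card_scope.

(* [measurableType] is pointed, hence never empty, whereas the empty space is
   standard Borel and the pieces of a parametrization may be empty.  Borel
   structures are therefore plain set systems. *)

Section standard_borel.
Variable R : realType.

(* Completeness is the axiom of [completeType], which cannot be used itself
   because it is pointed too. *)
Definition polish (P : metricType R) : Prop :=
  (forall G : set_system P, ProperFilter G -> cauchy G ->
     exists p : P, G --> p) /\
  (exists2 A : set P, countable A & dense A).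

Definition standard_borel (T : Type) (S : set (set T)) : Prop :=
  exists P : metricType R, polish P /\
  exists g : T -> P, bijective g /\
    S = [set g @^-1` B | B in <<s @open P >>].

Record standardBorel := StandardBorel {
  sb_sort :> Type ;
  borel : set (set sb_sort) ;
  borelP : standard_borel borel }.

End standard_borel.

Arguments borel {R s}.

Definition borel_fun (T U : Type) (S : set (set T)) (S' : set (set U))
  (f : T -> U) : Prop := forall B, S' B -> S (f @^-1` B).

Definition prod_borel (T U : Type) (S : set (set T)) (S' : set (set U)) :
  set (set (T * U)) := <<s [set A `*` B | A in S & B in S'] >>.

Definition sum_borel (I : Type) (T : I -> Type) (S : forall i, set (set (T i))) :
  set (set {i : I & T i}) :=
  [set B | forall i, S i (existT T i @^-1` B)].

Section relations.
Variables (R : realType) (X : standardBorel R).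
Implicit Types E F : X -> X -> Prop.

Definition countable_borel_equiv E : Prop :=
  [/\ RelationClasses.Equivalence E,
      prod_borel borel borel [set p : X * X | E p.1 p.2] &
      forall x, countable [set y | E x y]].

Definition smooth E : Prop :=
  exists (Z : standardBorel R) (f : X -> Z),
    borel_fun borel borel f /\ forall x y, E x y <-> f x = f y.

Definition classes E : set (set X) := range (fun x => [set y | E x y]).

Definition quot E : Type := set_type (classes E).

Definition quot_borel E : set (set (quot E)) :=
  [set B | borel (\bigcup_(C in B) set_val C)].

End relations.

Arguments quot_borel {R X} E.

Definition borel_isomorphic (R : realType) (X X' : standardBorel R)
    (E F : X -> X -> Prop) (E' F' : X' -> X' -> Prop) : Prop :=
  exists f : X -> X',
    [/\ bijective f, borel_fun borel borel f,
        forall x y, E x y <-> E' (f x) (f y) &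
        forall x y, F x y <-> F' (f x) (f y)].

(* {0, 1, ..., omega}, with [None] standing for omega *)
Definition natw := option nat.

(* {1, ..., omega} *)
Definition posw := {m : natw | m != Some 0}.

Definition card_is (T : Type) (A : set T) (k : natw) : Prop :=
  if k is Some n then A #= `I_n else A #= [set: nat].

(* The default value is only reached by uncountable sets. *)
Definition ccard (T : Type) (A : set T) : natw := xget None (card_is A).

Section shapes.
Variables (R : realType) (X : standardBorel R).
Variables E F : X -> X -> Prop.

Definition lfs (C : quot F) : posw -> natw :=
  fun m => ccard [set D | [/\ classes E D, D `<=` set_val C & ccard D = val m]].

Definition lfs_rel (C C' : quot F) : Prop := lfs C = lfs C'.

Definition lfs_fiber (a : posw -> natw) : set (quot F) := [set C | lfs C = a].

End shapes.

Arguments lfs {R X} E F C.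
Arguments lfs_rel {R X} E F C C'.
Arguments lfs_fiber {R X} E F a.

Definition Sf : set (posw -> natw) := [set a | exists m, a m <> Some 0].

(* gfs(E,F)(a) is the cardinal number of [lfs_fiber E F a]; two cardinal
   numbers are equal when the sets are equinumerous. *)
Definition gfs_eq (R : realType) (X X' : standardBorel R)
    (E F : X -> X -> Prop) (E' F' : X' -> X' -> Prop) : Prop :=
  forall a, Sf a -> lfs_fiber E F a #= lfs_fiber E' F' a.

(* {1, 2, ..., aleph_0, 2^aleph_0} *)
Variant cplus := countable_card of posw | continuum.

Definition type_card_is (T : Type) (m : cplus) : Prop :=
  match m with
  | countable_card k => card_is [set: T] (val k)
  | continuum => [set: T] #= [set: set nat]
  end.

Definition tag_pi1 (I : Type) (Z Y : I -> Type) (p : {i : I & (Z i * Y i)%type}) :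
  {i : I & Z i} := existT Z (projT1 p) (projT2 p).1.

Definition borel_parametrizable (R : realType) (T : Type) (S : set (set T))
    (D : T -> T -> Prop) : Prop :=
  exists (Z Y : cplus -> standardBorel R)
         (phi : T -> {m : cplus & (Z m * Y m)%type}),
    [/\ forall m, type_card_is (Y m) m,
        bijective phi,
        borel_fun S
          (sum_borel (fun m => prod_borel (@borel R (Z m)) (@borel R (Y m))))
          phi &
        forall z z', D z z' <-> tag_pi1 (phi z) = tag_pi1 (phi z')].

(* Main.v *)
From HB Require Import structures.
Require Import Defs.
From mathcomp Require Import all_boot all_order all_algebra.
From mathcomp Require Import all_classical all_reals.
From mathcomp Require Import topology measure.
From mathcomp Require Import lra.

(* Code [X] in Baire space, so that [X / F] becomes a Borel set [Z] and the local fine shape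
   a Borel map [L] on [Z]; let [U] be the set of shapes with uncountable fibre.  Given a Borel
   [W] and a Borel [g : W -> U], adding for each [w] in [W] a new [F]-class of shape [g w] does
   not change gfs, because by the perfect set theorem the fibres over [U] have size continuum
   already.  If the enlarged pair is always isomorphic to [(E, F)], the isomorphisms provide
   injective Borel lifts of all such [g] along [L].

   Lifting the projection [U * Cantor -> U] and applying a Borel Schroeder-Bernstein argument
   identifies the part of [Z] above [U] with [U * Cantor]; the other fibres are enumerated by
   Lusin-Novikov.  This is a Borel parametrization as soon as [U] is Borel.  If [U] were not
   Borel, every well-founded tree would embed in the tree searching for a perfect subset of
   some countable fibre.  Lifting the map that sends such an embedding to the shape of the
   fibre then makes every sufficiently closed countable family of points (a model) contain
   another model, which is refuted by a liar paradox. *)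

Set Implicit Arguments.
Unset Strict Implicit.
Unset Printing Implicit Defensive.

Import Order.TTheory GRing.Theory Num.Theory.

Local Open Scope classical_set_scope.
Local Open Scope card_scope.

(** Lifts exist only for Borel maps into [U], which is a priori just analytic; so [U] times Cantor
    space cannot be used until [U] is known to be Borel, and this is the obstacle that the models
    remove. Meanwhile [W] has to be a Borel set of certificates of membership in [U]: embeddings of
    a tree that in fact has a branch. Boundedness of ranks explains why, for non-Borel [U], a
    well-founded tree embeds at a point outside [U]. A model without a branch of its tree therefore
    contains such an embedding, but no perfect scheme at that point, hence an enumeration of what it
    sees of the section. The Cantor coordinate of the lift serves to diagonalize against this
    enumeration. The models play the part of omega-models in effective theory, with closure under
    coded Borel functions in place of a formal theory; the contradiction is a semantic form of the
    second incompleteness theorem: it cannot be that models exist and that each of them contains a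
    model. Codes have to be points of Baire space, so Borel functions are handled through closed
    graphs, and closed sets through trees. *)

Definition baire := nat -> nat.

(** * Borel sets under countable logical operations *)

Section sigma_algebra_logic.
Context (T : Type) (S : set (set T)).
Hypothesis hS : sigma_algebra setT S.

Lemma sa_ext (A B : T -> Prop) : (forall x, A x <-> B x) -> S A -> S B.
Proof. by move=> AB; rewrite (_ : A = B)//; apply/funext => x; apply/propext. Qed.

Lemma sa_not A : S A -> S (fun x => ~ A x).
Proof.
by move=> /(let: And3 _ h _ := hS in h); apply: sa_ext => x; split=> [[]|?]; last split.
Qed.

Lemma sa_ex (A : nat -> T -> Prop) : (forall n, S (A n)) -> S (fun x => exists n, A n x).
Proof.
by move=> /(let: And3 _ _ h := hS in h); apply: sa_ext => x; split=> [[n _ ?]|[n ?]]; exists n.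
Qed.

Lemma sa_all (A : nat -> T -> Prop) : (forall n, S (A n)) -> S (fun x => forall n, A n x).
Proof.
move=> hA; apply: (@sa_ext (fun x => ~ exists n, ~ A n x)) => [x|].
  by split=> [h n|h [n]]; [apply: contrapT => hn; apply: h; exists n|apply].
by apply: sa_not; apply: sa_ex => n; apply: sa_not.
Qed.

Lemma sa_false : S (fun=> False).
Proof. by case: hS => h _ _; apply: sa_ext h => x; split. Qed.

Lemma sa_cst (P : Prop) : S (fun=> P).
Proof.
have [p|p] := pselect P; last by apply: sa_ext sa_false => x; split.
by apply: sa_ext (sa_not sa_false) => x; split=> // _ [].
Qed.

Lemma sa_or A B : S A -> S B -> S (fun x => A x \/ B x).
Proof.
move=> hA hB; apply: (@sa_ext (fun x => exists n : nat, (if n is 0 then A else B) x)).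
  move=> x; split=> [[[|n] h]|[h|h]]; [by left|by right|by exists 0|by exists 1].
by apply: sa_ex => -[|n].
Qed.

Lemma sa_and A B : S A -> S B -> S (fun x => A x /\ B x).
Proof.
move=> hA hB; apply: (@sa_ext (fun x => forall n : nat, (if n is 0 then A else B) x)).
  by move=> x; split=> [h|[h h'] [|n]//]; split; [apply: (h 0)|apply: (h 1)].
by apply: sa_all => -[|n].
Qed.

Lemma sa_imp A B : S A -> S B -> S (fun x => A x -> B x).
Proof.
move=> hA hB; apply: (@sa_ext (fun x => ~ A x \/ B x)); last exact: sa_or (sa_not hA) hB.
by move=> x; split=> [[h|h] h'//|h]; have [/h|] := pselect (A x); [right|left].
Qed.

Lemma sa_iff A B : S A -> S B -> S (fun x => A x <-> B x).
Proof. by move=> hA hB; apply: sa_and; apply: sa_imp. Qed.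

Lemma sa_exc (I : countType) (A : I -> T -> Prop) :
  (forall i, S (A i)) -> S (fun x => exists i, A i x).
Proof.
move=> hA; apply: (@sa_ext (fun x => exists n, if unpickle n is Some i then A i x else False)).
  move=> x; split=> [[n]|[i h]]; first by case: unpickle => // i; exists i.
  by exists (pickle i); rewrite pickleK.
by apply: sa_ex => n; case: (unpickle n : option I) => [i|]; [apply: hA|apply: sa_false].
Qed.

Lemma sa_allc (I : countType) (A : I -> T -> Prop) :
  (forall i, S (A i)) -> S (fun x => forall i, A i x).
Proof.
move=> hA; apply: (@sa_ext (fun x => ~ exists i, ~ A i x)) => [x|].
  by split=> [h i|h [i]]; [apply: contrapT => hn; apply: h; exists i|apply].
by apply: sa_not; apply: sa_exc => n; apply: sa_not.
Qed.

(** Measurability tested on fibres, which is adequate for countable targets; hence the [countType]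
    in [df_pred]. *)
Definition df (I : Type) (h : T -> I) := forall i, S (fun x => h x = i).

Lemma df_pred (I : countType) (h : T -> I) (A : I -> Prop) : df h -> S (fun x => A (h x)).
Proof.
move=> hh; apply: (@sa_ext (fun x => exists i, A i /\ h x = i)) => [x|].
  by split=> [[i [? ->]]//|]; exists (h x).
by apply: sa_exc => i; apply: sa_and (sa_cst _) (hh i).
Qed.

Lemma df_comp (I : countType) (J : Type) (F : I -> J) (h : T -> I) :
  df h -> df (fun x => F (h x)).
Proof. by move=> hh j; apply: (df_pred (fun i => F i = j) hh). Qed.

Lemma df_pair (I J : Type) (h : T -> I) (k : T -> J) :
  df h -> df k -> df (fun x => (h x, k x)).
Proof.
move=> hh hk [i j]; apply: sa_ext (sa_and (hh i) (hk j)) => x.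
by split=> [[-> ->]//|[-> ->]].
Qed.

Lemma df_comp2 (I J : countType) (K : Type) (F : I -> J -> K) h k :
  df h -> df k -> df (fun x => F (h x) (k x)).
Proof. by move=> hh hk; apply: (df_comp (fun p => F p.1 p.2) (df_pair hh hk)). Qed.

Lemma df_pred2 (I J : countType) (A : I -> J -> Prop) h k :
  df h -> df k -> S (fun x => A (h x) (k x)).
Proof. by move=> hh hk; apply: (df_pred (fun p => A p.1 p.2) (df_pair hh hk)). Qed.

Lemma df_cst (I : Type) (i : I) : df (fun=> i).
Proof. by move=> j; apply: sa_cst. Qed.

Definition bf (phi : T -> baire) := forall n, df (fun x => phi x n).

Lemma df_eval phi (k : T -> nat) : bf phi -> df k -> df (fun x => phi x (k x)).
Proof.
move=> hp hk i; apply: (@sa_ext (fun x => exists n, k x = n /\ phi x n = i)).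
  by move=> x; split=> [[n [-> ->]]//|h]; exists (k x).
by apply: sa_ex => n; apply: sa_and (hk n) (hp n i).
Qed.

Lemma df_mkseq phi n : bf phi -> df (fun x => mkseq (phi x) n).
Proof.
move=> hp; elim: n => [|n IH]; first exact: df_cst.
under eq_fun do rewrite mkseqS.
exact: df_comp2 IH (hp n).
Qed.

Lemma bf_eq phi psi : bf phi -> bf psi -> S (fun x => phi x = psi x).
Proof.
move=> hp hq; apply: (@sa_ext (fun x => forall n, phi x n = psi x n)).
  by move=> x; split=> [/funext//|->].
by apply: sa_all => n; apply: df_pred2.
Qed.

Lemma sa_if (P A B : T -> Prop) : S P -> S A -> S B ->
  S (fun x => if pselect (P x) then A x else B x).
Proof.
move=> hP hA hB; apply: (@sa_ext (fun x => P x /\ A x \/ ~ P x /\ B x)) => [x|].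
  by case: pselect => p; split=> [[[]|[]]|]//; [left|right].
by apply: sa_or; apply: sa_and => //; apply: sa_not.
Qed.

Lemma bf_if (P : T -> Prop) phi psi : S P -> bf phi -> bf psi ->
  bf (fun x => if pselect (P x) then phi x else psi x).
Proof.
move=> hP hp hq n i; apply: sa_ext (sa_if hP (hp n i) (hq n i)) => x.
by case: pselect.
Qed.

End sigma_algebra_logic.

(* [0] when no such number exists *)
Definition least (A : nat -> Prop) : nat :=
  xget 0 [set n | A n /\ forall m, m < n -> ~ A m].

Lemma leastP (A : nat -> Prop) : (exists n, A n) ->
  A (least A) /\ forall m, m < least A -> ~ A m.
Proof.
case=> n An; have ex : exists n, `[< A n >] by exists n; apply/asboolP.
have : [set n | A n /\ forall m, m < n -> ~ A m] (ex_minn ex).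
  case: ex_minnP => m /asboolP Am h; split=> // k km /asboolP/h.
  by rewrite leqNgt km.
by move/(xgetI 0).
Qed.

Lemma least_unique (A : nat -> Prop) n : A n -> (forall m, m < n -> ~ A m) -> least A = n.
Proof.
move=> An h; have [|h1 h2] := @leastP A; first by exists n.
by case: (ltngtP (least A) n) => // [/h|/h2].
Qed.

Lemma least0 (A : nat -> Prop) : (forall n, ~ A n) -> least A = 0.
Proof. by move=> h; apply: xgetPN => n [/h]. Qed.

Lemma df_least (T : Type) (S : set (set T)) (hS : sigma_algebra setT S)
  (A : T -> nat -> Prop) :
  (forall n, S (fun x => A x n)) -> df S (fun x => least (A x)).
Proof.
move=> hA k; apply: (@sa_ext _ _ (fun x => (A x k /\ forall m, m < k -> ~ A x m) \/
  (k = 0 /\ forall n, ~ A x n))) => [x|]; last first.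
  apply: sa_or => //; apply: sa_and => //; first last.
  - by apply: sa_all => // n; apply: sa_not.
  - exact: sa_cst.
  - by apply: sa_all => // m; apply: sa_imp => //; [apply: sa_cst|apply: sa_not].
split=> [[[? ?]|[-> ?]]|]; [exact: least_unique|exact: least0|].
move=> <-; have [/leastP|h] := pselect (exists n, A x n); first by left.
right; split; first by apply: least0 => n ?; apply: h; exists n.
by move=> n ?; apply: h; exists n.
Qed.

(** * Baire space: Borel sets and coding operations *)

Definition BN : set (set baire) :=
  <<s [set [set y : baire | y nk.1 = nk.2] | nk in [set: nat * nat]] >>.

Lemma BNs : sigma_algebra setT BN.
Proof. exact: smallest_sigma_algebra. Qed.
#[global] Hint Resolve BNs : core.

Lemma bf_id : bf BN id.
Proof. by move=> n k; apply: sub_sigma_algebra; exists (n, k). Qed.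
#[global] Hint Resolve bf_id : core.

Lemma bf_preim (T : Type) (S : set (set T)) (hS : sigma_algebra setT S) phi B :
  bf S phi -> BN B -> S (fun x => B (phi x)).
Proof.
move=> hp; apply: (@smallest_sub _ _ _ [set B | S (fun x => B (phi x))]).
  split=> [|A|A] /=; first exact: sa_false.
    move=> hA; by apply: sa_ext (sa_not hS hA) => x; split=> [?|[]].
  move=> hA; apply: sa_ext (sa_ex hS hA) => x.
  by split=> [[n ?]|[n _ ?]]; exists n.
by move=> _ [[n k] _ <-] /=; apply: hp.
Qed.

Lemma bf_comp (T : Type) (S : set (set T)) (hS : sigma_algebra setT S) phi psi :
  bf BN psi -> bf S phi -> bf S (fun x => psi (phi x)).
Proof. by move=> hq hp n k; apply: bf_preim hp (hq n k). Qed.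

Definition lft (y : baire) : baire := fun n => y n.*2.
Definition rgt (y : baire) : baire := fun n => y n.*2.+1.
Definition pr (a b : baire) : baire := fun n => if odd n then b n./2 else a n./2.
Definition bcol (y : baire) (i : nat) : baire := fun n => y (pickle (i, n)).
(** Entries outside the image of [pickle] are [0], so [jn (bcol y)] may differ from [y]; this is why
    [uop] lists it as an operation. *)
Definition jn (f : nat -> baire) : baire :=
  fun m => if (unpickle m : option (nat * nat)) is Some (i, n) then f i n else 0.
Definition cns (k : nat) (y : baire) : baire := fun n => if n is m.+1 then y m else k.
Definition tl (y : baire) : baire := fun n => y n.+1.

Lemma lft_pr a b : lft (pr a b) = a.
Proof. by apply/funext => n; rewrite /lft /pr odd_double doubleK. Qed.

Lemma rgt_pr a b : rgt (pr a b) = b.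
Proof. by apply/funext => n; rewrite /rgt /pr /= odd_double uphalf_double. Qed.

Lemma pr_eta y : pr (lft y) (rgt y) = y.
Proof.
apply/funext => n; rewrite /pr /lft /rgt -[in RHS](odd_double_half n).
by case: (odd n).
Qed.

Lemma col_jn f i : bcol (jn f) i = f i.
Proof. by apply/funext => n; rewrite /bcol /jn pickleK. Qed.

Lemma tl_cns k y : tl (cns k y) = y. Proof. by []. Qed.

Lemma cns_tl y : cns (y 0) (tl y) = y.
Proof. by apply/funext => -[]. Qed.

Section bf_ops.
Context (T : Type) (S : set (set T)).
Hypothesis hS : sigma_algebra setT S.
Implicit Types phi psi : T -> baire.

Lemma bf_lft phi : bf S phi -> bf S (fun x => lft (phi x)).
Proof. by move=> h n; apply: h. Qed.

Lemma bf_rgt phi : bf S phi -> bf S (fun x => rgt (phi x)).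
Proof. by move=> h n; apply: h. Qed.

Lemma bf_tl phi : bf S phi -> bf S (fun x => tl (phi x)).
Proof. by move=> h n; apply: h. Qed.

Lemma bf_col phi i : bf S phi -> bf S (fun x => bcol (phi x) i).
Proof. by move=> h n; apply: h. Qed.

Lemma bf_pr phi psi : bf S phi -> bf S psi -> bf S (fun x => pr (phi x) (psi x)).
Proof. by move=> h h' n; rewrite /pr; case: odd. Qed.

Lemma bf_jn (f : nat -> T -> baire) : (forall i, bf S (f i)) -> bf S (fun x => jn (f^~ x)).
Proof.
move=> h n; rewrite /jn; case: (unpickle n : option (nat * nat)) => [[i m]|] //.
  exact: h.
exact: df_cst.
Qed.

Lemma bf_cns (k : T -> nat) phi : df S k -> bf S phi -> bf S (fun x => cns (k x) (phi x)).
Proof. by move=> hk h [|n] //; apply: h. Qed.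

Lemma bf_cst (y : baire) : bf S (fun=> y).
Proof. by move=> n; apply: df_cst. Qed.

End bf_ops.

(** * Continuity, closed sets, and closed graphs of Borel functions *)

Definition agree n (y y' : baire) := forall i, i < n -> y i = y' i.

Lemma agree_mkseq n y y' : agree n y y' <-> mkseq y n = mkseq y' n.
Proof.
split=> [h|h i im].
  apply: (@eq_from_nth _ 0); rewrite !size_mkseq// => i im.
  by rewrite !nth_mkseq// h.
by have := congr1 (fun s => nth 0 s i) h; rewrite /= !nth_mkseq.
Qed.

Lemma agreeW n m y y' : n <= m -> agree m y y' -> agree n y y'.
Proof. by move=> nm h i ?; apply: h; apply: leq_trans nm. Qed.

Lemma agree_sym n y y' : agree n y y' -> agree n y' y.
Proof. by move=> h i /h. Qed.

Lemma agree_pr n a b a' b' : agree n a a' -> agree n b b' -> agree n (pr a b) (pr a' b').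
Proof.
move=> h h' i im; rewrite /pr; have hi : i./2 < n.
  by apply: leq_ltn_trans im; rewrite leq_half_double -addnn leqW ?leq_addr.
by case: odd; [apply: h'|apply: h].
Qed.

Definition cont (phi : baire -> baire) :=
  forall n, exists m, forall y y', agree m y y' -> phi y n = phi y' n.

Lemma cont_agree phi n : cont phi -> exists m, forall y y', agree m y y' -> agree n (phi y) (phi y').
Proof.
move=> hp; elim: n => [|n [m hm]]; first by exists 0.
have [k hk] := hp n; exists (maxn m k) => y y' h i.
rewrite ltnS leq_eqVlt => /orP[/eqP->|im].
  by apply: hk; apply: agreeW h; apply: leq_maxr.
by apply: hm im; apply: agreeW h; apply: leq_maxl.
Qed.

Lemma cont_index (f : nat -> nat) : cont (fun y => fun n => y (f n)).
Proof. by move=> n; exists (f n).+1 => y y'; apply. Qed.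

Lemma cont_pr phi psi : cont phi -> cont psi -> cont (fun y => pr (phi y) (psi y)).
Proof. by move=> hp hq n; rewrite /pr; case: odd. Qed.

Lemma cont_comp phi psi : cont psi -> cont phi -> cont (fun y => psi (phi y)).
Proof.
move=> hq hp n; have [m hm] := hq n; have [k hk] := cont_agree m hp.
by exists k => y y' /hk/hm.
Qed.

Lemma cont_lft : cont lft. Proof. exact: cont_index. Qed.
Lemma cont_rgt : cont rgt. Proof. exact: cont_index. Qed.
Lemma cont_tl : cont tl. Proof. exact: cont_index. Qed.
Lemma cont_col i : cont (bcol^~ i). Proof. exact: cont_index. Qed.
Lemma cont_id : cont id. Proof. exact: cont_index. Qed.
Lemma cont_cst z : cont (fun=> z). Proof. by move=> n; exists 0. Qed.
#[global] Hint Resolve cont_lft cont_rgt cont_tl cont_col cont_id cont_cst : core.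

Definition clos (C : baire -> Prop) :=
  forall y, (forall n, exists y', agree n y y' /\ C y') -> C y.

(** Decided by an initial segment of fixed length (agreement is symmetric, so one implication
    suffices). Such sets are allowed as premises in [clos_imp]. *)
Definition fd (A : baire -> Prop) := exists m, forall y y', agree m y y' -> A y -> A y'.

Lemma clos_ext (C D : baire -> Prop) : (forall y, C y <-> D y) -> clos C -> clos D.
Proof. by move=> CD; rewrite (_ : C = D)//; apply/funext => x; apply/propext. Qed.

Lemma clos_preim phi C : cont phi -> clos C -> clos (fun y => C (phi y)).
Proof.
move=> hp hC y hy; apply: hC => n; have [m hm] := cont_agree n hp.
by have [y' [/hm ? ?]] := hy m; exists (phi y').
Qed.

Lemma clos_fd A : fd A -> clos A.
Proof. by move=> [m hm] y /(_ m) [y' [/agree_sym/hm h /h]]. Qed.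

Lemma clos_all (I : Type) (C : I -> baire -> Prop) :
  (forall i, clos (C i)) -> clos (fun y => forall i, C i y).
Proof.
by move=> hC y hy i; apply: hC => n; have [y' [? ?]] := hy n; exists y'.
Qed.

Lemma clos_and C D : clos C -> clos D -> clos (fun y => C y /\ D y).
Proof.
move=> hC hD y hy; split; [apply: hC|apply: hD] => n;
  by have [y' [? []]] := hy n; exists y'.
Qed.

Lemma clos_or C D : clos C -> clos D -> clos (fun y => C y \/ D y).
Proof.
move=> hC hD y hy; have [|nC] := pselect (C y); [by left|right].
have [n hn] : exists n, forall y', agree n y y' -> ~ C y'.
  apply: contrapT => h; apply: nC; apply: hC => n; apply: contrapT => h'.
  by apply: h; exists n => y' ? ?; apply: h'; exists y'.
apply: hD => m; have [y' [ha [Cy|Dy]]] := hy (maxn n m).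
  by exfalso; apply: hn Cy; apply: agreeW ha; apply: leq_maxl.
by exists y'; split=> //; apply: agreeW ha; apply: leq_maxr.
Qed.

Lemma clos_imp A C : fd A -> clos C -> clos (fun y => A y -> C y).
Proof.
move=> [m hm] hC y hy Ay; apply: hC => n.
have [y' [ha h]] := hy (maxn m n); exists y'; split.
  by apply: agreeW ha; apply: leq_maxr.
by apply: h; apply: hm Ay; apply: agreeW ha; apply: leq_maxl.
Qed.

Lemma fd_pred (A : nat -> Prop) i : fd (fun y => A (y i)).
Proof. by exists i.+1 => y y' h; rewrite h. Qed.

Lemma fd_pred2 (A : nat -> nat -> Prop) i j : fd (fun y => A (y i) (y j)).
Proof.
by exists (maxn i j).+1 => y y' h; rewrite !h// ltnS ?leq_maxl ?leq_maxr.
Qed.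

Lemma clos_eq phi psi : cont phi -> cont psi -> clos (fun y => phi y = psi y).
Proof.
move=> hp hq; apply: (@clos_ext (fun y => forall n, phi y n = psi y n)).
  by move=> y; split=> [/funext//|->].
apply: clos_all => n; apply: clos_fd; have [m hm] := hp n; have [k hk] := hq n.
exists (maxn m k) => y y' h.
rewrite (hm y y') ?(hk y y')//; apply: agreeW h; [exact: leq_maxr|exact: leq_maxl].
Qed.

(* Graph of the characteristic function of a countable union: [v] lists witnesses
   for all the sets, the head tells whether some set holds, and which first. *)
Definition opU (v : baire) : baire :=
  cns (if pselect (exists n, bcol v n 0 = 0) then 0 else 1)
    (cns (least (fun n => bcol v n 0 = 0)) v).
(** Complementation, with head [0] standing for true. The old value is kept as the tail, so that
    closed graphs stay closed. *)
Definition flip (y : baire) : baire := cns (y 0 == 0) y.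
(** Recovers a point from truth values: column [pickle (n, k)] tells whether entry [n] is [k]. *)
Definition hdec (v : baire) : baire :=
  fun n => least (fun k => bcol v (pickle (n, k)) 0 = 0).

(** The first field of [o] selects the operation, the others are parameters. A single countable
    index type makes closure under all of them one countable condition. *)
Definition uop (o : nat * nat * nat) (y : baire) : baire :=
  match o.1.1 with
  | 0 => lft y | 1 => rgt y | 2 => jn (bcol y) | 3 => opU y | 4 => flip y
  | 5 => hdec y | 6 => fun=> o.1.2 | 7 => fun=> y o.1.2 != o.2
  | _ => bcol y o.1.2 end.

Definition solves (d w : baire) (n : nat) (y : baire) :=
  forall m, d (pickle (n, mkseq w m, mkseq y m)) = 0.

(* Families of points that are closed under all Borel functions having a code
   in the family; this is what [borel_hyp] below proves. *)
Definition good (A : baire -> Prop) :=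
  [/\ forall o y, A y -> A (uop o y),
      forall a b, A a -> A b -> A (pr a b) &
      forall d w, A d -> A w -> (forall n, exists y, A y /\ solves d w n y) ->
        exists y, A y /\ forall n, solves d w n (bcol y n)].

(** The point [c] acts as a Borel code: any good family with the columns of [c] among its members
    can evaluate [phi]. *)
Definition hyp (phi : baire -> baire) := exists c, forall A, good A ->
  (forall i, A (bcol c i)) -> forall w, A w -> A (phi w).

(** The code accepts two sequences when a single point of [C n] extends both; closedness recovers
    [C n] from this tree. *)
Lemma code_solves (C : nat -> baire -> Prop) : (forall n, clos (C n)) ->
  exists d, forall w n y, solves d w n y <-> C n (pr w y).
Proof.
move=> hC.
pose ok (n : nat) a b := exists w y, mkseq w (size a) = a /\ mkseq y (size b) = b /\ C n (pr w y).
exists (fun k => if (unpickle k : option (nat * seq nat * seq nat)) is Some (n, a, b)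
  then (if pselect (ok n a b) then 0 else 1) else 1) => w n y; split=> h.
  apply: hC => m; have := h m; rewrite pickleK; case: pselect => // -[w' [y' [hw [hy Cw]]]] _.
  exists (pr w' y'); split=> //.
  by rewrite !size_mkseq in hw hy; apply: agree_pr; apply/agree_mkseq.
move=> m; rewrite pickleK; case: pselect => // -[]; exists w, y.
by rewrite !size_mkseq.
Qed.

Lemma uop_bf o : bf BN (uop o).
Proof.
have hc : forall i, bf BN (bcol^~ i) by move=> i; apply: bf_col.
rewrite /uop; case: o => -[t i] j /=.
case: t => [|[|[|[|[|[|[|[|t]]]]]]]] //.
- exact: bf_lft.
- exact: bf_rgt.
- exact: bf_jn.
- apply: bf_cns; last by apply: bf_cns => //; apply: df_least => // n; apply: (hc n 0 0).
  move=> k; apply: (@sa_ext _ BN (fun y => if pselect (exists n, bcol y n 0 = 0) then 0 = k else 1 = k)).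
    by move=> y; case: pselect.
  apply: (sa_if BNs); [|exact: sa_cst|exact: sa_cst].
  by apply: (sa_ex BNs) => n; apply: (hc n 0 0).
- apply: bf_cns => //; exact: (df_comp BNs (fun k => nat_of_bool (k == 0)) (bf_id 0)).
- move=> n; apply: df_least => // k; exact: (hc _ 0 0).
- exact: bf_cst.
- move=> _; exact: (df_comp BNs (fun k => nat_of_bool (k != j)) (bf_id i)).
Qed.

Lemma hyp_join (c : nat -> baire) (d : baire) : exists e, (exists k, bcol e k = d) /\
  forall n i, exists k, bcol e k = bcol (c n) i.
Proof.
exists (jn (fun m => if m is m'.+1 then
  (if (unpickle m' : option (nat * nat)) is Some (n, i) then bcol (c n) i else d) else d)).
split=> [|n i]; first by exists 0; rewrite col_jn.
by exists (pickle (n, i)).+1; rewrite col_jn pickleK.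
Qed.

(** All the closed graphs have one common code [d]. The last clause of [good] yields one member
    whose columns solve all of them, and a solution of a graph is the value. *)
Lemma hyp_seq (phi : nat -> baire -> baire) : (forall n, hyp (phi n)) ->
  (forall n, clos (fun p => rgt p = phi n (lft p))) ->
  hyp (fun w => jn (phi^~ w)).
Proof.
move=> hp cp; have [c hc] := choice hp.
have [d hd] := code_solves cp.
have [e [[k ek] he]] := hyp_join c d.
exists e => A gA eA w Aw; have [uA _ sA] := gA.
have [||n|y [Ay hy]] := sA d w => //.
- by rewrite -ek.
- exists (phi n w); split; last by apply/hd; rewrite rgt_pr lft_pr.
  by apply: hc => // i; have [j <-] := he n i.
have := uA (2, 0, 0) y Ay; rewrite /uop /=.
suff -> : bcol y = phi^~ w by [].
by apply/funext => n; have /hd := hy n; rewrite rgt_pr lft_pr.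
Qed.

Lemma clos_flip phi : clos (fun p => rgt p = phi (lft p)) ->
  clos (fun p => rgt p = flip (phi (lft p))).
Proof.
move=> cp; apply: (@clos_ext (fun p => (rgt p 0 = (rgt p 1 == 0)) /\
  rgt (pr (lft p) (tl (rgt p))) = phi (lft (pr (lft p) (tl (rgt p)))))).
  move=> p; rewrite rgt_pr lft_pr; split=> [[h <-]|->]; last by split.
  by apply/funext => -[|n]; rewrite /flip /=.
apply: clos_and; first by apply: clos_fd; apply: (fd_pred2 (fun a b => a = (b == 0) :> nat) 1 3).
apply: (clos_preim (phi := fun p => pr (lft p) (tl (rgt p)))) cp.
by apply: cont_pr => //; apply: cont_comp.
Qed.

(** That no column has head [0] is a closed condition; that some column has becomes closed once the
    first such index is recorded. The graph is thus cut out by a disjunction of two closed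
    conditions. *)
Lemma clos_opU (phi : nat -> baire -> baire) :
  (forall n, clos (fun p => rgt p = phi n (lft p))) ->
  clos (fun p => rgt p = opU (jn (phi^~ (lft p)))).
Proof.
move=> cp; pose v p := tl (tl (rgt p)).
have cv : cont v by apply: cont_comp => //; apply: cont_comp.
have cvp n : cont (fun p => pr (lft p) (bcol (v p) n)).
  by apply: cont_pr => //; apply: (cont_comp (psi := bcol^~ n)).
have f0 i (A : nat -> Prop) : fd (fun p => A (rgt p i)) by apply: fd_pred.
have fv i j (A : nat -> Prop) : fd (fun p => A (bcol (v p) i j)).
  by rewrite /v /bcol /tl /rgt; apply: fd_pred.
(* The columns do not see the entries outside the image of [pickle]; the first equation fixes
   them. *)
apply: (@clos_ext (fun p => v p = jn (bcol (v p)) /\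
  (forall n, rgt (pr (lft p) (bcol (v p) n)) = phi n (lft (pr (lft p) (bcol (v p) n)))) /\
  ((rgt p 0 = 0 /\ forall n, rgt p 1 = n -> bcol (v p) n 0 = 0 /\
      forall m, m < n -> bcol (v p) m 0 <> 0) \/
   ((rgt p 0 = 1 /\ rgt p 1 = 0) /\ forall n, bcol (v p) n 0 <> 0)))); last first.
  apply: clos_and.
    apply: clos_eq => // n; rewrite /jn; case: (unpickle n : option (nat * nat)) => [[i m]|].
      by have [k hk] := cont_comp (cont_col i) cv m; exists k.
    by exists 0.
  apply: clos_and; first by apply: clos_all => n; apply: clos_preim (cvp n) (cp n).
  apply: clos_or; apply: clos_and.
  - by apply: clos_fd; apply: (f0 _ (fun a => a = 0)).
  - apply: clos_all => n; apply: clos_imp; first exact: (f0 _ (fun a => a = n)).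
    apply: clos_and; first by apply: clos_fd; apply: (fv _ _ (fun a => a = 0)).
    by apply: clos_all => m; apply: clos_all => _; by apply: clos_fd; apply: (fv _ _ (fun a => a <> 0)).
  - by apply: clos_and; apply: clos_fd; [apply: (f0 _ (fun a => a = 1))|apply: (f0 _ (fun a => a = 0))].
  - by apply: clos_all => n; by apply: clos_fd; apply: (fv _ _ (fun a => a <> 0)).
move=> p; set q := rgt p.
have vE : q = cns (q 0) (cns (q 1) (v p)) by rewrite /v -/q; apply/funext => -[|[]].
split=> [[hv [hn h]]|hq].
  have hc : bcol (v p) = phi^~ (lft p).
    by apply/funext => n; have := hn n; rewrite rgt_pr lft_pr.
  rewrite -hc -hv vE /opU; case: h => [[h0 h1]|[[h0 h1] h2]].
    have [h3 h4] := h1 _ erefl.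
    by rewrite h0 (least_unique h3 h4); case: pselect => // e; case: e; exists (q 1).
  by rewrite h0 h1 least0//; case: pselect => // e; exfalso; case: e => n /h2.
have hv : v p = jn (phi^~ (lft p)) by rewrite /v -/q hq.
rewrite hv; split; first by congr jn; apply/funext => i; rewrite col_jn.
split; first by move=> n; rewrite rgt_pr lft_pr col_jn.
rewrite hq /opU /=; case: pselect => h.
  by left; split=> // n <-; apply: leastP.
by right; split; [split=> //; apply: least0 => n ?|move=> n ?]; apply: h; exists n.
Qed.

(** Induction over the sigma-algebra. The value [phi w] is a unique closed witness for the answer in
    its head, which is what Lusin-Souslin and the coding of functions both rest on. *)
Lemma borel_graph B : BN B -> exists phi,
  [/\ bf BN phi, clos (fun p => rgt p = phi (lft p)), hyp phi &
      forall w, B w <-> phi w 0 = 0].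
Proof.
apply: (@smallest_sub _ _ _ [set B | exists phi,
  [/\ bf BN phi, clos (fun p => rgt p = phi (lft p)), hyp phi &
      forall w, B w <-> phi w 0 = 0]]); first split=> [|A|A] /=.
- exists (fun=> fun=> 1); split=> //; first exact: bf_cst.
    exact: clos_eq.
  by exists (fun=> 0) => A [uA _ _] _ w /(uA (6, 1, 0)).
- move=> [phi [p1 p2 [c hc] p4]]; exists (fun w => flip (phi w)); split.
  + by apply: bf_comp p1 => //; apply: (uop_bf (4, 0, 0)).
  + exact: clos_flip.
  + by exists c => A' gA cA w /(hc _ gA cA); apply: (let: And3 h _ _ := gA in h (4, 0, 0)).
  + move=> w; split=> [[_ h]|h]; rewrite /flip /=.
      by case: eqP => // /p4/h.
    by split=> // /p4 h'; move: h; rewrite /flip /= h'.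
- move=> /choice [phi hp].
  have p1 n : bf BN (phi n) by case: (hp n).
  have p2 n : clos (fun p => rgt p = phi n (lft p)) by case: (hp n).
  have p3 n : hyp (phi n) by case: (hp n).
  have p4 n w : A n w <-> phi n w 0 = 0 by case: (hp n).
  exists (fun w => opU (jn (phi^~ w))); split.
  + by apply: bf_comp (bf_jn _ p1) => //; apply: (uop_bf (3, 0, 0)).
  + exact: clos_opU.
  + have [c hc] := hyp_seq p3 p2.
    by exists c => A' gA cA w /(hc _ gA cA); apply: (let: And3 h _ _ := gA in h (3, 0, 0)).
  + move=> w; rewrite /opU /=; case: pselect => h /=.
      split=> // _; case: h => n; rewrite col_jn => /p4 An; by exists n.
    by split=> // -[n _ /p4 h']; exfalso; apply: h; exists n; rewrite col_jn.
move=> _ [[n k] _ <-] /=.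
exists (uop (7, n, k)); split.
- exact: uop_bf.
- apply: clos_eq => //; rewrite /uop /= => i.
  by exists n.*2.+1 => y y' h; rewrite /lft h.
- by exists (fun=> 0) => A [uA _ _] _ w /(uA (7, n, k)).
- by move=> w; rewrite /uop /=; split=> [->|]; [rewrite eqxx|case: eqP].
Qed.

(** The codes of the countably many sets where entry [n] is [k] are merged, and [hdec] reads the
    value off the answers. *)
Lemma borel_hyp phi : bf BN phi -> hyp phi.
Proof.
move=> hp.
have /choice[psi hpsi] m : exists psi, [/\ bf BN psi, clos (fun p => rgt p = psi (lft p)),
    hyp psi & forall w, (if (unpickle m : option (nat * nat)) is Some (n, k)
      then phi w n = k else False) <-> psi w 0 = 0].
  apply: borel_graph; case: (unpickle m : option (nat * nat)) => [[n k]|]; last exact: sa_false.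
  exact: hp.
have [|n|c hc] := @hyp_seq psi; [by move=> n; case: (hpsi n)|by case: (hpsi n)|].
exists c => A gA cA w /(hc _ gA cA) /(let: And3 h _ _ := gA in h (5, 0, 0)).
rewrite /uop /= /hdec; congr A; apply/funext => n.
have e k : bcol (jn (psi^~ w)) (pickle (n, k)) 0 = 0 <-> phi w n = k.
  by have [_ _ _ /(_ w)] := hpsi (pickle (n, k)); rewrite pickleK col_jn => ->.
by apply: least_unique => [|m mk /e h]; [apply/e|rewrite -h ltnn in mk].
Qed.

(** * Analytic sets: separation, Lusin-Souslin and uniformization *)

Definition pfx (u : seq nat) (y : baire) := mkseq y (size u) = u.

Lemma pfx_nil y : pfx [::] y. Proof. by []. Qed.

Lemma pfx_mkseq y n : pfx (mkseq y n) y.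
Proof. by rewrite /pfx size_mkseq. Qed.

Lemma pfx_rcons u y : pfx u y -> pfx (rcons u (y (size u))) y.
Proof. by rewrite /pfx size_rcons mkseqS => ->. Qed.

Lemma take_mkseq k n (y : baire) : k <= n -> take k (mkseq y n) = mkseq y k.
Proof. by move=> kn; rewrite /mkseq -map_take take_iota; move/minn_idPl: kn => ->. Qed.

Lemma pfx_take k u y : pfx u y -> pfx (take k u) y.
Proof.
move=> h; have [ku|ku] := leqP k (size u); last by rewrite take_oversize// ltnW.
by rewrite /pfx size_takel// -[in RHS]h take_mkseq.
Qed.

Lemma pfx_agree u y y' : pfx u y -> pfx u y' -> agree (size u) y y'.
Proof. by move=> h h'; apply/agree_mkseq; rewrite h h'. Qed.

Lemma pfx_nth u y i : pfx u y -> i < size u -> y i = nth 0 u i.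
Proof. by move=> <-; rewrite size_mkseq => iu; rewrite nth_mkseq. Qed.

Lemma agree_pfx u y y' : agree (size u) y y' -> pfx u y -> pfx u y'.
Proof. by move=> /agree_mkseq; rewrite /pfx => ->. Qed.

Lemma fd_pfx (phi : baire -> baire) u : cont phi -> fd (fun y => pfx u (phi y)).
Proof.
by move=> /(cont_agree (size u))[m hm]; exists m => y y' /hm; apply: agree_pfx.
Qed.

Lemma sa_pfx T (S : set (set T)) (hS : sigma_algebra setT S) phi u :
  bf S phi -> S (fun x => pfx u (phi x)).
Proof.
move=> hp; apply: (df_pred hS (fun s => s = u)); exact: df_mkseq.
Qed.

Lemma dep_choice (I : Type) (Bad : seq I -> Prop) : Bad [::] ->
  (forall u, Bad u -> exists i, Bad (rcons u i)) ->
  exists y : nat -> I, forall n, Bad (mkseq y n).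
Proof.
move=> h0 hs; have [i0 _] := hs _ h0.
have /choice[nxt hn] : forall u, exists i, Bad u -> Bad (rcons u i).
  move=> u; have [/hs[i hi]|hu] := pselect (Bad u); first by exists i.
  by exists i0.
pose s n := iter n (fun u => rcons u (nxt u)) [::].
exists (fun n => nxt (s n)) => n.
have -> : mkseq (fun n => nxt (s n)) n = s n.
  by elim: n => // n IH; rewrite mkseqS IH.
by elim: n => //= n; apply: hn.
Qed.

Definition an (A : baire -> Prop) :=
  exists C, clos C /\ forall y, A y <-> exists q, C (pr y q).

(** The second half of a witness is the value of the function from [borel_graph], so the first half
    determines it. Sections of [K] and of [C] then correspond bijectively, which carries
    countability from one to the other. *)
Lemma an_proj (K : baire -> baire -> Prop) :
  BN (fun p => K (lft p) (rgt p)) -> exists C, [/\ clos C,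
    forall y q, C (pr y q) -> K y (lft q), forall y q, K y q -> exists t, C (pr y (pr q t)) &
    forall y q q', C (pr y q) -> C (pr y q') -> lft q = lft q' -> q = q'].
Proof.
move=> /borel_graph[phi [p1 p2 _ p4]].
exists (fun p => rgt (rgt p) = phi (pr (lft p) (lft (rgt p))) /\ rgt (rgt p) 0 = 0); split.
- apply: clos_and; last by apply: clos_fd; apply: (fd_pred (fun a => a = 0) 3).
  apply: clos_ext (clos_preim (phi := fun p => pr (pr (lft p) (lft (rgt p))) (rgt (rgt p))) _ p2).
    by move=> p /=; rewrite rgt_pr lft_pr.
  by do ?apply: cont_pr => //; apply: cont_comp.
- move=> y q; rewrite !rgt_pr lft_pr => -[h1 h2].
  by have /p4 := etrans (congr1 (fun f => f 0) (esym h1)) h2; rewrite rgt_pr lft_pr.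
- move=> y q h; exists (phi (pr y q)); rewrite !(rgt_pr, lft_pr); split=> //.
  by apply/p4; rewrite rgt_pr lft_pr.
- move=> y q q'; rewrite !(rgt_pr, lft_pr) => -[h _] [h' _] e.
  by rewrite -(pr_eta q) -(pr_eta q') h h' e.
Qed.

Lemma an_borel_proj (K : baire -> baire -> Prop) :
  BN (fun p => K (lft p) (rgt p)) -> an (fun y => exists q, K y q).
Proof.
move=> /an_proj[C [c1 c2 c3 _]]; exists C; split=> // y; split=> [[q /c3[t ?]]|[q /c2 ?]].
  by exists (pr q t).
by exists (lft q).
Qed.

Definition sep (A A' : baire -> Prop) := exists B : baire -> Prop,
  [/\ BN B, forall y, A y -> B y & forall y, A' y -> ~ B y].

(** Countably many separators combine, so an inseparable pair of pieces has an inseparable pair of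
    smaller pieces. Iterating leads to a common point of [A] and [A']. *)
Lemma separation A A' : an A -> an A' -> (forall y, A y -> A' y -> False) -> sep A A'.
Proof.
move=> [C [hC AC]] [C' [hC' AC']] dis; apply: contrapT => nsep.
pose P (D : baire -> Prop) a u y := pfx a y /\ exists q, pfx u q /\ D (pr y q).
(* A triple holds the next entry of the point, of its witness for [C] and of its witness for [C'];
   both pieces share the first. *)
pose Bad (w : seq (nat * nat * nat)) :=
  ~ sep (P C [seq x.1.1 | x <- w] [seq x.1.2 | x <- w])
        (P C' [seq x.1.1 | x <- w] [seq x.2 | x <- w]).
have [||y hy] := @dep_choice _ Bad.
- move=> [B [bB hB hB']]; apply: nsep; exists B; split=> //.
    by move=> y /AC[q ?]; apply: hB; split; [exact: pfx_nil|exists q; split; first exact: pfx_nil].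
  by move=> y /AC'[q ?]; apply: hB'; split; [exact: pfx_nil|exists q; split; first exact: pfx_nil].
- move=> w; rewrite /Bad; set a := map _ w; set u := map _ w; set v := map _ w => hw.
  apply: contrapT => /forallNP h; apply: hw.
  have /choice[B hB] : forall x : nat * nat * nat, exists B, [/\ BN B,
      forall y, P C (rcons a x.1.1) (rcons u x.1.2) y -> B y &
      forall y, P C' (rcons a x.1.1) (rcons v x.2) y -> ~ B y].
    by move=> x; have /contrapT := h x; rewrite !map_rcons -/a -/u -/v => -[B ?]; exists B.
  (* With [i] fixed by the point, [j] runs over the pieces of [A] and [k] over those of [A']: a
     union of intersections of separators. *)
  exists (fun y => exists i, y (size a) = i /\ exists j, forall k, B (i, j, k) y); split.
  + apply: (sa_ex BNs) => i; apply: (sa_and BNs); first exact: bf_id.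
    apply: (sa_ex BNs) => j; apply: (sa_all BNs) => k; by case: (hB (i, j, k)).
  + move=> y [ay [q [uq Cq]]]; exists (y (size a)); split=> //.
    exists (q (size u)) => k; have [_ + _] := hB (y (size a), q (size u), k); apply.
    by split; [apply: pfx_rcons|exists q; split=> //; apply: pfx_rcons].
  + move=> y [ay [q [vq Cq]]] [_ [<- [j /(_ (q (size v)))]]].
    have [_ _] := hB (y (size a), j, q (size v)); apply.
    by split; [apply: pfx_rcons|exists q; split=> //; apply: pfx_rcons].
have mE (f : nat * nat * nat -> nat) n : [seq f x | x <- mkseq y n] = mkseq (f \o y) n.
  by rewrite /mkseq -map_comp.
have lim (D : baire -> Prop) (f : nat * nat * nat -> nat) : clos D ->
    (forall n, exists z, P D (mkseq (fun i => (y i).1.1) n) (mkseq (f \o y) n) z) ->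
    D (pr (fun i => (y i).1.1) (f \o y)).
  move=> hD h; apply: hD => n; have [z [pz [q [pq Dq]]]] := h n.
  exists (pr z q); split=> //; apply: agree_pr; apply/agree_mkseq.
    by rewrite /pfx size_mkseq in pz.
  by rewrite /pfx size_mkseq in pq.
apply: (dis (fun i => (y i).1.1)).
  apply/AC; exists (fun i => (y i).1.2); apply: (lim C (fun x => x.1.2)) => // n.
  apply: contrapT => /forallNP h; apply: (hy n); exists (fun=> False).
  split=> [|z|z _]; [exact: sa_false|by rewrite !mE => /h|by []].
apply/AC'; exists (fun i => (y i).2); apply: (lim C' (fun x => x.2)) => // n.
apply: contrapT => /forallNP h; apply: (hy n); exists (fun=> True).
split=> [|z _|z]; [exact: sa_cst|by []|by rewrite !mE => /h].
Qed.

(* Lusin-Souslin.  The pieces [A u] of the domain on which the witness starts with [u] are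
   disjoint analytic sets for [u] of a given size; separating them turns the domain
   into a countable intersection of countable unions of Borel sets. *)
Lemma lusin_souslin C : clos C -> (forall y q q', C (pr y q) -> C (pr y q') -> q = q') ->
  BN (fun y => exists q, C (pr y q)).
Proof.
move=> hC uC; pose A u y := exists q, C (pr y q) /\ pfx u q.
have hA u : an (A u).
  exists (fun p => C p /\ pfx u (rgt p)); split.
    by apply: clos_and => //; apply: clos_fd; apply: fd_pfx.
  by move=> y; split=> -[q [? h]]; exists q; move: h; rewrite rgt_pr.
have /choice[B hB] : forall x : seq nat * seq nat, exists B, BN B /\
    (x.1 <> x.2 -> size x.1 = size x.2 ->
    (forall y, A x.1 y -> B y) /\ (forall y, A x.2 y -> ~ B y)).
  move=> [u v] /=; have [[uv suv]|h] := pselect (u <> v /\ size u = size v); last first.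
    by exists (fun=> False); split; [exact: sa_false|move=> ? ?; exfalso; apply: h].
  have [|B [b1 b2 b3]] := separation (hA u) (hA v); last by exists B.
  move=> y [q [Cq uq]] [q' [Cq' vq]]; apply: uv.
  by rewrite -uq -vq (uC _ _ _ Cq Cq') suv.
(* Using both orders of each pair makes the [D u] disjoint for [u] of one size. The last clause
   keeps [y] close to [A u], so that closedness of [C] applies in the limit. *)
pose D u y := (forall v, v <> u -> size v = size u -> B (u, v) y /\ ~ B (v, u) y) /\
  (exists y' q', agree (size u) y y' /\ pfx u q' /\ C (pr y' q')).
have AD u y : A u y -> D u y.
  move=> Auy; split; last first.
    by case: Auy => q [Cq uq]; exists y, q.
  move=> v vu svu; split.
    by have [_ [||h _]] := hB (u, v); [by apply/nesym|by []|apply: h].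
  by have [_ [||_ h]] := hB (v, u); [by []|by []|apply: h].
have DD u v y : D u y -> D v y -> size u = size v -> u = v.
  move=> [h _] [h' _] suv; apply: contrapT => uv.
  by have [h1 _] := h v (nesym uv) (esym suv); have [_] := h' u uv suv.
(* Asking for all initial segments of [u] forces the sequences found for different [n] to cohere, by
   disjointness. *)
apply: (@sa_ext _ BN (fun y => forall n, exists u, size u = n /\ D u y /\
    forall k, k <= n -> D (take k u) y)).
  move=> y; split=> [h|[q Cq] n]; last first.
    have Aq k : A (mkseq q k) y by exists q; split=> //; apply: pfx_mkseq.
    exists (mkseq q n); rewrite size_mkseq; split=> //; split; first exact: AD.
    by move=> k kn; rewrite take_mkseq//; apply: AD.
  have {h}[u hu] := choice h.
  have su n : size (u n) = n by case: (hu n).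
  have uD n : D (u n) y by case: (hu n) => _ [].
  have tu k n : k <= n -> take k (u n) = u k.
    move=> kn; apply: (DD _ _ y); rewrite ?size_takel ?su//.
    by case: (hu n) => _ [_]; apply.
  exists (fun i => nth 0 (u i.+1) i); apply: hC => n.
  have [_ [y' [q' [ag [pq Cq]]]]] := uD n.
  exists (pr y' q'); split=> //; rewrite su in ag; apply: agree_pr => // i im.
  by rewrite (pfx_nth pq) ?su// -(tu i.+1 n)// nth_take.
have hD u : BN (D u).
  apply: (sa_and BNs).
    apply: (sa_allc BNs) => v; apply: (sa_imp BNs); first exact: sa_cst.
    apply: (sa_imp BNs); first exact: sa_cst.
    by apply: (sa_and BNs); [case: (hB (u, v))|apply: (sa_not BNs); case: (hB (v, u))].
  have := df_pred BNs (fun s => exists y' q', s = mkseq y' (size u) /\ pfx u q' /\ C (pr y' q'))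
    (df_mkseq BNs (size u) bf_id).
  apply: sa_ext => y; split=> -[y' [q' [h ?]]]; exists y', q'; split=> //; exact/agree_mkseq.
apply: (sa_all BNs) => n; apply: (sa_exc BNs) => u; apply: (sa_and BNs); first exact: sa_cst.
apply: (sa_and BNs) => //; apply: (sa_all BNs) => k; apply: (sa_imp BNs) => //; exact: sa_cst.
Qed.

Lemma borel_dom (K : baire -> baire -> Prop) : BN (fun p => K (lft p) (rgt p)) ->
  (forall y q q', K y q -> K y q' -> q = q') -> BN (fun y => exists q, K y q).
Proof.
move=> /an_proj[C [c1 c2 c3 c4]] uK.
have uC y q q' : C (pr y q) -> C (pr y q') -> q = q'.
  by move=> h h'; apply: (c4 _ _ _ h h'); apply: (uK y); apply: c2.
apply: sa_ext (lusin_souslin c1 uC) => y.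
split=> [[q /c2 ?]|[q /c3[t ?]]]; first by exists (lft q).
by exists (pr q t).
Qed.

Lemma borel_unif (K : baire -> baire -> Prop) : BN (fun p => K (lft p) (rgt p)) ->
  (forall y q q', K y q -> K y q' -> q = q') ->
  exists2 h, bf BN h & forall y q, K y q -> h y = q.
Proof.
move=> hK uK; exists (fun y n => least (fun k => exists q, K y q /\ q n = k)).
  move=> n; apply: df_least => // k; apply: borel_dom.
    by apply: (sa_and BNs) => //; apply: bf_rgt.
  by move=> y q q' [h _] [h' _]; apply: uK h h'.
move=> y q Kq; apply/funext => n; apply: least_unique; first by exists q.
by move=> m mn [q' [/(uK _ _ _ Kq) <-]] e; rewrite e ltnn in mn.
Qed.

(** * Binary schemes and the Lusin-Novikov theorem *)

Definition flat (f : nat -> baire) : baire :=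
  jn (fun m => if (unpickle m : option (nat * nat)) is Some (k, j) then bcol (f k) j else fun=> 0).

Lemma col_flat f k j : bcol (flat f) (pickle (k, j)) = bcol (f k) j.
Proof. by rewrite /flat col_jn pickleK. Qed.

Lemma bf_flat T (S : set (set T)) (hS : sigma_algebra setT S) (f : nat -> T -> baire) :
  (forall k, bf S (f k)) -> bf S (fun x => flat (f^~ x)).
Proof.
move=> h; apply: bf_jn => // m; case: (unpickle m : option (nat * nat)) => [[k j]|].
  exact: bf_col.
exact: bf_cst.
Qed.

(* A scheme is a binary tree of finite sequences in heap order: the children
   of [c i] are [c (2 i + 1)] and [c (2 i + 2)]. *)
Definition splits (u v w : seq nat) :=
  [/\ size u < size v, take (size u) v = u, size u < size w, take (size u) w = u &
      forall z, pfx v z -> pfx w z -> False].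

Definition scheme (c : nat -> seq nat) := forall n, splits (c n) (c n.*2.+1) (c n.*2.+2).

(** In heap order the tree is built by plain recursion: stage [n] has [n.*2.+1] nodes, splits node
    [n] and appends its two children. The states in [S] carry a construction made alongside. *)
Lemma scheme_build (S : Type) (Inv : nat -> S -> seq (seq nat) -> Prop) (R : S -> S -> Prop) s0 :
  Inv 0 s0 [:: [::]] ->
  (forall n s L, size L = n.*2.+1 -> Inv n s L -> exists s' v w,
    [/\ R s s', splits (nth [::] L n) v w & Inv n.+1 s' (L ++ [:: v; w])]) ->
  exists c sg, [/\ forall n, Inv n (sg n) (mkseq c n.*2.+1), forall n, R (sg n) (sg n.+1) & scheme c].
Proof.
move=> h0 hs.
pose ok n (x : S * seq (seq nat)) := size x.2 = n.*2.+1 /\ Inv n x.1 x.2.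
pose st n (x y : S * seq (seq nat)) := exists v w, [/\ R x.1 y.1, splits (nth [::] x.2 n) v w &
  y.2 = x.2 ++ [:: v; w]].
have /choice[nxt hn] : forall nx : nat * (S * seq (seq nat)), exists y,
    ok nx.1 nx.2 -> ok nx.1.+1 y /\ st nx.1 nx.2 y.
  move=> [n x]; have [[h1 h2]|h] := pselect (ok n x); last by exists x.
  have [s' [v [w [r1 r2 r3]]]] := hs n _ _ h1 h2.
  exists (s', x.2 ++ [:: v; w]) => _; split; last by exists v, w.
  by split=> //=; rewrite size_cat h1 addn2.
pose f := fix f n := if n is m.+1 then nxt (m, f m) else (s0, [:: [::]]).
have fok n : ok n (f n) by elim: n => // n IH; case: (hn (n, f n) IH).
have fst n : st n (f n) (f n.+1) by case: (hn (n, f n) (fok n)).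
have fsz n : size (f n).2 = n.*2.+1 by case: (fok n).
pose c n := nth [::] (f n).2 n.
have stable n k i : i < n.*2.+1 -> nth [::] (f (n + k)).2 i = nth [::] (f n).2 i.
  move=> im; elim: k => [|k IH]; first by rewrite addn0.
  rewrite addnS; have [v [w [_ _ ->]]] := fst (n + k).
  by rewrite nth_cat fsz (leq_trans im)// ltnS leq_double leq_addr.
have cE n i : i < n.*2.+1 -> nth [::] (f n).2 i = c i.
  move=> im; have ii : i < i.*2.+1 by rewrite ltnS -addnn leq_addr.
  by rewrite /c -(stable i n i)// -(stable n i i)// addnC.
have mk n : mkseq c n.*2.+1 = (f n).2.
  apply: (@eq_from_nth _ [::]); rewrite size_mkseq ?fsz// => i im.
  by rewrite nth_mkseq// cE.
exists c, (fun n => (f n).1); split=> n.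
- by rewrite mk; case: (fok n).
- by have [v [w []]] := fst n.
- have [v [w [_ sp e]]] := fst n; move: sp.
  have nn : n < n.*2.+1 by rewrite ltnS -addnn leq_addr.
  rewrite cE//; have -> : v = c n.*2.+1.
    by rewrite -(cE n.+1) ?doubleS// e nth_cat fsz ltnn subnn.
  suff -> : w = c n.*2.+2 by [].
  by rewrite -(cE n.+1) ?doubleS// e nth_cat fsz ltnNge leqnSn /= subSn// subnn.
Qed.

Definition idx (b : nat -> bool) k := iteri k (fun j i => i.*2.+1 + b j) 0.

Lemma scheme_split c b k : scheme c ->
  size (c (idx b k)) < size (c (idx b k.+1)) /\
  take (size (c (idx b k))) (c (idx b k.+1)) = c (idx b k).
Proof.
move=> /(_ (idx b k))[h1 h2 h3 h4 _].
by rewrite /idx iteriS -/(idx b k); case: (b k); rewrite ?addn1 ?addn0.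
Qed.

Lemma scheme_size c b k : scheme c -> k <= size (c (idx b k)).
Proof.
move=> sc; elim: k => // k IH; apply: leq_ltn_trans IH _.
by case: (scheme_split b k sc).
Qed.

(** Entry [n] is read at depth [n.+1], where nodes have more than [n] entries. *)
Definition branch (c : nat -> seq nat) b : baire := fun n => nth 0 (c (idx b n.+1)) n.

Lemma scheme_take c b k m : scheme c -> size (c (idx b k)) <= size (c (idx b (k + m))) /\
  take (size (c (idx b k))) (c (idx b (k + m))) = c (idx b k).
Proof.
move=> sc; elim: m => [|m [IH1 IH2]]; first by rewrite addn0 take_size.
have [h1 h2] := scheme_split b (k + m) sc; rewrite addnS.
split; first exact: leq_trans IH1 (ltnW h1).
by rewrite -[in RHS]IH2 -h2 take_takel.
Qed.

Lemma branch_pfx c b k : scheme c -> pfx (c (idx b k)) (branch c b).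
Proof.
move=> sc; apply: (@eq_from_nth _ 0); rewrite size_mkseq// => i ik; rewrite nth_mkseq// /branch.
have [ki|ki] := leqP k i.+1.
  have [_ e] := scheme_take b k (i.+1 - k) sc.
  by rewrite subnKC// in e; rewrite -[in RHS]e nth_take.
have [_ e] := scheme_take b i.+1 (k - i.+1) sc; rewrite subnKC ?(ltnW ki)// in e.
by rewrite -e nth_take//; apply: scheme_size.
Qed.

Lemma branch_inj c : scheme c -> injective (branch c).
Proof.
move=> sc b b' e; apply: contrapT => ne.
have [k hk] : exists k, b k <> b' k.
  by apply: contrapT => h; apply: ne; apply/funext => k; apply: contrapT => ?; apply: h; exists k.
have [n [bn hn]] : exists n, b n <> b' n /\ forall m, m < n -> b m = b' m.
  have [|h1 h2] := @leastP (fun k => b k <> b' k); first by exists k.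
  by exists (least (fun k => b k <> b' k)); split=> // m /h2/contrapT.
have ie k' : k' <= n -> idx b k' = idx b' k'.
  elim: k' => // k' IH kn; rewrite /idx !iteriS -!/(idx _ _) IH ?hn//; exact: ltnW.
have p1 := branch_pfx b n.+1 sc; have p2 := branch_pfx b' n.+1 sc.
rewrite -e in p2; move: p1 p2; rewrite /idx !iteriS -!/(idx _ _) ie//.
have [_ _ _ _ h] := sc (idx b' n).
case: (b n) (b' n) bn => -[]//= _; rewrite ?addn1 ?addn0 => p1 p2; exact: h p1 p2 || exact: h p2 p1.
Qed.

Lemma cantor (m : (nat -> bool) -> nat) : ~ injective m.
Proof.
move=> mi; pose d n := `[< forall b, m b = n -> ~~ b n >].
case dE : (d (m d)).
  by have /asboolP/(_ d erefl) := dE; rewrite dE.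
by move/negbT/asboolPn: (dE); apply => b /mi ->; rewrite dE.
Qed.

Lemma scheme_uncountable c (y : baire) : scheme c ->
  exists b, forall m, branch c b <> bcol y m.
Proof.
move=> sc; apply: contrapT => h.
have /choice[m hm] : forall b, exists m, branch c b = bcol y m.
  by move=> b; apply: contrapT => h'; apply: h; exists b => m ?; apply: h'; exists m.
apply: (@cantor m) => b b' e; apply: (branch_inj sc); by rewrite !hm e.
Qed.

Section lusin_novikov.
Context (C : baire -> Prop).
Hypothesis hC : clos C.

Let inE (Y : baire -> baire) s z := exists m, z = bcol (Y s) m.
Let cov Y s u := forall z, pfx u z -> C (pr s z) -> inE Y s z.
(** The nodes [n] to [n.*2] are the leaves at stage [n]. For every [s] extending [a], one Borel
    enumeration exhausts the section inside some leaf, which may depend on [s]. For empty [a] and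
    the root alone this is the theorem. *)
Let Good a n (L : seq (seq nat)) := exists Y, bf BN Y /\
  forall s, pfx a s -> exists i, [/\ n <= i, i <= n.*2 & cov Y s (nth [::] L i)].

Lemma inE_borel T (S : set (set T)) (hS : sigma_algebra setT S) Y s z :
  bf BN Y -> bf S s -> bf S z -> S (fun x => inE Y (s x) (z x)).
Proof.
move=> hY hs hz; apply: (sa_ex hS) => m; apply: (bf_eq hS hz).
by apply: bf_col; apply: (bf_comp hS hY).
Qed.

Let inEW Y s z k : inE (Y k) s z -> inE (fun s => flat (Y^~ s)) s z.
Proof. by move=> [m ->]; exists (pickle (k, m)); rewrite (col_flat (Y^~ s)). Qed.

(** If all one-entry extensions of [a] were good, merging their enumerations would make [a] good. *)
Let good_longer a n L N : ~ Good a n L -> exists a', [/\ take (size a) a' = a, N <= size a',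
  size a <= size a' & ~ Good a' n L].
Proof.
move=> h; suff [a' [h1 h2 h3]] : exists a', [/\ take (size a) a' = a, size a' = size a + N & ~ Good a' n L].
  by exists a'; rewrite h2 leq_addl leq_addr.
elim: N => [|N [a' [h1 h2 h3]]]; first by exists a; rewrite take_size addn0.
have [k hk] : exists k, ~ Good (rcons a' k) n L.
  apply: contrapT => /forallNP h4; apply: h3.
  have /choice[Y hY] : forall k, Good (rcons a' k) n L by move=> k; apply: contrapT; apply: h4.
  exists (fun s => flat (Y^~ s)); split; first by apply: bf_flat => // k; case: (hY k).
  move=> s /pfx_rcons; set k := s _ => /(let: conj _ h := hY k in h) [i [i1 i2 ci]].
  by exists i; split=> // z pz Cz; apply: inEW (ci z pz Cz).
exists (rcons a' k); rewrite size_rcons h2 addnS; split=> //.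
by rewrite -cats1 takel_cat// h2 leq_addr.
Qed.

(* If no point of the leaf [u] can be split off, then outside the set enumerated so far
   every section has at most one point in [u]: separation makes this uniform in [s],
   and [borel_unif] adds the missing point to the enumeration. *)
Let good_split a n L : size L = n.*2.+1 ->
  (forall v w, splits (nth [::] L n) v w -> Good a n.+1 (L ++ [:: v; w])) -> Good a n L.
Proof.
move=> sL h; set u := nth [::] L n in h.
(* One enumeration for each way of splitting [u]; their union [E] serves for all of them at once. *)
have /choice[Y hY] : forall k, exists Y, bf BN Y /\
    forall v w, unpickle k = Some (v, w) -> splits u v w -> forall s, pfx a s ->
      exists i, [/\ n < i, i <= n.*2.+2 & cov Y s (nth [::] (L ++ [:: v; w]) i)].
  move=> k; case: (unpickle k) => [[v w]|]; last by exists (fun=> fun=> 0); split=> //; exact: bf_cst.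
  have [sp|sp] := pselect (splits u v w).
    have [Y [b1 b2]] := h _ _ sp; exists Y; split=> // _ _ [<- <-] _ s /b2.
    by rewrite doubleS.
  by exists (fun=> fun=> 0); split=> [|_ _ [<- <-]//]; exact: bf_cst.
pose E s := flat (Y^~ s).
have bE : bf BN E by apply: bf_flat => // k; case: (hY k).
have hE v w s : splits u v w -> pfx a s ->
    exists i, [/\ n < i, i <= n.*2.+2 & cov E s (nth [::] (L ++ [:: v; w]) i)].
  move=> sp pa; have [_ hk] := hY (pickle (v, w)).
  have [i [i1 i2 ci]] := hk v w (pickleK _) sp s pa.
  by exists i; split=> // z pz Cz; apply: inEW (ci z pz Cz).
pose K u s z := [/\ pfx u z, C (pr s z) & ~ inE E s z].
have bK T (S : set (set T)) (hS : sigma_algebra setT S) u' s z :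
    bf S s -> bf S z -> S (fun x => K u' (s x) (z x)).
  move=> hs hz.
  apply: (@sa_ext _ _ (fun x => pfx u' (z x) /\ (C (pr (s x) (z x)) /\ ~ inE E (s x) (z x)))).
    by move=> x; split=> [[? []]|[]].
  apply: (sa_and hS); first exact: sa_pfx.
  apply: (sa_and hS); last by apply: (sa_not hS); apply: inE_borel.
  have bC : BN C.
    apply: (@sa_ext _ BN (fun y => forall n, exists y', mkseq y n = mkseq y' n /\ C y')).
      move=> y; split=> [hy|Cy m]; last by exists y.
      by apply: hC => m; have [y' [? ?]] := hy m; exists y'; split=> //; apply/agree_mkseq.
    apply: (sa_all BNs) => m.
    exact: (df_pred BNs (fun t => exists y', t = mkseq y' m /\ C y') (df_mkseq BNs m bf_id)).
  by apply: bf_preim bC => //; apply: bf_pr.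
(* In [A1] every leaf other than [u] has a point missed by [E], in [A2] the leaf [u] has two. They
   are disjoint: splitting [u] between two such points gives leaves of which [E] exhausts one. *)
pose A1 s := exists q, pfx a s /\ forall i, n < i -> i <= n.*2 -> K (nth [::] L i) s (bcol q i).
pose A2 s := exists q, [/\ K u s (lft q), K u s (rgt q) & lft q <> rgt q].
have [|||B [bB hB1 hB2]] := @separation A1 A2.
- apply: an_borel_proj; apply: (sa_and BNs); first exact: (sa_pfx BNs _ (bf_lft bf_id)).
  apply: (sa_all BNs) => i; apply: (sa_imp BNs); first exact: sa_cst.
  apply: (sa_imp BNs); first exact: sa_cst.
  by apply: (bK _ BN BNs); [exact: (bf_lft bf_id)|exact: (bf_col _ (bf_rgt bf_id))].
- apply: an_borel_proj.
  apply: (@sa_ext _ BN (fun p => K u (lft p) (lft (rgt p)) /\ (K u (lft p) (rgt (rgt p)) /\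
    lft (rgt p) <> rgt (rgt p)))); first by move=> x; split=> [[? []]|[]].
  have b1 : bf BN (fun p => lft (rgt p)) by exact: (bf_lft (bf_rgt bf_id)).
  have b2 : bf BN (fun p => rgt (rgt p)) by exact: (bf_rgt (bf_rgt bf_id)).
  have b3 := bf_lft bf_id.
  apply: (sa_and BNs); first exact: bK.
  by apply: (sa_and BNs); [apply: bK|apply: (sa_not BNs); apply: bf_eq].
- move=> s [q [pa hq]] [q' [[z1 z2 z3] [z1' z2' z3'] zz]].
  set z := lft q' in z1 z2 z3 zz; set z' := rgt q' in z1' z2' z3' zz.
  have [d hd] : exists d, z d <> z' d.
    by apply: contrapT => hh; apply: zz; apply/funext => d; apply: contrapT => ?; apply: hh; exists d.
  pose N := maxn d.+1 (size u).+1.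
  have uN : size u < N by rewrite leq_maxr.
  have sp : splits u (mkseq z N) (mkseq z' N).
    split; rewrite ?size_mkseq//; try by rewrite take_mkseq ?z1 ?z1'// ltnW.
    rewrite /pfx !size_mkseq => y ->; move/agree_mkseq/(_ d); rewrite leq_maxl => /(_ isT).
    exact: hd.
  have [i [i1 i2 ci]] := hE _ _ _ sp pa.
  move: i2; rewrite leq_eqVlt => /orP[/eqP ei|]; [|rewrite ltnS leq_eqVlt => /orP[/eqP ei|]].
  + apply: z3'; apply: ci => //; rewrite ei nth_cat sL ltnNge leqnSn subSn// subnn.
    exact: pfx_mkseq.
  + apply: z3; apply: ci => //; rewrite ei nth_cat sL ltnn subnn.
    exact: pfx_mkseq.
  + rewrite ltnS => i2; have [k1 k2 k3] := hq i i1 i2; apply: k3.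
    by apply: ci => //; rewrite nth_cat sL ltnS i2.
have [||g bg hg] := @borel_unif (fun s z => B s /\ K u s z).
- apply: (sa_and BNs); first exact: (bf_preim BNs (bf_lft bf_id) bB).
  by apply: (bK _ BN BNs); [exact: (bf_lft bf_id)|exact: (bf_rgt bf_id)].
- move=> s z z' [Bs k] [_ k']; apply: contrapT => zz; apply: (hB2 s) Bs.
  by exists (pr z z'); rewrite lft_pr rgt_pr.
(* In [B] at most one point of [u] is missing, and [g s] supplies it; outside [B] another leaf is
   already exhausted. *)
pose Y' (k : nat) s := if k is 0 then E s else jn (fun=> g s).
exists (fun s => flat (Y'^~ s)); split.
  by apply: bf_flat => // -[|k] //; apply: bf_jn.
move=> s pa; have inE0 z : inE E s z -> inE (fun s => flat (Y'^~ s)) s z.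
  exact: (@inEW Y' s z 0).
have [Bs|Bs] := pselect (B s).
  exists n; split=> //; first by rewrite -addnn leq_addr.
  move=> z pz Cz; have [/inE0//|nE] := pselect (inE E s z).
  apply: (@inEW Y' s z 1); exists 0; rewrite /Y' col_jn; apply/esym/hg.
  by split.
have : ~ forall i, n < i -> i <= n.*2 -> exists z, K (nth [::] L i) s z.
  move=> hh; apply: Bs; apply: hB1.
  have /choice[q hq] : forall i, exists z, n < i -> i <= n.*2 -> K (nth [::] L i) s z.
    move=> i; have [[i1 i2]|hi] := pselect (n < i /\ i <= n.*2).
      by have [z hz] := hh i i1 i2; exists z.
    by exists (fun=> 0) => i1 i2; exfalso; apply: hi.
  by exists (jn q); split=> // i i1 i2; rewrite col_jn; apply: hq.
move=> /existsNP[i /not_implyP[i1 /not_implyP[i2 /forallNP hi]]].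
exists i; split=> //; first exact: ltnW.
by move=> z pz Cz; apply: inE0; apply: contrapT => nE; apply: (hi z).
Qed.

(** If the root is not good, lengthening [a] and splitting leaves keeps it so forever. This produces
    a point [s] together with a perfect set in its section, against countability. *)
Lemma lusin_novikov :
  (forall s, exists y : baire, forall z, C (pr s z) -> exists m, z = bcol y m) ->
  exists2 Y, bf BN Y & forall s z, C (pr s z) -> exists m, z = bcol (Y s) m.
Proof.
move=> cnt; have [[Y [bY hY]]|bad] := pselect (Good [::] 0 [:: [::]]).
  exists Y => // s z Cz; have [[|i] [_ _ ci]//] := hY s (pfx_nil s).
  exact: (ci z (pfx_nil z)).
exfalso.
(* Nodes stay no longer than [a], so that a point of [C] found near a node is equally close to
   [s]. *)
pose Inv n a L := ~ Good a n L /\ forall i, i < size L -> size (nth [::] L i) <= size a.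
have [||c [a [h1 h2 sc]]] := @scheme_build _ Inv
  (fun a a' => size a < size a' /\ take (size a) a' = a) [::].
- by split=> // -[].
- move=> n s L sL [hG hs].
  have [v [w [sp nG]]] : exists v w, splits (nth [::] L n) v w /\ ~ Good s n.+1 (L ++ [:: v; w]).
    apply: contrapT => hh; apply: hG; apply: good_split => // v w sp.
    by apply: contrapT => nG; apply: hh; exists v, w.
  have [a' [r1 r2 _ r4]] := good_longer (maxn (maxn (size v) (size w)) (size s).+1) nG.
  move: r2; rewrite !geq_max => /andP[/andP[rv rw] rs].
  exists a', v, w; split=> //; split=> // i; rewrite size_cat addn2 sL !ltnS.
  rewrite leq_eqVlt => /orP[/eqP->|].
    by rewrite nth_cat sL ltnNge leqnSn subSn// subnn.
  rewrite ltnS leq_eqVlt => /orP[/eqP->|il].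
    by rewrite nth_cat sL ltnn subnn.
  by rewrite nth_cat sL il (leq_trans (hs i _)) ?sL// ltnW.
have szc i : size (c i) <= size (a i).
  have [_ /(_ i)] := h1 i; have ii : i < i.*2.+1 by rewrite ltnS -addnn leq_addr.
  by rewrite size_mkseq nth_mkseq//; apply.
have tk n k : size (a n) <= size (a (n + k)) /\ take (size (a n)) (a (n + k)) = a n.
  elim: k => [|k [l1 l2]]; first by rewrite addn0 take_size.
  have [r1 r2] := h2 (n + k); rewrite addnS; split; first exact: leq_trans (ltnW r1).
  by rewrite -[in RHS]l2 -r2 take_takel.
have sza n : n <= size (a n).
  by elim: n => // n IH; apply: leq_ltn_trans IH _; case: (h2 n).
pose s : baire := fun i => nth 0 (a i.+1) i.
have pa n : pfx (a n) s.
  apply: (@eq_from_nth _ 0); rewrite size_mkseq// => i ik; rewrite nth_mkseq// /s.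
  have [ni|ni] := leqP n i.+1.
    have [_ e] := tk n (i.+1 - n); rewrite subnKC// in e.
    by rewrite -[in RHS]e nth_take.
  have [_ e] := tk i.+1 (n - i.+1); rewrite subnKC ?(ltnW ni)// in e.
  by rewrite -e nth_take.
have [y hy] := cnt s; have [b hb] := scheme_uncountable y sc.
have [|m] := hy (branch c b); last exact: hb.
apply: hC => N; set i := idx b N; have [nG _] := h1 i.
have [s' [z' [ps pz Cz]]] : exists s' z', [/\ pfx (a i) s', pfx (c i) z' & C (pr s' z')].
  (* Without a point of [C] in the leaf [c i], that leaf would be exhausted vacuously. *)
  apply: contrapT => hh; apply: nG; exists (fun=> fun=> 0); split; first exact: bf_cst.
  have ii : i <= i.*2 by rewrite -addnn leq_addr.
  move=> s' ps; exists i; split=> // z; rewrite nth_mkseq ?ltnS// => pz Cz.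
  by exfalso; apply: hh; exists s', z.
have Nc : N <= size (c i) by apply: scheme_size.
exists (pr s' z'); split=> //; apply: agree_pr.
  by apply: agreeW (pfx_agree (pa i) ps); apply: leq_trans (szc i).
exact: agreeW Nc (pfx_agree (branch_pfx b N sc) pz).
Qed.

End lusin_novikov.

(** The tree of the section of [D] at [s]. Approximation in [s] as well makes each node depend on
    finitely many entries of [s]; for closed [D] the branches are still the section. *)
Definition nd (D : baire -> Prop) (s : baire) (u : seq nat) :=
  exists s' y', [/\ agree (size u) s s', pfx u y' & D (pr s' y')].

Lemma nd_closed D s y : clos D -> (forall n, nd D s (mkseq y n)) -> D (pr s y).
Proof.
move=> hD h; apply: hD => n; have [s' [y' [h1 h2 h3]]] := h n.
rewrite size_mkseq in h1; exists (pr s' y'); split=> //; apply: agree_pr => //.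
by apply/agree_mkseq; rewrite /pfx size_mkseq in h2.
Qed.

Lemma nd_mkseq D s y n : D (pr s y) -> nd D s (mkseq y n).
Proof. by move=> h; exists s, y; split=> //; apply: pfx_mkseq. Qed.

Lemma nd_take D s u k : nd D s u -> nd D s (take k u).
Proof.
move=> [s' [y' [h1 h2 h3]]]; exists s', y'; split=> //; last exact: pfx_take.
by apply: agreeW h1; rewrite size_take_min geq_minr.
Qed.

Lemma fd_nd (phi : baire -> baire) D u : cont phi -> fd (fun y => nd D (phi y) u).
Proof.
move=> /(cont_agree (size u))[m hm]; exists m => y y' /hm ag [s' [y'' [h1 h2 h3]]].
by exists s', y''; split=> // i iu; rewrite -h1// ag.
Qed.

Lemma sa_nd T (S : set (set T)) (hS : sigma_algebra setT S) phi D u :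
  bf S phi -> S (fun x => nd D (phi x) u).
Proof.
move=> hp; have := df_pred hS (fun t => exists s' y', [/\ t = mkseq s' (size u), pfx u y' & D (pr s' y')])
  (df_mkseq hS (size u) hp).
apply: sa_ext => x; split=> -[s' [y' [h1 h2 h3]]]; exists s', y'; split=> //; exact/agree_mkseq.
Qed.

Lemma clos_borel C : clos C -> BN C.
Proof.
move=> hC; apply: (@sa_ext _ BN (fun y => forall n, exists y', mkseq y n = mkseq y' n /\ C y')).
  move=> y; split=> [hy|Cy m]; last by exists y.
  by apply: hC => m; have [y' [? ?]] := hy m; exists y'; split=> //; apply/agree_mkseq.
apply: (sa_all BNs) => m.
exact: (df_pred BNs (fun t => exists y', t = mkseq y' m /\ C y') (df_mkseq BNs m bf_id)).
Qed.

(** * Perfect subsets of closed sections *)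

Definition dec (y : baire) i : seq nat := odflt [::] (unpickle (y i)).

Definition enumerable (A : baire -> Prop) :=
  exists y, forall z, A z -> exists m, z = bcol y m.

Lemma enumerableU (I : countType) (A : I -> baire -> Prop) :
  (forall i, enumerable (A i)) -> enumerable (fun z => exists i, A i z).
Proof.
move=> /choice[y hy].
exists (flat (fun k => if (unpickle k : option I) is Some i then y i else fun=> 0)).
move=> z [i /hy[m ->]]; exists (pickle (pickle i, m)); by rewrite col_flat pickleK.
Qed.

Lemma enumerable_sub (A B : baire -> Prop) : (forall z, A z -> B z) -> enumerable B -> enumerable A.
Proof. by move=> AB [y hy]; exists y => z /AB/hy. Qed.

Lemma enumerable1 z0 : enumerable (fun z => z = z0).
Proof. by exists (jn (fun=> z0)) => z ->; exists 0; rewrite col_jn. Qed.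

(** The points having an enumerable neighbourhood in [A] are enumerable altogether, so two other
    points remain beyond [u]; long initial segments of these are the split. *)
Lemma splits_exist (A : baire -> Prop) u : ~ enumerable (fun z => pfx u z /\ A z) ->
  exists v w, [/\ splits u v w, ~ enumerable (fun z => pfx v z /\ A z) &
    ~ enumerable (fun z => pfx w z /\ A z)].
Proof.
move=> hu; apply: contrapT => h.
pose small z := exists v, enumerable (fun z => pfx v z /\ A z) /\ (pfx v z /\ A z).
have es : enumerable small.
  apply: enumerableU => v; have [e|e] := pselect (enumerable (fun z => pfx v z /\ A z)).
    by apply: enumerable_sub e => z [].
  by exists (fun=> 0) => z [].
apply: hu; have [[z0 [[p0 A0] n0]]|no] :=
    pselect (exists z, (pfx u z /\ A z) /\ ~ small z); last first.
  apply: enumerable_sub es => z hz; apply: contrapT => nz; apply: no; by exists z.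
have := enumerableU (A := fun b : bool => if b then small else fun z => z = z0).
move=> /(_ (fun b => if b return enumerable (if b then _ else _) then es else enumerable1 z0)).
apply: enumerable_sub => z [pz Az]; have [sz|nz] := pselect (small z); first by exists true.
exists false; apply: contrapT => zz.
have [d hd] : exists d, z d <> z0 d.
  by apply: contrapT => hh; apply: zz; apply/funext => d; apply: contrapT => ?; apply: hh; exists d.
pose N := maxn d.+1 (size u).+1.
have uN : size u < N by rewrite leq_maxr.
apply: h; exists (mkseq z N), (mkseq z0 N); split.
- split; rewrite ?size_mkseq//; try by rewrite take_mkseq ?pz ?p0// ltnW.
  rewrite /pfx !size_mkseq => y ->; move/agree_mkseq/(_ d); rewrite leq_maxl => /(_ isT).
  exact: hd.
- by move=> e; apply: nz; exists (mkseq z N); split=> //; split=> //; apply: pfx_mkseq.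
- by move=> e; apply: n0; exists (mkseq z0 N); split=> //; split=> //; apply: pfx_mkseq.
Qed.

Section perfect.
Context (C : baire -> Prop).
Hypothesis hC : clos C.

(** The right half codes a perfect subset of the section of [C] at the left half. This set is
    closed, so the search for such a code is itself the search for a branch of a tree. *)
Definition Sch p := scheme (dec (rgt p)) /\ forall i, nd C (lft p) (dec (rgt p) i).

Lemma clos_Sch : clos Sch.
Proof.
have f1 i (A : seq nat -> Prop) : fd (fun p => A (dec (rgt p) i)).
  exact: (fd_pred (fun k => A (odflt [::] (unpickle k))) i.*2.+1).
apply: clos_and.
  apply: clos_all => n; apply: clos_fd; rewrite /splits.
  pose M := maxn n.*2.+1 (maxn (n.*2.+1).*2.+1 (n.*2.+2).*2.+1).
  exists M.+1 => p p' h; have e i : i <= M -> p i = p' i by move=> iM; apply: h; rewrite ltnS.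
  by rewrite /dec /rgt !e// /M ?leq_max ?leqnn ?orbT.
apply: clos_all => i.
apply: (@clos_ext (fun p => forall u, dec (rgt p) i = u -> nd C (lft p) u)).
  by move=> p; split=> [h|h u <-//]; apply: h.
apply: clos_all => u; apply: clos_imp; first exact: (f1 i (fun v => v = u)).
by apply: clos_fd; apply: fd_nd.
Qed.

Definition U s := exists y, Sch (pr s y).

Lemma branch_in s c b : scheme c -> (forall i, nd C s (c i)) -> C (pr s (branch c b)).
Proof.
move=> sc h; apply: nd_closed => // n.
have Nc : n <= size (c (idx b n)) by apply: scheme_size.
have := nd_take n (h (idx b n)); rewrite -[c _](branch_pfx b n sc).
by rewrite take_mkseq.
Qed.

Lemma UP s : U s <-> ~ enumerable (fun z => C (pr s z)).
Proof.
split=> [[y [sc h]] [e he]|h].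
  rewrite !(lft_pr, rgt_pr) in sc h.
  have [b hb] := scheme_uncountable e sc.
  by have [m] := he _ (branch_in b sc h); apply: hb.
pose unc u := ~ enumerable (fun z => pfx u z /\ C (pr s z)).
have [||c [_ [h1 _ sc]]] := @scheme_build unit
  (fun n _ L => forall i, i < size L -> unc (nth [::] L i)) (fun _ _ => True) tt.
- move=> [|i]// _ [y hy]; apply: h; exists y => z Cz; apply: hy.
  by split=> //; apply: pfx_nil.
- move=> n _ L sL hL; have [|v [w [sp hv hw]]] := @splits_exist (fun z => C (pr s z)) (nth [::] L n).
    by apply: hL; rewrite sL ltnS -addnn leq_addr.
  exists tt, v, w; split=> // i; rewrite size_cat addn2 sL !ltnS.
  rewrite leq_eqVlt => /orP[/eqP->|].
    by rewrite nth_cat sL ltnNge leqnSn subSn// subnn.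
  rewrite ltnS leq_eqVlt => /orP[/eqP->|il].
    by rewrite nth_cat sL ltnn subnn.
  by rewrite nth_cat sL il; apply: hL; rewrite sL.
exists (fun i => pickle (c i)); have dE : dec (fun i => pickle (c i)) = c.
  by apply/funext => i; rewrite /dec pickleK.
split; rewrite rgt_pr dE// => i; rewrite lft_pr.
have ii : i < i.*2.+1 by rewrite ltnS -addnn leq_addr.
have := h1 i i; rewrite size_mkseq nth_mkseq// => /(_ ii) un.
apply: contrapT => nn; apply: un; exists (fun=> 0) => z [pz Cz]; exfalso; apply: nn.
by exists s, z.
Qed.

End perfect.

(** * Well-founded trees, ranks and boundedness *)

Lemma tree_ind (Q : seq nat -> Prop) (Phi : seq nat -> Prop) :
  ~ (exists y, forall n, Q (mkseq y n)) ->
  (forall u, Q u -> (forall k, Q (rcons u k) -> Phi (rcons u k)) -> Phi u) ->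
  Q [::] -> Phi [::].
Proof.
move=> np hs Q0; apply: contrapT => n0; apply: np.
have [||y hy] := @dep_choice _ (fun u => Q u /\ ~ Phi u); last first.
- by exists y => n; case: (hy n).
- move=> u [Qu nu]; apply: contrapT => hh; apply: nu; apply: hs => // k Qk.
  by apply: contrapT => nk; apply: hh; exists k.
- by [].
Qed.

(** Only the last entry of the image of each node is stored, which makes every [eps] a monotone
    length-preserving map. *)
Definition emap (eps : baire) (u : seq nat) : seq nat :=
  mkseq (fun i => eps (pickle (take i.+1 u))) (size u).

Definition emb (D : baire -> Prop) (Q : seq nat -> Prop) s eps :=
  forall u, Q u -> nd D s (emap eps u).

Lemma emb_path D Q s eps y : clos D -> emb D Q s eps -> (forall n, Q (mkseq y n)) ->
  D (pr s (fun i => eps (pickle (mkseq y i.+1)))).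
Proof.
move=> hD he hy; apply: nd_closed => // n; have := he _ (hy n); congr nd.
rewrite /emap size_mkseq; apply: (@eq_from_nth _ 0); rewrite !size_mkseq// => i im.
by rewrite !nth_mkseq// take_mkseq.
Qed.

Section ranks.
Context (D : baire -> Prop) (Q : seq nat -> Prop).
Hypothesis hD : clos D.

(* [rle s t u]: the rank of the tree of [s] below [t] is at most that of [Q] below [u] *)
Inductive rle s : seq nat -> seq nat -> Prop :=
  rleI t u (ka : nat -> nat) :
    (forall k', nd D s (rcons t k') -> Q (rcons u (ka k'))) ->
    (forall k', nd D s (rcons t k') -> rle s (rcons t k') (rcons u (ka k'))) -> rle s t u.

Lemma rleP s t u : rle s t u <-> (forall k', nd D s (rcons t k') ->
    exists k, Q (rcons u k) /\ rle s (rcons t k') (rcons u k)).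
Proof.
split=> [[{}t {}u ka h1 h2] k' nk|h]; first by exists (ka k'); split; [apply: h1|apply: h2].
have /choice[ka hka] : forall k', exists k, nd D s (rcons t k') ->
    Q (rcons u k) /\ rle s (rcons t k') (rcons u k).
  move=> k'; have [/h[k ?]|nk] := pselect (nd D s (rcons t k')); first by exists k.
  by exists 0.
by apply: (@rleI s t u ka) => k' /hka[].
Qed.

Lemma rle_wf s t u : rle s t u -> forall y, pfx t y -> ~ D (pr s y).
Proof.
elim=> {}t {}u ka _ _ IH y py0 Dy; have py := pfx_rcons py0.
apply: (IH (y (size t)) _ y py Dy).
by rewrite -[rcons _ _]py; apply: nd_mkseq.
Qed.

(** As [Q] is well-founded, induction from its leaves expresses the inductive relation by countable
    operations. *)
Lemma rle_borel : ~ (exists y, forall n, Q (mkseq y n)) -> Q [::] ->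
  forall t, BN (fun s => rle s t [::]).
Proof.
move=> np; apply: (@tree_ind Q (fun u => forall t, BN (fun s => rle s t u)) np) => u Qu IH t.
apply: (@sa_ext _ BN (fun s => forall k', nd D s (rcons t k') ->
    exists k, Q (rcons u k) /\ rle s (rcons t k') (rcons u k))).
  by move=> s; split=> /rleP.
apply: (sa_all BNs) => k'; apply: (sa_imp BNs); first exact: sa_nd.
apply: (sa_ex BNs) => k; have [Qk|Qk] := pselect (Q (rcons u k)); last first.
  by apply: (@sa_ext _ BN (fun=> False)) (sa_false BNs) => s; split=> // -[].
apply: (sa_and BNs); [exact: sa_cst|exact: IH].
Qed.

(** When [rle] fails at [t] and [u], some child of [t] fails against all children of [u]. Choosing
    that child along the way maps [Q] into the tree of [s]. *)
Lemma rle_emb s : (forall k u, Q u -> Q (take k u)) -> nd D s [::] ->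
  ~ rle s [::] [::] -> exists eps, emb D Q s eps.
Proof.
move=> Qt nd0 nr.
have /choice[ka hka] : forall tu : seq nat * seq nat, exists k', ~ rle s tu.1 tu.2 ->
    nd D s (rcons tu.1 k') /\ forall k, Q (rcons tu.2 k) -> ~ rle s (rcons tu.1 k') (rcons tu.2 k).
  move=> [t u] /=; have [r|r] := pselect (rle s t u); first by exists 0.
  apply: contrapT => hh; apply: r; apply/rleP => k' nk; apply: contrapT => nr'; apply: hh.
  by exists k' => _; split=> // k Qk r; apply: nr'; exists k.
pose E := fix E n (u : seq nat) := if n is m.+1 then rcons (E m u) (ka (E m u, take m u)) else [::].
have sE n u : size (E n u) = n by elim: n => //= n IH; rewrite size_rcons IH.
have Etake n u k : n <= k -> E n (take k u) = E n u.
  by elim: n => //= n IH nk; rewrite IH ?take_takel// ltnW.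
pose eps m := if (unpickle m : option (seq nat)) is Some v then last 0 (E (size v) v) else 0.
exists eps => u Qu.
have -> : emap eps u = E (size u) u.
  suff h n : n <= size u -> mkseq (fun i => eps (pickle (take i.+1 u))) n = E n u by exact: h.
  elim: n => // n IH nu; rewrite mkseqS IH ?(ltnW nu)// /eps pickleK size_takel// Etake//= last_rcons.
  by [].
suff : forall n, n <= size u -> nd D s (E n u) /\ ~ rle s (E n u) (take n u).
  by case/(_ _ (leqnn _)).
elim=> [|n IH] nu; first by rewrite take0.
have [_ r] := IH (ltnW nu); have [h1 h2] := hka (E n u, take n u) r.
split=> //=; rewrite (take_nth 0 nu); apply: h2.
by rewrite -take_nth//; apply: Qt.
Qed.

End ranks.

(** Boundedness: were there no such embedding, the complement of [U C] would consist of the [s] of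
    rank at most that of [Q], because [rle] excludes branches, and would be Borel. *)
Lemma emb_exists C (Q : seq nat -> Prop) : clos C ->
  (forall k u, Q u -> Q (take k u)) -> ~ (exists y, forall n, Q (mkseq y n)) ->
  ~ BN (fun s => ~ U C s) -> exists s eps, emb (Sch C) Q s eps /\ ~ U C s.
Proof.
move=> hC Qt np nB; apply: contrapT => hh; apply: nB.
have [[s0 hs0]|nU] := pselect (exists s, U C s); last first.
  apply: (@sa_ext _ BN (fun=> True)) (sa_cst BNs True) => s; split=> // _ Us.
  by apply: nU; exists s.
have nd0 s : nd (Sch C) s [::].
  by case: hs0 => y hy; exists s0, y; split=> //; apply: pfx_nil.
have [Q0|Q0] := pselect (Q [::]); last first.
  apply: (@sa_ext _ BN (fun=> False)) (sa_false BNs) => s; split=> // nU; apply: hh.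
  by exists s, (fun=> 0); split=> // u /(Qt 0); rewrite take0.
apply: sa_ext (@rle_borel (Sch C) Q np Q0 [::]) => s; split=> [r [y]|nU].
  exact: (rle_wf r (pfx_nil y)).
apply: contrapT => nr; apply: hh.
by have [eps he] := rle_emb Qt (nd0 s) nr; exists s, eps.
Qed.

(** * Models, and why the uncountable sections form a Borel set *)

Lemma countable_closure (F : nat -> baire -> baire -> baire) x : exists y,
  (exists i, bcol y i = x) /\ forall k i j, exists l, bcol y l = F k (bcol y i) (bcol y j).
Proof.
pose nxt (e : baire) : baire := jn (fun m =>
  if (unpickle m : option (nat + nat * nat * nat)) is Some v then
    match v with inl i => bcol e i | inr (k, i, j) => F k (bcol e i) (bcol e j) end
  else e).
pose E n := iter n nxt (jn (fun=> x)).
have E1 n i : exists j, bcol (E n.+1) j = bcol (E n) i.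
  by exists (pickle (inl i : nat + nat * nat * nat)); rewrite [E n.+1]iterS col_jn pickleK.
have Em n m i : exists j, bcol (E (n + m)) j = bcol (E n) i.
  elim: m => [|m [j <-]]; first by exists i; rewrite addn0.
  by rewrite addnS; apply: E1.
pose y := jn (fun m => if (unpickle m : option (nat * nat)) is Some (n, j) then bcol (E n) j else x).
have yE n j : bcol y (pickle (n, j)) = bcol (E n) j by rewrite col_jn pickleK.
exists y; split; first by exists (pickle (0, 0)); rewrite yE col_jn.
have inE i : exists n j, bcol y i = bcol (E n) j.
  rewrite /y col_jn; case: (unpickle i : option (nat * nat)) => [[n j]|]; first by exists n, j.
  by exists 0, 0; rewrite col_jn.
move=> k i j; have [n [a ->]] := inE i; have [m [b ->]] := inE j.
have [a' <-] := Em n m a; have [b' <-] := Em m n b; rewrite (addnC m n).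
exists (pickle ((n + m).+1, pickle (inr (k, a', b') : nat + nat * nat * nat))).
by rewrite yE [E _.+1]iterS col_jn pickleK.
Qed.

Section models.
Context (C : baire -> Prop).
Hypothesis hC : clos C.

(* A point [N] codes the bit [N 0] and the countable family of the [el N i]. *)
Definition el (N : baire) i := bcol (tl N) i.

(* [Ka a x] is the closed set coded by [a] at [x]; [Qt a x] is a tree for it. *)
Definition Ka a x y := solves a (pr x (lft y)) 0 (rgt y).
Definition Qt a x (u : seq nat) := forall m, m.*2 <= size u ->
  a (pickle (0, mkseq (pr x (lft (nth 0 u))) m, mkseq (rgt (nth 0 u)) m)) = 0.

Lemma Qt_agree a x u v : take (size u) v = u -> Qt a x v -> size u <= size v -> Qt a x u.
Proof.
move=> e h uv m mu.
have -> : mkseq (pr x (lft (nth 0 u))) m = mkseq (pr x (lft (nth 0 v))) m.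
  apply/agree_mkseq; apply: agree_pr => // i im.
  rewrite /lft -[in LHS]e nth_take//; apply: leq_trans mu; by rewrite ltn_double.
have -> : mkseq (rgt (nth 0 u)) m = mkseq (rgt (nth 0 v)) m.
  apply/agree_mkseq => i im; rewrite /rgt -[in LHS]e nth_take//.
  by apply: leq_trans mu; rewrite -doubleS leq_double.
by apply: h; apply: leq_trans uv.
Qed.

Lemma Qt_take a x k u : Qt a x u -> Qt a x (take k u).
Proof.
move=> h; have [ku|ku] := leqP k (size u); last by rewrite take_oversize// ltnW.
by apply: Qt_agree h _; rewrite size_takel.
Qed.

(** The first [m] entries of both halves of [y] are read off [m.*2] entries of [y], whence the bound
    in [Qt]. *)
Lemma Qt_path a x y : (forall n, Qt a x (mkseq y n)) <-> Ka a x y.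
Proof.
have e m n : m.*2 <= n ->
    mkseq (pr x (lft (nth 0 (mkseq y n)))) m = mkseq (pr x (lft y)) m /\
    mkseq (rgt (nth 0 (mkseq y n))) m = mkseq (rgt y) m.
  move=> mn; split; apply/agree_mkseq; first (apply: agree_pr => //); move=> i im.
    by rewrite /lft nth_mkseq// (leq_trans _ mn)// ltn_double.
  by rewrite /rgt nth_mkseq// (leq_trans _ mn)// -doubleS leq_double.
split=> h m; first by have [<- <-] := e m m.*2 (leqnn _); apply: h; rewrite size_mkseq.
by move=> k; rewrite size_mkseq => /e[-> ->].
Qed.

(* A model of [x] is closed under the Borel functions with a code in it, contains [x],
   knows of each of its trees whether it has a branch, and its bit says that
   all the models of [x] belonging to it have bit [<> 1]. *)
Definition model (x N : baire) :=
  [/\ [/\ forall o i, exists j, el N j = uop o (el N i),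
       forall i j, exists k, el N k = pr (el N i) (el N j) &
       forall i j, (forall n, exists k, solves (el N i) (el N j) n (el N k)) ->
         exists k, forall n, solves (el N i) (el N j) n (bcol (el N k) n)],
     [/\ exists i, el N i = x & forall i k, exists j, el N j = el (lft (el N i)) k],
     forall i, (exists k, Sch C (pr (el N i) (el N k))) \/
       (exists j, forall k, C (pr (el N i) (el N k)) -> exists m, el N k = bcol (el N j) m),
     (exists i, Ka (lft x) x (el N i)) \/
       (exists i j, emb (Sch C) (Qt (lft x) x) (el N i) (el N j) /\
         forall k, ~ Sch C (pr (el N i) (el N k))) &
     N 0 = 1 <-> forall i, Ka (lft x) x (el N i) -> lft (el N i) 0 <> 1].

Lemma model_good x N : model x N -> good (fun y => exists i, y = el N i).
Proof.
move=> [[h1 h2 h3] _ _ _ _]; split.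
- by move=> o _ [i ->]; have [j] := h1 o i; exists j.
- by move=> _ _ [i ->] [j ->]; have [k] := h2 i j; exists k.
- move=> _ _ [i ->] [j ->] h; have [|k hk] := h3 i j; last by exists (el N k); split=> //; exists k.
  by move=> n; have [_ [[k ->] ?]] := h n; exists k.
Qed.

Lemma sa_solves T (S : set (set T)) (hS : sigma_algebra setT S) d w n y :
  bf S d -> bf S w -> bf S y -> S (fun x => solves (d x) (w x) n (y x)).
Proof.
move=> hd hw hy; apply: (sa_all hS) => m.
have := df_eval hS hd (df_comp2 hS (fun a b => pickle (n, a, b)) (df_mkseq hS m hw) (df_mkseq hS m hy)).
exact.
Qed.

Lemma sa_Qt T (S : set (set T)) (hS : sigma_algebra setT S) a x u :
  bf S a -> bf S x -> S (fun t => Qt (a t) (x t) u).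
Proof.
move=> ha hx; apply: (sa_all hS) => m; apply: (sa_imp hS); first exact: sa_cst.
have := df_eval hS ha (df_comp hS (fun b => pickle (0, b, mkseq (rgt (nth 0 u)) m))
  (df_mkseq hS m (bf_pr hx (bf_cst hS (lft (nth 0 u)))))).
exact.
Qed.

Lemma sa_emb T (S : set (set T)) (hS : sigma_algebra setT S) D (Q : T -> seq nat -> Prop) s eps :
  (forall u, S (fun t => Q t u)) -> bf S s -> bf S eps -> S (fun t => emb D (Q t) (s t) (eps t)).
Proof.
move=> hQ hs he; apply: (sa_allc hS) => u; apply: (sa_imp hS) => //.
apply: (@sa_ext _ _ (fun t => exists v, emap (eps t) u = v /\ nd D (s t) v)).
  by move=> t; split=> [[v [-> ?]]//|?]; exists (emap (eps t) u).
apply: (sa_exc hS) => v; apply: (sa_and hS); last exact: sa_nd.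
exact: (df_mkseq hS (size u) (phi := fun t i => eps t (pickle (take i.+1 u))) (fun i => he _)).
Qed.

Lemma model_borel : BN (fun p => model (lft p) (rgt p)).
Proof.
have bx : bf BN lft := bf_lft bf_id.
have ba : bf BN (fun p => lft (lft p)) := bf_lft bx.
have bN : bf BN rgt := bf_rgt bf_id.
have be i : bf BN (fun p => el (rgt p) i) := bf_col i (bf_tl bN).
have bC := clos_borel hC; have bS := clos_borel (@clos_Sch C).
have bK i : BN (fun p => Ka (lft (lft p)) (lft p) (el (rgt p) i)).
  by apply: sa_solves => //; [apply: bf_pr => //; apply: bf_lft|apply: bf_rgt].
have bSS i k : BN (fun p => Sch C (pr (el (rgt p) i) (el (rgt p) k))).
  by apply: bf_preim bS => //; apply: bf_pr.
rewrite /model.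
apply: (@sa_ext _ BN (fun p => let x := lft p in let N := rgt p in
  ((forall o i, exists j, el N j = uop o (el N i)) /\
   ((forall i j, exists k, el N k = pr (el N i) (el N j)) /\
    (forall i j, (forall n, exists k, solves (el N i) (el N j) n (el N k)) ->
         exists k, forall n, solves (el N i) (el N j) n (bcol (el N k) n)))) /\
  (((exists i, el N i = x) /\ (forall i k, exists j, el N j = el (lft (el N i)) k)) /\
   ((forall i, (exists k, Sch C (pr (el N i) (el N k))) \/
       (exists j, forall k, C (pr (el N i) (el N k)) -> exists m, el N k = bcol (el N j) m)) /\
    (((exists i, Ka (lft x) x (el N i)) \/
       (exists i j, emb (Sch C) (Qt (lft x) x) (el N i) (el N j) /\
         forall k, ~ Sch C (pr (el N i) (el N k)))) /\
     (N 0 = 1 <-> forall i, Ka (lft x) x (el N i) -> lft (el N i) 0 <> 1)))))).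
  by move=> p /=; split=> [[[? [? ?]] [[? ?] [? [? ?]]]]|[[? ? ?] [? ?] ? ? ?]].
apply: (sa_and BNs).
  apply: (sa_and BNs).
    apply: (sa_allc BNs) => o; apply: (sa_all BNs) => i; apply: (sa_ex BNs) => j.
    by apply: (bf_eq BNs (be j)); apply: (bf_comp BNs (uop_bf o) (be i)).
  apply: (sa_and BNs).
    apply: (sa_all BNs) => i; apply: (sa_all BNs) => j; apply: (sa_ex BNs) => k.
    exact: (bf_eq BNs (be k) (bf_pr (be i) (be j))).
  apply: (sa_all BNs) => i; apply: (sa_all BNs) => j; apply: (sa_imp BNs).
    by apply: (sa_all BNs) => n; apply: (sa_ex BNs) => k; apply: sa_solves.
  apply: (sa_ex BNs) => k; apply: (sa_all BNs) => n; apply: sa_solves => //.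
  exact: (bf_col n (be k)).
apply: (sa_and BNs).
  apply: (sa_and BNs); first by apply: (sa_ex BNs) => i; apply: bf_eq.
  apply: (sa_all BNs) => i; apply: (sa_all BNs) => k; apply: (sa_ex BNs) => j.
  exact: (bf_eq BNs (be j) (bf_col k (bf_tl (bf_lft (be i))))).
apply: (sa_and BNs).
  apply: (sa_all BNs) => i; apply: (sa_or BNs); first by apply: (sa_ex BNs) => k.
  apply: (sa_ex BNs) => j; apply: (sa_all BNs) => k; apply: (sa_imp BNs).
    by apply: bf_preim bC => //; apply: bf_pr.
  apply: (sa_ex BNs) => m; exact: (bf_eq BNs (be k) (bf_col m (be j))).
apply: (sa_and BNs).
  apply: (sa_or BNs); first by apply: (sa_ex BNs) => i.
  apply: (sa_ex BNs) => i; apply: (sa_ex BNs) => j; apply: (sa_and BNs).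
    by apply: sa_emb => // u; apply: sa_Qt.
  by apply: (sa_all BNs) => k; apply: (sa_not BNs).
apply: (sa_iff BNs); first exact: (bN 0 1).
apply: (sa_all BNs) => i; apply: (sa_imp BNs) => //; apply: (sa_not BNs).
exact: (bf_lft (be i) 0 1).
Qed.

Lemma model_exists x : ~ BN (fun s => ~ U C s) -> exists N, model x N.
Proof.
move=> nB.
(* If the coded set is empty its tree is well-founded, and boundedness embeds it at a point outside
   [U C]. *)
have [z1 [z2 hz]] : exists z1 z2, Ka (lft x) x z1 \/
    (emb (Sch C) (Qt (lft x) x) z1 z2 /\ ~ U C z1).
  have [[y hy]|ne] := pselect (exists y, Ka (lft x) x y); first by exists y, y; left.
  have [||s [eps h]] := @emb_exists C (Qt (lft x) x) hC _ _ nB.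
  - by move=> k u; apply: Qt_take.
  - by move=> [y /Qt_path h]; apply: ne; exists y.
  - by exists s, eps; right.
have /choice[f5 h5] : forall dw : baire * baire, exists y,
    (forall n, exists z, solves dw.1 dw.2 n z) -> forall n, solves dw.1 dw.2 n (bcol y n).
  move=> dw; have [/choice[z hz']|ne] := pselect (forall n, exists z, solves dw.1 dw.2 n z).
    by exists (jn z) => _ n; rewrite col_jn.
  by exists dw.1.
have /choice[f6 h6] : forall s, exists y, Sch C (pr s y) \/
    forall z, C (pr s z) -> exists m, z = bcol y m.
  move=> s; have [[y hy]|nU] := pselect (U C s); first by exists y; left.
  have [y hy] : enumerable (fun z => C (pr s z)).
    by apply: contrapT => ne; apply: nU; apply/UP.
  by exists y; right.
(* The functions serve the clauses of [model] in turn: pairing, common solutions, a scheme or an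
   enumeration of a section, the two points found above, and finally transitivity and [uop]. *)
pose F k y z := match k with
  | 0 => pr y z | 1 => f5 (y, z) | 2 => f6 y | 3 => z1 | 4 => z2
  | k'.+4.+1 => if (unpickle k' : option (nat + nat * nat * nat)) is Some v then
      match v with inl i => el (lft y) i | inr o => uop o y end else y end.
have [t [[i0 ti0] tF]] := countable_closure F x.
(* The bit can be set last, as the other clauses only concern the family. *)
pose b := if pselect (forall i, Ka (lft x) x (bcol t i) -> lft (bcol t i) 0 <> 1) then 1 else 0.
exists (cns b t); rewrite /model /el tl_cns; split.
- split.
  + move=> o i; have [j] := tF (pickle (inr o : nat + nat * nat * nat)).+4.+1 i i.
    by rewrite /F pickleK; exists j.
  + by move=> i j; have [k] := tF 0 i j; exists k.
  + move=> i j h; have [k] := tF 1 i j; rewrite /F => e; exists k => n; rewrite e.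
    by apply: (h5 (_, _)) => m; have [l hl] := h m; exists (bcol t l).
- split; first by exists i0.
  move=> i k; have [j] := tF (pickle (inl k : nat + nat * nat * nat)).+4.+1 i i.
  by rewrite /F pickleK; exists j.
- move=> i; have [j] := tF 2 i i; rewrite /F => e; case: (h6 (bcol t i)) => h.
    by left; exists j; rewrite e.
  by right; exists j => k /h; rewrite e.
- have [j1] := tF 3 i0 i0; have [j2] := tF 4 i0 i0; rewrite /F => e2 e1.
  case: hz => [h|[h nU]]; first by left; exists j1; rewrite e1.
  by right; exists j1, j2; rewrite e1 e2; split=> // k hk; apply: nU; exists (bcol t k).
- by rewrite /b /=; case: pselect.
Qed.

End models.

(* [H] lifts pairs [(w, r)] with [r] in Cantor space, and [G] chooses [r] diagonally so that
   [H (G t)] avoids the points listed by [rgt t].  The point [x = (a, c)] is such that [c] codes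
   [H \o G] and the closed set coded by [a] at [x] is the set of all models of [x] (with a
   witness): then every model of [x] contains a model of [x], since otherwise [H \o G] would
   give it a point of a section outside the enumeration it has of this section.  The bits of
   these models form a liar paradox. *)
Lemma universal_lift_borel C : clos C ->
  (forall (W : baire -> Prop) g, BN W -> bf BN g -> (forall w, W w -> U C (g w)) ->
    exists H, [/\ bf BN H, forall w, W w -> C (pr (g w) (H w)) &
      forall w w', W w -> W w' -> H w = H w' -> w = w']) ->
  BN (fun s => ~ U C s).
Proof.
move=> hC lift; apply: contrapT => nB.
have [phi [_ p2 _ p4]] := borel_graph (model_borel hC).
(* With this [a], [Ka a x y] says that [lft y] is a model of [x], the witness [rgt y] being the
   value of [phi]. The same [a] works for all [x], which permits an [x] that contains [a]. *)
have [] := @code_solves (fun _ p => rgt p = phi (lft p) /\ rgt p 0 = 0).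
  move=> _; apply: clos_and => //; apply: clos_fd; exact: (fd_pred (fun k => k = 0) 1).
move=> a ha.
have aK x y : Ka a x y -> model C x (lft y).
  move=> /ha; rewrite rgt_pr lft_pr => -[h1 h2].
  by have /p4 := etrans (congr1 (fun f => f 0) (esym h1)) h2; rewrite rgt_pr lft_pr.
have Ka_ex x N : model C x N -> Ka a x (pr N (phi (pr x N))).
  move=> h; apply/ha; rewrite !(rgt_pr, lft_pr); split=> //.
  by apply/p4; rewrite rgt_pr lft_pr.
pose W w := emb (Sch C) (Qt a (lft (rgt w))) (lft w) (rgt (rgt w)).
have bl : bf BN lft := bf_lft bf_id.
have br : bf BN rgt := bf_rgt bf_id.
have bW : BN W.
  apply: sa_emb => //; [|exact: (bf_rgt br)].
  by move=> u; apply: sa_Qt => //; [apply: bf_cst|apply: bf_lft].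
(* In reality every [x] has a model, so the tree [Qt a x] has a branch and the embedding sends it to
   a scheme. A model may fail to contain such a branch. *)
have WU w : W w -> U C (lft w).
  move=> hw; have [N hN] := model_exists hC (lft (rgt w)) nB.
  have := Ka_ex _ _ hN; set y := pr N _ => hy.
  exists (fun i => rgt (rgt w) (pickle (mkseq y i.+1))).
  apply: emb_path hw _; first exact: clos_Sch.
  exact/Qt_path.
pose W' v := W (lft v) /\ forall n, rgt v n <= 1.
have [|||H [bH CH iH]] := lift W' (fun v => lft (lft v)).
- apply: (sa_and BNs); first exact: (bf_preim BNs bl bW).
  by apply: (sa_all BNs) => n; apply: (df_pred BNs (fun k => k <= 1) (br n)).
- exact: (bf_lft bl).
- by move=> v [/WU].
(* The inverse of [H] on its range: from a listed point it recovers the Cantor coordinate that has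
   to be avoided. *)
have [||J bJ hJ] := @borel_unif (fun y v => W' v /\ H v = y).
- apply: (sa_and BNs).
    apply: (bf_preim BNs br (B := W')); apply: (sa_and BNs); first exact: (bf_preim BNs bl bW).
    by apply: (sa_all BNs) => n; apply: (df_pred BNs (fun k => k <= 1) (br n)).
  by apply: bf_eq => //; apply: (bf_comp BNs bH br).
- by move=> y v v' [w1 <-] [w2 e]; apply: iH.
pose G t := pr (lft t) (fun m => rgt (J (bcol (rgt t) m)) m == 0).
have bG : bf BN G.
  apply: bf_pr => // m; apply: (df_comp BNs (fun k => nat_of_bool (k == 0))).
  exact: (bf_rgt (bf_comp BNs bJ (bf_col m br)) m).
have [c hc] := borel_hyp (bf_comp BNs bH bG).
pose x := pr a c.
have step N : model C x N -> exists i, Ka a x (el N i).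
  move=> hN; have gN := model_good hN.
  have [_ [[ix ixE] _] h6 h1 _] := hN.
  (* Otherwise [N] has an embedding at [el N i] but no scheme there, so some [el N l] lists the
     members of [N] in this section. The value of [H \o G] is such a member by closure, yet avoids
     the list. *)
  rewrite /x lft_pr -/x in h1; case: h1 => // -[i [j [hemb noS]]].
  case: (h6 i) => [[k /noS]//|[l hl]]; exfalso.
  pose A y := exists i, y = el N i.
  have [uA pA _] := gN.
  have Ax : A x by exists ix.
  pose w := pr (el N i) (pr x (el N j)).
  have At : A (pr w (el N l)).
    by apply: (pA _ _ _ _); [apply: (pA _ _ _ _); [exists i|apply: (pA _ _ _ _) => //; exists j]|exists l].
  have Ac k : A (bcol c k).
    have := uA (8, k, 0) _ (uA (1, 0, 0) _ Ax).
    by rewrite /uop /= /x rgt_pr.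
  have [m hm] := hc _ gN Ac _ At; rewrite -/(A _) in At.
  have WG : W' (G (pr w (el N l))).
    rewrite /W' /G lft_pr rgt_pr; split; last by move=> n; apply: leq_b1.
    by rewrite /W !(lft_pr, rgt_pr).
  have := CH _ WG; rewrite {1}/G !lft_pr hm => /hl[q hq].
  have hJG : J (bcol (el N l) q) = G (pr w (el N l)) by apply: hJ; split=> //; rewrite hm hq.
  have : rgt (G (pr w (el N l))) q = (rgt (J (bcol (el N l) q)) q == 0) by rewrite /G !rgt_pr.
  by rewrite hJG; case: (rgt (G (pr w (el N l))) q).
(* If the bit of [N] is [1], all models in [N] have another bit. One of them exists by [step]; its
   own models belong to [N] by transitivity, so its bit must be [1]. *)
have bit0 N : model C x N -> N 0 <> 1.
  move=> hN N1; have [i Ki] := step _ hN.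
  have [_ [_ tr] _ _ [/(_ N1) h _]] := hN; rewrite /x lft_pr -/x in h.
  have := h i Ki; have [_ _ _ _ [_ h']] := aK _ _ Ki => nb; apply: nb; apply: h' => k.
  by have [j <-] := tr i k; rewrite /x lft_pr -/x => /h.
(* Conversely, as no model has bit [1], the last clause of [model] gives [N] the bit [1]. *)
have [N hN] := model_exists hC x nB.
have [_ _ _ _ [_ h]] := hN; apply: (bit0 _ hN); apply: h => i.
by rewrite /x lft_pr -/x => /aK/bit0.
Qed.

(** * Standard Borel spaces as Borel subsets of Baire space *)

Lemma sval_inj T (P : T -> Prop) : injective (@proj1_sig T P).
Proof. by move=> [x px] [y py] /= xy; subst y; congr exist; apply: Prop_irrelevance. Qed.

Section radius.
Context (R : realType).

Definition rad (n : nat) : R := (n.+1%:R^-1)%R.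

Lemma rad_gt0 n : (0 < rad n)%R.
Proof. by rewrite invr_gt0 ltr0n. Qed.

Lemma rad_lt m n : (rad m < rad n)%R = (n < m).
Proof. by rewrite /rad ltf_pV2 ?posrE ?ltr0n// ltr_nat ltnS. Qed.

Lemma rad_le m n : (rad m <= rad n)%R = (n <= m).
Proof. by rewrite leNgt rad_lt -leqNgt. Qed.

Lemma rad_small (e : R) : (0 < e)%R -> exists n, (rad n < e)%R.
Proof.
move=> e0; exists (Num.trunc e^-1); rewrite /rad -[ltRHS]invrK ltf_pV2 ?posrE ?invr_gt0// ?ltr0n//.
exact: truncnS_gt.
Qed.

End radius.
#[global] Hint Resolve rad_gt0 : core.

(* [R] is an argument so that the topology of the metric instance can depend on it *)
Definition closed_space (R : realType) (C : baire -> Prop) : Type := {p : baire | C p}.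

Section closed_space.
Context (R : realType) (C : baire -> Prop).
Implicit Types p q : closed_space R C.

Let dif p q := least (fun n => sval p n <> sval q n).

(** An ultrametric in which the ball of radius [rad R n] is the cylinder of length [n.+1]. *)
Definition cdist p q : R := if pselect (p = q) then 0%R else rad R (dif p q).

Let difP p q : p <> q -> sval p (dif p q) <> sval q (dif p q) /\ agree (dif p q) (sval p) (sval q).
Proof.
move=> pq; have [|h1 h2] := @leastP (fun n => sval p n <> sval q n).
  apply: contrapT => h; apply: pq; apply: sval_inj; apply/funext => n.
  by apply: contrapT => ?; apply: h; exists n.
by split=> // i /h2/contrapT.
Qed.

Lemma cdist_lt p q n : (cdist p q < rad R n)%R <-> agree n.+1 (sval p) (sval q).
Proof.
rewrite /cdist; case: pselect => [e|pq] /=; first by rewrite e rad_gt0; split.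
have [h1 h2] := difP pq; rewrite rad_lt; split=> [h i im|h].
  by apply: h2; apply: leq_trans im h.
by rewrite ltnNge; apply/negP => le; apply: h1; apply: h.
Qed.

Lemma cdistxx p : cdist p p = 0%R.
Proof. by rewrite /cdist; case: pselect. Qed.

Lemma cdist_pos p q : cdist p q = 0%R -> p = q.
Proof.
by rewrite /cdist; case: pselect => //= _ /eqP; rewrite gt_eqF ?rad_gt0.
Qed.

Lemma cdist_sym p q : cdist p q = cdist q p.
Proof.
rewrite /cdist; case: pselect => pq /=; case: pselect => qp //=.
- by case: qp.
- by case: pq.
by congr rad; congr least; apply/funext => n; apply/propext; split=> /nesym.
Qed.

Lemma cdist_ge0 p q : (0 <= cdist p q)%R.
Proof. by rewrite /cdist; case: pselect => //= pq; apply: ltW. Qed.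

Lemma cdist_triangle q p r : (cdist p r <= cdist p q + cdist q r)%R.
Proof.
have [->|pr] := pselect (p = r); first by rewrite cdistxx addr_ge0// cdist_ge0.
have [<-|pq] := pselect (p = q); first by rewrite cdistxx add0r.
have [<-|qr] := pselect (q = r); first by rewrite cdistxx addr0.
rewrite /cdist; case: pselect => //= _; case: pselect => //= _; case: pselect => //= _.
have [h1 h2] := difP pr; have [h3 h4] := difP pq; have [h5 h6] := difP qr.
have [h|h] := leqP (dif p q) (dif p r).
  by apply: (@le_trans _ _ (rad R (dif p q))); rewrite ?rad_le// lerDl ltW// rad_gt0.
have [h'|h'] := leqP (dif q r) (dif p r).
  by apply: (@le_trans _ _ (rad R (dif q r))); rewrite ?rad_le// lerDr ltW// rad_gt0.
by case: h1; rewrite h4// h6.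
Qed.

HB.instance Definition _ := gen_eqMixin (closed_space R C).
HB.instance Definition _ := gen_choiceMixin (closed_space R C).
HB.instance Definition _ := @isMetric.Build R (closed_space R C) cdist
  cdistxx cdist_pos cdist_sym cdist_triangle.

End closed_space.

Section closed_polish.
Context (R : realType) (C : baire -> Prop).
Hypothesis hC : clos C.
Let T : metricType R := closed_space R C.

Lemma ball_agree (p q : T) n : ball p (rad R n) q <-> agree n.+1 (sval p) (sval q).
Proof. by rewrite ballEmdist /=; apply: cdist_lt. Qed.

Lemma closed_space_polish : polish T.
Proof.
split=> [G GP /cauchyP Gc|].
  have /choice[x hx] : forall n, exists x : T, G (ball x (rad R n)) by move=> n; apply: Gc; apply: rad_gt0.
  have ag n m : n <= m -> agree n.+1 (sval (x n)) (sval (x m)).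
    move=> nm; have [z [/ball_agree h1 /ball_agree h2]] := filter_ex (filterI (hx n) (hx m)).
    by move=> i im; rewrite h1// -h2//; apply: leq_trans im _.
  pose y : baire := fun i => sval (x i) i.
  have yx n : agree n.+1 (sval (x n)) y by move=> i; rewrite ltnS => im; rewrite /y -(ag i n im).
  have Cy : C y.
    apply: hC => n; exists (sval (x n)); split; last exact: (proj2_sig (x n)).
    by apply: agree_sym; apply: agreeW (yx n).
  exists (exist _ y Cy : T); apply/fcvg_ballP => e e0; have [n ne] := rad_small e0.
  apply: filterS (hx n) => z /ball_agree xz.
  have /ball_agree : agree n.+1 (sval (exist _ y Cy : T)) (sval z).
    by move=> i im /=; rewrite -(yx n)// xz.
  by apply: le_ball; apply: ltW.
have [[p0 _]|no] := pselect (exists p : T, True); last first.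
  by exists set0; [exact: countable0|move=> O [p]; exfalso; apply: no; exists p].
have /choice[f hf] : forall u : seq nat, exists p : T,
    (exists q : T, pfx u (sval q)) -> pfx u (sval p).
  move=> u; have [[q hq]|no] := pselect (exists q : T, pfx u (sval q)); first by exists q.
  by exists p0.
exists (range f).
  by apply: (sub_countable (card_image_le f setT)); apply: countableP.
move=> O [p Op] oO; move: oO; rewrite openE => /(_ p Op) /nbhs_ballP[e /= e0 eO].
have [n ne] := rad_small e0.
exists (f (mkseq (sval p) n.+1)); split; last by exists (mkseq (sval p) n.+1).
apply: eO; apply: le_ball (ltW ne) _ _; apply/ball_agree.
have := hf (mkseq (sval p) n.+1) (ex_intro _ p (pfx_mkseq _ _)).
by rewrite /pfx size_mkseq => h; apply/agree_mkseq.
Qed.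

Lemma cylinder_open i k : open [set p : T | sval p i = k].
Proof.
rewrite openE => p /= pi; apply/nbhs_ballP; exists (rad R i); first exact: rad_gt0.
by move=> q /ball_agree h /=; rewrite -h.
Qed.

Lemma open_cylinder (O : set T) : open O ->
  exists A : seq nat -> Prop, O = [set p | exists u, A u /\ pfx u (sval p)].
Proof.
move=> oO; exists (fun u => forall p : T, pfx u (sval p) -> O p); apply/seteqP; split=> [p Op|p [u []]].
  move: oO; rewrite openE => /(_ p Op) /nbhs_ballP[e /= e0 eO].
  have [n ne] := rad_small e0; exists (mkseq (sval p) n.+1); split; last exact: pfx_mkseq.
  move=> q hq; apply: eO; apply: le_ball (ltW ne) _ _; apply/ball_agree.
  by rewrite /pfx size_mkseq in hq; apply/agree_mkseq.
exact.
Qed.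

End closed_polish.

Definition trace (T : Type) (j : T -> baire) : set (set T) :=
  [set A | exists B, BN B /\ forall x, A x <-> B (j x)].

Lemma trace_sigma T (j : T -> baire) : sigma_algebra setT (trace j).
Proof.
split=> [|A [B [bB AB]]|A hA].
- by exists (fun=> False); split; [exact: (sa_false BNs)|].
- exists (fun y => ~ B y); split; first exact: (sa_not BNs bB).
  by move=> x; rewrite -AB; split=> [[]|].
- have /choice[B hB] := hA.
  exists (fun y => exists n, B n y); split; first by apply: (sa_ex BNs) => n; case: (hB n).
  move=> x; split=> [[n _ An]|[n Bn]]; exists n => //; by have [_ h] := hB n; apply/h.
Qed.

Lemma trace_bf T (j : T -> baire) : bf (trace j) j.
Proof. by move=> n k; exists (fun y => y n = k); split=> //; apply: bf_id. Qed.

Lemma sigma_min T (G : set (set T)) (S : set (set T)) :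
  sigma_algebra setT S -> G `<=` S -> <<s G >> `<=` S.
Proof. by move=> hS GS; apply: smallest_sub. Qed.

(** Adjoining the witness of [borel_graph] to each code turns the Borel range into a closed set,
    which is Polish. *)
Lemma standard_of_inj (R : realType) (T : Type) (j : T -> baire) : injective j ->
  BN (fun y => exists x, j x = y) -> standard_borel R (trace j).
Proof.
move=> ij /borel_graph[phi [p1 p2 _ p4]].
pose C p := rgt p = phi (lft p) /\ rgt p 0 = 0.
have hC : clos C by apply: clos_and => //; apply: clos_fd; exact: (fd_pred (fun k => k = 0) 1).
exists (closed_space R C); split; first exact: closed_space_polish.
have gP x : C (pr (j x) (phi (j x))).
  by rewrite /C rgt_pr lft_pr; split=> //; apply/p4; exists x.
have /choice[h hh] : forall p : closed_space R C, exists x, j x = lft (sval p).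
  by move=> [p [/= e1 e2]]; apply/p4; rewrite -e1.
pose g x : closed_space R C := exist _ _ (gP x).
exists g; split.
  exists h => [x|p]; first by apply: ij; rewrite hh /= lft_pr.
  by apply: sval_inj; rewrite /= hh -[RHS]pr_eta; case: p => p [/= -> _].
apply/seteqP; split=> [A [B [bB AB]]|A [B hB <-]].
  exists (fun p => B (lft (sval p))).
    apply: (@bf_preim _ <<s @open (closed_space R C) >> _ (fun p => lft (sval p)) B _ bB).
      exact: smallest_sigma_algebra.
    by move=> n k; apply: sub_sigma_algebra; apply: cylinder_open.
  by apply/seteqP; split=> x; rewrite /= lft_pr => /AB.
have hS := trace_sigma j.
suff : <<s @open (closed_space R C) >> `<=` [set B | trace j (g @^-1` B)] by apply.
apply: sigma_min => [|O /open_cylinder[D ->]] /=.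
  split=> [|D hD|D hD] /=.
  - exact: (sa_false hS).
  - by apply: sa_ext (sa_not hS hD) => x; split=> [?|[]].
  - by apply: sa_ext (sa_ex hS hD) => x; split=> [[n ?]|[n _ ?]]; exists n.
apply: (sa_exc hS) => u; apply: (sa_and hS); first exact: sa_cst.
apply: sa_pfx => //; apply: bf_pr; first exact: trace_bf.
exact: (bf_comp hS p1 (trace_bf j)).
Qed.

Section polish_code.
Context (R : realType) (P : metricType R).
Hypothesis hP : polish P.
Implicit Types (p q : P) (y : baire).

Section dense_sequence.
Context (a : nat -> P).
Hypothesis da : forall p (e : R), (0 < e)%R -> exists n, (mdist p (a n) < e)%R.

Let dS p q : mdist p q = mdist q p. Proof. exact: metric_sym. Qed.
Let dT p q z : (mdist p z <= mdist p q + mdist q z)%R. Proof. exact: metric_triangle. Qed.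

Definition jcode p : baire := fun k => least (fun n => (mdist p (a n) < rad R k)%R).

Lemma jcodeP p k : (mdist p (a (jcode p k)) < rad R k)%R.
Proof. by have [h _] := leastP (da p (rad_gt0 R k)). Qed.

Lemma jcode_inj : injective jcode.
Proof.
move=> p q e; apply: mdist_positivity; apply/eqP; rewrite eq_le mdist_ge0 andbT leNgt.
apply/negP => d0; have [|n hn] := @rad_small R (mdist p q / 2)%R; first by rewrite divr_gt0.
have h1 := jcodeP p n; have h2 := jcodeP q n; rewrite e in h1.
have := dT p (a (jcode q n)) q; rewrite (dS (a _) q); lra.
Qed.

(* the limit of the points listed by [y] is closer than [rad R k] to [a m] *)
Definition lim_close y k m := exists i N, forall l, N <= l ->
  (mdist (a (y l)) (a m) + rad R i < rad R k)%R.

Lemma lim_closeP p y k m : (forall l, mdist p (a (y l)) < rad R l)%R ->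
  lim_close y k m <-> (mdist p (a m) < rad R k)%R.
Proof.
move=> py; split=> [[i [N h]]|h].
  have := h _ (leq_maxl N i); have := py (maxn N i).
  have : (rad R (maxn N i) <= rad R i)%R by rewrite rad_le leq_maxr.
  have := dT p (a (y (maxn N i))) (a m); lra.
have [|i hi] := @rad_small R ((rad R k - mdist p (a m)) / 2)%R; first by lra.
exists i, i => l il; have : (rad R l <= rad R i)%R by rewrite rad_le.
have := py l; have := dT (a (y l)) p (a m); rewrite (dS (a (y l)) p); lra.
Qed.

Lemma lim_close_borel k m : BN (fun y => lim_close y k m).
Proof.
apply: (sa_ex BNs) => i; apply: (sa_ex BNs) => N; apply: (sa_all BNs) => l.
apply: (sa_imp BNs); first exact: sa_cst.
exact: (df_pred BNs (fun n => (mdist (a n) (a m) + rad R i < rad R k)%R) (bf_id l)).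
Qed.

(** The first condition makes the listed points a Cauchy sequence, the second says that [y] is the
    code of its limit; [lim_close] expresses distances to the limit without mentioning it. *)
Lemma jcode_range y : (exists p, jcode p = y) <->
  (forall k l, (mdist (a (y k)) (a (y l)) < rad R k + rad R l)%R) /\
  (forall k, lim_close y k (y k) /\ forall m, m < y k -> ~ lim_close y k m).
Proof.
split=> [[p <-]|[h1 h2]].
  have hp l := jcodeP p l; split=> [k l|k].
    have := hp k; have := hp l; have := dT (a (jcode p k)) p (a (jcode p l)).
    rewrite (dS (a _) p); lra.
  have [l1 l2] := leastP (da p (rad_gt0 R k)).
  split=> [|m mk]; rewrite (lim_closeP _ _ hp) //; exact: l2.
have [p hp] : exists p, (fun n => a (y n)) @ \oo --> p.
  apply: hP.1; apply: cauchy_exP => e e0.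
  have [|n hn] := @rad_small R (e / 2)%R; first by rewrite divr_gt0.
  exists (a (y n)); exists n => // m /= nm; rewrite ballEmdist /=.
  have := h1 n m; have : (rad R m <= rad R n)%R by rewrite rad_le.
  lra.
have py l : (mdist p (a (y l)) <= rad R l)%R.
  apply/ler_addgt0Pl => e e0.
  have [|i hi] := @rad_small R (e / 2)%R; first by rewrite divr_gt0.
  have [|N _ hN] := (fcvg_ballP _).1 hp (rad R i); first exact: rad_gt0.
  have := hN (maxn N i) (leq_maxl N i); rewrite /= ballEmdist /=.
  have : (rad R (maxn N i) <= rad R i)%R by rewrite rad_le leq_maxr.
  have := h1 (maxn N i) l; have := dT p (a (y (maxn N i))) (a (y l)); lra.
(* The distances to the limit are only known to satisfy the weak inequality [py], so [lim_closeP]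
   does not apply directly. *)
have cl k m : lim_close y k m <-> (mdist p (a m) < rad R k)%R.
  split=> [[i [N h]]|h].
    have := h _ (leq_maxl N i); have := py (maxn N i).
    have : (rad R (maxn N i) <= rad R i)%R by rewrite rad_le leq_maxr.
    have := dT p (a (y (maxn N i))) (a m); lra.
  have [|i hi] := @rad_small R ((rad R k - mdist p (a m)) / 2)%R; first by lra.
  exists i, i => l il; have : (rad R l <= rad R i)%R by rewrite rad_le.
  have := py l; have := dT (a (y l)) p (a m); rewrite (dS (a (y l)) p); lra.
exists p; apply/funext => k; have [/cl l1 l2] := h2 k.
by apply: least_unique => // m /l2 + /cl.
Qed.

Lemma jcode_range_borel : BN (fun y => exists p, jcode p = y).
Proof.
apply: sa_ext (fun y => iff_sym (jcode_range y)) _; apply: (sa_and BNs).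
  apply: (sa_all BNs) => k; apply: (sa_all BNs) => l.
  exact: (df_pred2 BNs (fun n n' => (mdist (a n) (a n') < rad R k + rad R l)%R) (bf_id k) (bf_id l)).
apply: (sa_all BNs) => k; apply: (sa_and BNs).
  apply: (@sa_ext _ BN (fun y => exists m, y k = m /\ lim_close y k m)).
    by move=> y; split=> [[m [->]]//|?]; exists (y k).
  by apply: (sa_ex BNs) => m; apply: (sa_and BNs); [apply: bf_id|apply: lim_close_borel].
apply: (sa_all BNs) => m; apply: (sa_imp BNs).
  exact: (df_pred BNs (fun n => m < n) (bf_id k)).
by apply: (sa_not BNs); apply: lim_close_borel.
Qed.

Lemma jcode_trace : <<s @open P >> = trace jcode.
Proof.
have hS : sigma_algebra setT <<s @open P >> by exact: smallest_sigma_algebra.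
have ob m k : <<s @open P >> (fun p => (mdist p (a m) < rad R k)%R).
  apply: sub_sigma_algebra; rewrite openE => p /= pk; apply/nbhs_ballP.
  exists (rad R k - mdist p (a m))%R; first by rewrite /= subr_gt0.
  move=> q; rewrite ballEmdist /= => pq; have := dT q p (a m); rewrite (dS q p); lra.
apply/seteqP; split.
  apply: sigma_min => [|O oO]; first exact: trace_sigma.
  apply: (@sa_ext _ _ (fun p => exists m k, (forall q, (mdist q (a m) < rad R k)%R -> O q) /\
      (mdist p (a m) < rad R k)%R)).
    move=> p; split=> [[m [k [h /h]]]//|Op].
    move: oO; rewrite openE => /(_ p Op) /nbhs_ballP[e /= e0 eO].
    have [|k hk] := @rad_small R (e / 2)%R; first by rewrite divr_gt0.
    have [m hm] := da p (rad_gt0 R k); exists m, k; split=> // q hq.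
    apply: eO; rewrite ballEmdist /=; have := dT p (a m) q; rewrite (dS (a _) q); lra.
  have hT := trace_sigma jcode.
  apply: (sa_ex hT) => m; apply: (sa_ex hT) => k; apply: (sa_and hT); first exact: sa_cst.
  exists (fun y => lim_close y k m); split; first exact: lim_close_borel.
  by move=> p; rewrite (lim_closeP _ _ (jcodeP p)).
move=> A [B [bB AB]]; apply: sa_ext (fun p => iff_sym (AB p)) _.
apply: (bf_preim hS _ bB) => k; apply: df_least => // n; exact: ob.
Qed.

End dense_sequence.

Lemma polish_code : exists j : P -> baire,
  [/\ injective j, BN (fun y => exists x, j x = y) & <<s @open P >> = trace j].
Proof.
have [[p0 _]|no] := pselect (exists p : P, True); last first.
  exists (fun=> fun=> 0); split=> [p||]; first by exfalso; apply: no; exists p.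
    apply: (@sa_ext _ BN (fun=> False)) (sa_false BNs) => y.
    by split=> // -[p]; exfalso; apply: no; exists p.
  have e (A A' : set P) : A = A'.
    by apply/funext => p; exfalso; apply: no; exists p.
  have hT := trace_sigma (fun _ : P => (fun=> 0) : baire).
  apply/seteqP; split=> A _; rewrite (e A (fun=> False)); first exact: (sa_false hT).
  by apply: sa_false; apply: smallest_sigma_algebra.
have [_ [A /countable_injP[f fi] dA]] := hP.
pose a n := xget p0 [set p | A p /\ f p = n].
have da p (e : R) : (0 < e)%R -> exists n, (mdist p (a n) < e)%R.
  move=> e0; have [||q [hq Aq]] := dA (ball p e)^°; last first.
  - exists (f q); have [/= h1 h2] : [set p | A p /\ f p = f q] (a (f q)) by apply: (@xgetI _ _ _ q).
    have -> : a (f q) = q by apply: fi => //; rewrite inE.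
    by have := interior_subset hq; rewrite ballEmdist.
  - exact: open_interior.
  - by exists p; apply: nbhsx_ballx.
exists (jcode a); split; [exact: jcode_inj|exact: jcode_range_borel|exact: jcode_trace].
Qed.

End polish_code.

Lemma sb_code (R : realType) (X : standardBorel R) : exists j : X -> baire,
  [/\ injective j, BN (fun y => exists x, j x = y) & @borel R X = trace j].
Proof.
case: X => X S /= [P [hP [g [[h gh hg] ->]]]].
have [j [ij rj tj]] := polish_code hP.
exists (fun x => j (g x)); split.
- by move=> x y /ij/(can_inj gh).
- apply: sa_ext rj => y; split=> [[p <-]|[x <-]]; last by exists (g x).
  by exists (h p); rewrite hg.
- rewrite tj; apply/seteqP; split=> [_ [B [D [bD BD]] <-]|A [B [bB AB]]].
    by exists D; split=> // x; apply: BD.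
  exists (fun p => B (j p)); first by exists B.
  by apply/seteqP; split=> x /AB.
Qed.

(** * Cardinalities and their Borel computation *)

Lemma card_le_rel T U (A : set T) (B : set U) (r : T -> U -> Prop) :
  (forall x, A x -> exists y, B y /\ r x y) ->
  (forall x x' y, A x -> A x' -> r x y -> r x' y -> x = x') -> A #<= B.
Proof.
move=> h1 h2; apply/card_leP.
have /choice[f hf] : forall x : A, exists y : B, r (set_val x) (set_val y).
  move=> x; have [y [By xy]] := h1 _ (set_valP x).
  by exists (SigSub (mem_set By)).
apply/injfunPex; exists f => // x y _ _ e; apply: val_inj.
apply: (h2 _ _ (set_val (f x))); [exact: set_valP|exact: set_valP|exact: hf|].
by rewrite e; apply: hf.
Qed.

Lemma ker_card T U V (A : set T) (f : T -> U) (g : T -> V) :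
  (forall x y, A x -> A y -> f x = f y <-> g x = g y) -> f @` A #= g @` A.
Proof.
move=> h; apply: Cantor_Bernstein.
  apply: (@card_le_rel _ _ _ _ (fun u v => exists x, [/\ A x, f x = u & g x = v])).
    by move=> _ [x Ax <-]; exists (g x); split; exists x.
  by move=> u u' v _ _ [x [Ax <- xv]] [y [Ay <- yv]]; apply/h => //; rewrite xv yv.
apply: (@card_le_rel _ _ _ _ (fun v u => exists x, [/\ A x, f x = u & g x = v])).
  by move=> _ [x Ax <-]; exists (f x); split; exists x.
by move=> u u' v _ _ [x [Ax xv <-]] [y [Ay yv <-]]; apply/h => //; rewrite xv yv.
Qed.

Lemma card_is_unique T (A : set T) k k' : card_is A k -> card_is A k' -> k = k'.
Proof.
have ni n : `I_n #= [set: nat] -> False.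
  by move=> e; apply: infinite_nat; rewrite -(eq_finite_set e); apply: finite_II.
case: k k' => [n|] [m|] //= h h'.
- by congr Some; apply/card_eq_II; apply: card_eq_trans h'; rewrite card_eq_sym.
- by case: (ni n); apply: card_eq_trans h'; rewrite card_eq_sym.
- by case: (ni m); apply: card_eq_trans h; rewrite card_eq_sym.
Qed.

Lemma ccardE T (A : set T) k : card_is A k -> ccard A = k.
Proof. by move=> h; apply: (card_is_unique (A := A)) => //; apply: (xgetI None h). Qed.

Lemma card_is_eq T U (A : set T) (B : set U) k : A #= B -> card_is A k -> card_is B k.
Proof.
by rewrite card_eq_sym; case: k => [n|] /= e h; apply: card_eq_trans h.
Qed.

Lemma ccard_eq T U (A : set T) (B : set U) : A #= B -> ccard A = ccard B.
Proof.
move=> e; rewrite /ccard; congr xget; apply/seteqP; split=> k; first exact: card_is_eq.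
by apply: card_is_eq; rewrite card_eq_sym.
Qed.

Section rank.
Context (M : nat -> Prop).

(** On [M] this is the increasing numbering by an initial segment of the natural numbers; it will
    also number the points of countable fibres. *)
Definition cnt n := count (fun m => `[< M m >]) (iota 0 n).

Lemma cntS n : cnt n.+1 = cnt n + `[< M n >].
Proof. by rewrite /cnt -addn1 iotaD count_cat /= addn0. Qed.

Lemma cnt_le m n : m <= n -> cnt m <= cnt n.
Proof.
move=> /subnKC <-; elim: (n - m) => [|k IH]; first by rewrite addn0.
by rewrite addnS cntS (leq_trans IH)// leq_addr.
Qed.

Lemma cnt_lt m n : M m -> m < n -> cnt m < cnt n.
Proof.
move=> Mm /cnt_le; apply: leq_trans; rewrite cntS.
by case: asboolP => // _; rewrite addn1.
Qed.

Lemma cnt_inj m n : M m -> M n -> cnt m = cnt n -> m = n.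
Proof.
by move=> Mm Mn e; case: (ltngtP m n) => // h; [have := cnt_lt Mm h|have := cnt_lt Mn h]; rewrite e ltnn.
Qed.

Lemma cnt_surj i n : i < cnt n -> exists m, [/\ M m, m < n & cnt m = i].
Proof.
elim: n => // n IH; rewrite cntS; have [Mn|Mn] := asboolP (M n); last first.
  by rewrite addn0 => /IH[m [? ? ?]]; exists m; split=> //; apply: ltnW.
rewrite addn1 ltnS leq_eqVlt => /orP[/eqP->|/IH[m [? ? ?]]]; first by exists n.
by exists m; split=> //; apply: ltnW.
Qed.

Lemma card_bounded n N : cnt N = n -> (forall N', cnt N' <= n) -> M #= `I_n.
Proof.
move=> nN le; apply: Cantor_Bernstein.
  apply: (@card_le_rel _ _ _ _ (fun m i => cnt m = i)).
    move=> m Mm; exists (cnt m); split=> //=; apply: leq_trans (le m.+1).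
    exact: (cnt_lt Mm).
  by move=> m m' i Mm Mm' <- e; apply: cnt_inj.
apply: (@card_le_rel _ _ _ _ (fun i m => cnt m = i)).
  by move=> i /=; rewrite -{1}nN => /cnt_surj[m [? _ ?]]; exists m.
by move=> i i' m _ _ <- <-.
Qed.

Lemma card_unbounded : (forall n, exists N, n < cnt N) -> M #= [set: nat].
Proof.
move=> h; apply: Cantor_Bernstein; first exact: card_leT.
apply: (@card_le_rel _ _ _ _ (fun i m => cnt m = i)).
  by move=> i _; have [N /cnt_surj[m [? _ ?]]] := h i; exists m.
by move=> i i' m _ _ <- <-.
Qed.

Lemma cnt_cases : (forall n, exists N, n < cnt N) \/
  exists N, forall N', N <= N' -> cnt N' = cnt N.
Proof.
have [|/existsNP[n hn]] := pselect (forall n, exists N, n < cnt N); [by left|right].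
have bd N : cnt N <= n by rewrite leqNgt; apply/negP => ?; apply: hn; exists N.
have [N hN] : exists N, forall N', cnt N' <= cnt N.
  elim: n bd {hn} => [|n IH] bd; first by exists 0 => N'; have := bd N'; rewrite leqn0 => /eqP->.
  have [h|/existsNP[N hN]] := pselect (forall N, cnt N <= n); first exact: IH.
  exists N => N'; apply: leq_trans (bd N') _; by rewrite ltnNge; apply/negP.
by exists N => N' le; apply/eqP; rewrite eqn_leq hN cnt_le.
Qed.

(** Cardinality becomes a countable condition on membership, and so depends on [M] in a Borel
    way. *)
Lemma ccard_cnt n : ccard M = Some n <-> exists N, forall N', N <= N' -> cnt N' = n.
Proof.
have fin N k : (forall N', N <= N' -> cnt N' = k) -> ccard M = Some k.
  move=> h; apply: ccardE => /=; apply: (@card_bounded k N) => [|N']; first exact: h.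
  by rewrite -(h (maxn N N') (leq_maxl _ _)) cnt_le// leq_maxr.
split=> [e|[N h]]; last exact: fin h.
have [h|[N h]] := cnt_cases; last first.
  by exists N; have := fin _ _ h; rewrite e => -[->].
by have := ccardE (k := None) (card_unbounded h); rewrite e.
Qed.

Lemma card_is_ccard : card_is M (ccard M).
Proof.
apply: (xgetPex None); have [h|[N h]] := cnt_cases; first by exists None; apply: card_unbounded.
exists (Some (cnt N)); apply: (@card_bounded _ N) => // N'.
by rewrite -(h (maxn N N') (leq_maxl _ _)) cnt_le// leq_maxr.
Qed.

Lemma cnt_image m : M m -> if ccard M is Some n then cnt m < n else true.
Proof.
move=> Mm; case e : (ccard M) => [n|] //; have [N hN] := (ccard_cnt n).1 e.
by rewrite -(hN (maxn N m.+1) (leq_maxl _ _)); apply: cnt_lt Mm _; rewrite leq_maxr.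
Qed.

Lemma cnt_onto i : (if ccard M is Some n then i < n else true) -> exists m, M m /\ cnt m = i.
Proof.
case e : (ccard M) => [n|] h.
  have [N hN] := (ccard_cnt n).1 e; rewrite -(hN N (leqnn _)) in h.
  by have [m [? _ ?]] := cnt_surj h; exists m.
have [h'|[N hN]] := cnt_cases.
  by have [N /cnt_surj[m [? _ ?]]] := h' i; exists m.
by have /ccard_cnt : exists N', forall N'', N' <= N'' -> cnt N'' = cnt N; [exists N|rewrite e].
Qed.

End rank.

Lemma df_cnt T (S : set (set T)) (hS : sigma_algebra setT S) (M : T -> nat -> Prop) n :
  (forall m, S (fun x => M x m)) -> df S (fun x => cnt (M x) n).
Proof.
move=> hM; elim: n => [|n IH]; first exact: df_cst.
under eq_fun do rewrite cntS; apply: (df_comp2 hS (fun a (b : bool) => a + b)) => // b.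
apply: (@sa_ext _ _ (fun x => if b then M x n else ~ M x n)).
  by move=> x; case: b; case: asboolP; split.
by case: b => //; apply: (sa_not hS).
Qed.

Lemma df_ccard_nat T (S : set (set T)) (hS : sigma_algebra setT S) (M : T -> nat -> Prop) :
  (forall m, S (fun x => M x m)) -> df S (fun x => ccard (M x)).
Proof.
move=> hM; have dc n := df_cnt hS n hM.
have some n : S (fun x => ccard (M x) = Some n).
  apply: (@sa_ext _ _ (fun x => exists N, forall N', N <= N' -> cnt (M x) N' = n)).
    by move=> x; rewrite ccard_cnt.
  apply: (sa_ex hS) => N; apply: (sa_all hS) => N'; apply: (sa_imp hS) (dc N' n).
  exact: sa_cst.
case=> [n|] //; apply: (@sa_ext _ _ (fun x => forall n, ~ ccard (M x) = Some n)).
  by move=> x; case: (ccard (M x)) => [n|]; split=> // /(_ n).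
by apply: (sa_all hS) => n; apply: (sa_not hS).
Qed.

(** Enumerations have repetitions; values are counted at their first occurrence. *)
Definition firsts V (M : nat -> Prop) (v : nat -> V) m :=
  M m /\ forall m', m' < m -> M m' -> v m' <> v m.

Lemma firsts_card V (M : nat -> Prop) (v : nat -> V) : v @` M #= firsts M v.
Proof.
have -> : v @` M = v @` firsts M v.
  apply/seteqP; split=> [_ [m Mm <-]|_ [m [Mm _] <-]]; last by exists m.
  have [|[h1 h2] h3] := @leastP (fun m' => M m' /\ v m' = v m); first by exists m.
  exists (least (fun m' => M m' /\ v m' = v m)) => //; split=> // m' lt Mm' e.
  by apply: (h3 m' lt); rewrite -h2.
apply: inj_card_eq => m m'; rewrite !inE => -[Mm hm] [Mm' hm'] e.
by case: (ltngtP m m') => // [/hm'|/hm]; [move=> /(_ Mm)/(_ e)|move=> /(_ Mm')/(_ (esym e))].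
Qed.

Lemma df_ccard T (S : set (set T)) (hS : sigma_algebra setT S) V U
    (A : T -> set U) (M : T -> nat -> Prop) (v : T -> nat -> V) :
  (forall x, A x #= v x @` M x) -> (forall m, S (fun x => M x m)) ->
  (forall m m', S (fun x => v x m = v x m')) -> df S (fun x => ccard (A x)).
Proof.
move=> AM hM hv.
rewrite (_ : (fun x => ccard (A x)) = (fun x => ccard (firsts (M x) (v x)))); last first.
  by apply/funext => x; apply: ccard_eq; apply: card_eq_trans (AM x) (firsts_card _ _).
apply: df_ccard_nat => // m; apply: (sa_and hS) => //; apply: (sa_all hS) => m'.
apply: (sa_imp hS); first exact: sa_cst.
by apply: (sa_imp hS) => //; apply: (sa_not hS).
Qed.

(** * The local fine shape as a Borel map on codes of classes *)

Section lfs_transport.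
Context (R : realType).

Lemma lfsE (X : standardBorel R) (E F : X -> X -> Prop) x (C : quot F) k :
  RelationClasses.Equivalence E -> RelationClasses.Equivalence F ->
  (forall x y, E x y -> F x y) -> set_val C = [set y | F x y] ->
  lfs E F C k = ccard ((fun y => [set z | E y z]) @`
    [set y | F x y /\ ccard [set z | E y z] = val k]).
Proof.
move=> [rE sE tE] [rF sF tF] EF Cx; rewrite /lfs Cx; congr ccard.
apply/seteqP; split=> [D [[y _ <-] DC cD]|_ [y [Fxy cy] <-]].
  by exists y => //; split=> //; apply: DC; apply: rE.
by split=> //; [exists y|move=> z /= /EF; apply: tF].
Qed.

(** The image of [phi] need only be saturated, so the lemma serves both for isomorphisms and for the
    inclusion into an enlarged space. *)
Lemma lfs_emb (X X' : standardBorel R) (E F : X -> X -> Prop) (E' F' : X' -> X' -> Prop)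
    (phi : X -> X') x (C : quot F) (C' : quot F') :
  RelationClasses.Equivalence E -> RelationClasses.Equivalence F ->
  RelationClasses.Equivalence E' -> RelationClasses.Equivalence F' ->
  (forall x y, E x y -> F x y) -> (forall x y, E' x y -> F' x y) -> injective phi ->
  (forall x y, E x y <-> E' (phi x) (phi y)) -> (forall x y, F x y <-> F' (phi x) (phi y)) ->
  (forall x u, F' (phi x) u -> exists y, u = phi y) ->
  set_val C = [set y | F x y] -> set_val C' = [set u | F' (phi x) u] ->
  lfs E' F' C' = lfs E F C.
Proof.
move=> hE hF hE' hF' EF EF' ip pE pF sat Cx Cx'; apply/funext => k.
rewrite (lfsE k hE hF EF Cx) (lfsE k hE' hF' EF' Cx').
have cE y : ccard [set u | E' (phi y) u] = ccard [set z | E y z].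
  apply: ccard_eq; rewrite (_ : [set u | _] = phi @` [set z | E y z]).
    by apply: inj_card_eq => a b _ _ /ip.
  apply/seteqP; split=> [u /= h|_ [z /pE h <-]//].
  by have [z uz] := sat _ _ (EF' _ _ h); exists z => //; apply/pE; rewrite -uz.
rewrite (_ : [set y | F' (phi x) y /\ _] = phi @` [set y | F x y /\ ccard [set z | E y z] = val k]).
  rewrite image_comp; apply: ccard_eq; apply: ker_card => y z _ _ /=.
  have eqc (T : Type) (Q : T -> T -> Prop) a b : RelationClasses.Equivalence Q ->
      [set z | Q a z] = [set z | Q b z] <-> Q a b.
    move=> [rQ sQ tQ]; split=> [/(congr1 (fun A => A b))/= ->//|ab].
    by apply/seteqP; split=> t /=; apply: tQ => //; apply: sQ.
  by rewrite !eqc// -pE.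
apply/seteqP; split=> [u /= [h cu]|_ [y [/= Fy cy] <-]].
  have [y uy] := sat _ _ h; exists y => //=; rewrite -cE -uy; split=> //.
  by apply/pF; rewrite -uy.
by rewrite cE; split=> //; apply/pF.
Qed.

End lfs_transport.

Lemma enum_borel (K : baire -> baire -> Prop) : BN (fun p => K (lft p) (rgt p)) ->
  (forall s, enumerable (K s)) ->
  exists2 Y, bf BN Y & forall s z, K s z -> exists m, z = bcol (Y s) m.
Proof.
move=> /an_proj[C [c1 c2 c3 c4]] eK.
have [|Y bY hY] := lusin_novikov c1.
  move=> s; have [y hy] := eK s.
  have /choice[q hq] : forall m, exists q, forall q', C (pr s q') -> lft q' = bcol y m -> q' = q.
    move=> m; have [[q [Cq eq]]|no] := pselect (exists q, C (pr s q) /\ lft q = bcol y m).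
      by exists q => q' Cq' e'; apply: c4 Cq' Cq _; rewrite e' eq.
    by exists y => q' Cq' e'; exfalso; apply: no; exists q'.
  exists (jn q) => z Cz; have [m e] := hy _ (c2 _ _ Cz); exists m.
  by rewrite col_jn; apply: hq.
exists (fun s => jn (fun m => lft (bcol (Y s) m))).
  by apply: bf_jn => // m; apply: bf_lft; apply: bf_col.
move=> s z /c3[t /hY[m e]]; exists m; by rewrite col_jn -e lft_pr.
Qed.

Lemma countable_enumerable T (A : set T) (phi : T -> baire) : countable A ->
  enumerable (fun z => exists x, A x /\ phi x = z).
Proof.
move=> /countable_injP[f fi].
have /choice[q hq] : forall n, exists z, forall x, A x -> f x = n -> phi x = z.
  move=> n; have [[x [Ax fx]]|no] := pselect (exists x, A x /\ f x = n).
    by exists (phi x) => x' Ax' fx'; congr phi; apply: fi; rewrite ?inE// fx' fx.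
  by exists (fun=> 0) => x Ax fx; exfalso; apply: no; exists x.
by exists (jn q) => z [x [Ax <-]]; exists (f x); rewrite col_jn; apply: hq.
Qed.

Section coded_space.
Context (R : realType) (X : standardBorel R) (j : X -> baire).
Hypotheses (ij : injective j) (rj : BN (fun y => exists x, j x = y)) (tj : @borel R X = trace j).

Lemma borel_sigma : sigma_algebra setT (@borel R X).
Proof. by rewrite tj; apply: trace_sigma. Qed.

Lemma img_borel (A : X -> Prop) : @borel R X A -> BN (fun y => exists x, j x = y /\ A x).
Proof.
rewrite tj => -[B [bB AB]]; apply: sa_ext (sa_and BNs rj bB) => y.
by split=> [[[x <-] /AB Ax]|[x [<- /AB Bx]]]; [exists x|split=> //; exists x].
Qed.

Lemma code_ext (phi : X -> baire) : bf (@borel R X) phi ->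
  exists2 psi, bf BN psi & forall x, psi (j x) = phi x.
Proof.
move=> hp; exists (fun y n => least (fun k => exists x, j x = y /\ phi x n = k)).
  by move=> n; apply: df_least => // k; apply: img_borel; apply: hp.
move=> x; apply/funext => n; apply: least_unique; first by exists x.
by move=> m mn [x' [/ij -> e]]; rewrite e ltnn in mn.
Qed.

(** The enumeration may contain points outside the class; the second clause allows them to be
    discarded in a Borel way. *)
Lemma fiber_enum (rho : X -> baire) : bf (@borel R X) rho ->
  (forall x, countable [set y | rho x = rho y]) -> exists Y,
  [/\ bf BN Y, forall m, BN (fun y => exists x, j x = bcol (Y y) m /\ rho x = y) &
      forall x, exists m, j x = bcol (Y (rho x)) m].
Proof.
move=> br cr; have [psi bp hp] := code_ext br.
have bl : bf BN lft := bf_lft bf_id.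
have bR : bf BN rgt := bf_rgt bf_id.
pose K y z := (exists x, j x = z) /\ psi z = y.
have [||Y bY hY] := @enum_borel K.
- apply: (sa_and BNs); first exact: (bf_preim BNs bR rj).
  by apply: bf_eq => //; apply: (bf_comp BNs bp bR).
- move=> s; have [[x rx]|no] := pselect (exists x, rho x = s); last first.
    by exists s => z [[x <-]]; rewrite hp => rx; exfalso; apply: no; exists x.
  apply: enumerable_sub (countable_enumerable j (cr x)) => z [[x' <-]].
  by rewrite hp -rx => e; exists x'.
exists Y; split=> [//|m|x].
  apply: (@sa_ext _ BN (fun y => (exists x, j x = bcol (Y y) m) /\ psi (bcol (Y y) m) = y)).
    move=> y; split=> [[[x e]]|[x [<- <-]]]; first by rewrite -e hp => ry; exists x.
    by rewrite hp; split=> //; exists x.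
  have bc : bf BN (fun y => bcol (Y y) m) by apply: bf_col.
  apply: (sa_and BNs); first exact: (bf_preim BNs bc rj).
  by apply: bf_eq => //; apply: (bf_comp BNs bp bc).
by apply: hY; split; [exists x|apply: hp].
Qed.

End coded_space.

Lemma smooth_code (R : realType) (X : standardBorel R) (E : X -> X -> Prop) : smooth E ->
  exists2 rho : X -> baire, bf (@borel R X) rho & forall x y, E x y <-> rho x = rho y.
Proof.
move=> [Z [f [bf_f Ef]]]; have [j [ij rj tj]] := sb_code Z.
exists (fun x => j (f x)); last first.
  by move=> x y; rewrite Ef; split=> [->//|/ij].
move=> n k; apply: (bf_f (fun z => j z n = k)); rewrite tj; exact: trace_bf.
Qed.

Definition cw (k : natw) : nat := if k is Some n then n.+1 else 0.
Definition dw (n : nat) : natw := if n is k.+1 then Some k else None.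

Lemma cwK : cancel cw dw. Proof. by case. Qed.
Lemma dwK : cancel dw cw. Proof. by case. Qed.

Lemma pw_subproof n : (if n is k.+1 then Some k.+1 else None : natw) != Some 0.
Proof. by case: n. Qed.

Definition pw (n : nat) : posw := exist (fun m : natw => m != Some 0) _ (pw_subproof n).

Lemma pw_surj (m : posw) : exists n, m = pw n.
Proof.
case: m => -[[|k]|] // h; first by exists k.+1; apply: val_inj.
by exists 0; apply: val_inj.
Qed.

(** Two conventions meet: index [0] is the size omega, and by [cw] the value [0] is the number omega
    while [m.+1] is the number [m]. Value [1] thus means that there is no class of that size. *)
Definition enc (a : posw -> natw) : baire := fun n => cw (a (pw n)).

Lemma enc_inj : injective enc.
Proof.
move=> a b e; apply/funext => m; have [n ->] := pw_surj m.
by apply: (can_inj cwK); apply: (congr1 (fun f => f n) e).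
Qed.

Section lfs_code.
Context (R : realType) (X : standardBorel R) (E F : X -> X -> Prop).
Context (j : X -> baire) (rE rF : X -> baire).
Hypotheses (ij : injective j) (rj : BN (fun y => exists x, j x = y)) (tj : @borel R X = trace j).
Hypotheses (bE : bf (@borel R X) rE) (hE : forall x y, E x y <-> rE x = rE y).
Hypotheses (bF : bf (@borel R X) rF) (hF : forall x y, F x y <-> rF x = rF y).
Hypotheses (cE : forall x, countable [set y | E x y]) (cF : forall x, countable [set y | F x y]).
Hypothesis EF : forall x y, E x y -> F x y.

Let eqE : RelationClasses.Equivalence E.
Proof.
by split=> [x|x y|x y z]; rewrite !hE// => -> ->.
Qed.

Let eqF : RelationClasses.Equivalence F.
Proof.
by split=> [x|x y|x y z]; rewrite !hF// => -> ->.
Qed.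

Let hX : sigma_algebra setT (@borel R X) := borel_sigma tj.

Lemma df_class_card : df (@borel R X) (fun x => ccard [set y | E x y]).
Proof.
have [|Y [bY hV hY]] := fiber_enum ij rj tj bE.
  by move=> x; rewrite (_ : [set y | _] = [set y | E x y])//; apply/seteqP; split=> y /hE.
apply: (@df_ccard _ _ hX _ _ _ (fun x m => exists x', j x' = bcol (Y (rE x)) m /\ rE x' = rE x)
    (fun x m => bcol (Y (rE x)) m)).
- move=> x; rewrite card_eq_sym (_ : _ @` _ = j @` [set y | E x y]).
    by apply: inj_card_eq => a b _ _ /ij.
  apply/seteqP; split=> [_ [m [x' [e rx]] <-]|_ [y /hE Exy <-]].
    by exists x' => //; apply/hE.
  have [m e] := hY y; exists m; last by rewrite Exy e.
  by exists y; rewrite Exy.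
- by move=> m; apply: (bf_preim hX bE (hV m)).
- have bc m : bf (@borel R X) (fun x => bcol (Y (rE x)) m).
    by apply: bf_col; apply: (bf_comp hX bY bE).
  by move=> m m'; apply: bf_eq.
Qed.

Lemma lfs_code : exists2 L, bf BN L &
  forall x (C : quot F), set_val C = [set y | F x y] -> L (rF x) = enc (lfs E F C).
Proof.
have [|Y [bY hV hY]] := fiber_enum ij rj tj bF.
  by move=> x; rewrite (_ : [set y | _] = [set y | F x y])//; apply/seteqP; split=> y /hF.
have [psi bp hp] := code_ext ij rj tj bE.
(* Listed points lying in a subclass of the right size; [v] sends them to their invariant for [E],
   so counting values counts subclasses. *)
pose M n y m := exists x, [/\ j x = bcol (Y y) m, rF x = y & ccard [set z | E x z] = val (pw n)].
pose v y m := psi (bcol (Y y) m).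
exists (fun y n => cw (ccard (v y @` M n y))).
  have bc m : bf BN (fun y => bcol (Y y) m) by apply: bf_col.
  move=> n; apply: (df_comp BNs); apply: (@df_ccard _ _ BNs _ _ _ (M n) v) => [y|m|m m'].
  - exact: card_eqxx.
  - apply: (@sa_ext _ BN (fun y => (exists x, j x = bcol (Y y) m /\ rF x = y) /\
      (exists x, j x = bcol (Y y) m /\ ccard [set z | E x z] = val (pw n)))).
      move=> y; split=> [[[x [e1 e2]] [x' [e3 e4]]]|[x [e1 e2 e3]]]; last by split; exists x.
      by exists x; split=> //; have -> : x = x' by apply: ij; rewrite e1 e3.
    apply: (sa_and BNs) => //.
    exact: (bf_preim BNs (bc m) (img_borel rj tj (df_class_card (val (pw n))))).
  - exact: (bf_eq BNs (bf_comp BNs bp (bc m)) (bf_comp BNs bp (bc m'))).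
move=> x C Cx; apply/funext => n; rewrite /enc (lfsE (pw n) eqE eqF EF Cx); congr cw.
set Yk := [set y | _]; apply: ccard_eq.
rewrite (_ : _ @` M n _ = rE @` Yk).
  apply: ker_card => y z _ _; rewrite -hE; split=> [Eyz|].
    by apply/seteqP; split=> t /=; rewrite !hE; move/hE: Eyz => ->.
  by move/(congr1 (fun A => A z)) => /= ->; apply/hE.
apply/seteqP; split=> [_ [m [y [e1 e2 e3]] <-]|_ [y [/hF Fxy cy] <-]].
  by exists y; [split=> //; apply/hF|rewrite /v -e1 hp].
have [m e] := hY y; exists m; last by rewrite /v Fxy -e hp.
by exists y; rewrite Fxy.
Qed.

Lemma quot_borel_code (B : set (quot F)) (rq : quot F -> baire) :
  (forall x (C : quot F), set_val C = [set y | F x y] -> rq C = rF x) ->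
  quot_borel F B <-> trace rq B.
Proof.
move=> hrq; have repC (C : quot F) : exists x, set_val C = [set y | F x y].
  by have [x _ e] := set_valP C; exists x.
have mkC x : exists C : quot F, set_val C = [set y | F x y].
  by exists (SigSub (mem_set (ex_intro2 _ _ x I erefl : classes F [set y | F x y]))).
have inC (C : quot F) x y : set_val C = [set y | F x y] -> set_val C y -> rq C = rF y.
  by move=> e; rewrite (hrq _ _ e) e => /hF.
split=> [bB|[D [bD BD]]]; last first.
  rewrite /quot_borel /=; apply: sa_ext (bf_preim hX bF bD) => x.
  split=> [Dx|[C BC Cx]].
    have [C eC] := mkC x; exists C; last by rewrite eC /=; apply/hF.
    by apply/BD; rewrite (hrq _ _ eC).
  by move/BD: BC; have [x' e] := repC C; rewrite (inC _ _ _ e Cx).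
have [|Y [bY hV hY]] := fiber_enum ij rj tj bF.
  by move=> x; rewrite (_ : [set y | _] = [set y | F x y])//; apply/seteqP; split=> y /hF.
(* The image under [rF] of a Borel set is Borel here, since the enumeration of classes replaces the
   projection by a countable union. *)
pose A x := (\bigcup_(C in B) set_val C) x.
exists (fun y => exists m, (exists x, j x = bcol (Y y) m /\ rF x = y) /\
    exists x, j x = bcol (Y y) m /\ A x); split.
  apply: (sa_ex BNs) => m; apply: (sa_and BNs) => //.
  exact: (bf_preim BNs (bf_col m bY) (img_borel rj tj bB)).
move=> C; have [x e] := repC C; rewrite (hrq _ _ e); split=> [BC|[m [[x1 [e1 e2]] [x2 [e3 [C' BC' Cx2]]]]]].
  have [m em] := hY x; exists m; split; exists x; split=> //.
  by exists C => //; rewrite e /=; apply/hF.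
have ex : x1 = x2 by apply: ij; rewrite e1 e3.
suff -> : C = C' by [].
have [x' e'] := repC C'; apply: val_inj; rewrite -[LHS]/(set_val C) -[RHS]/(set_val C') e e'.
have h : rF x = rF x' by rewrite -e2 ex; move: Cx2; rewrite e' => /hF.
by apply/seteqP; split=> t /=; rewrite !hF h.
Qed.

Lemma Z_borel : BN (fun y => exists x, rF x = y).
Proof.
have [|Y [bY hV hY]] := fiber_enum ij rj tj bF.
  by move=> x; rewrite (_ : [set y | _] = [set y | F x y])//; apply/seteqP; split=> y /hF.
apply: sa_ext (sa_ex BNs hV) => y; split=> [[m [x []]]|[x <-]]; first by exists x.
by have [m e] := hY x; exists m, x.
Qed.

End lfs_code.

(** * Enlarging a pair by classes of prescribed shape *)

Definition bits (y : baire) : nat -> bool :=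
  fun m => if (unpickle m : option (nat * nat)) is Some (n, k) then y n == k else false.

Lemma bits_inj : injective bits.
Proof.
move=> y y' e; apply/funext => n; have := congr1 (fun f => f (pickle (n, y' n))) e.
by rewrite /bits pickleK eqxx => /eqP.
Qed.

Lemma perfect_set (A : baire -> Prop) : BN A -> ~ enumerable A ->
  exists2 f : baire -> baire, injective f & forall y, A (f y).
Proof.
move=> bA nA; have [|C [c1 c2 c3 c4]] := @an_proj (fun=> A).
  exact: (bf_preim BNs (bf_rgt bf_id) bA).
pose s : baire := fun=> 0.
have [y [sc hy]] : U C s.
  apply/UP => // -[e he]; apply: nA; exists (jn (fun m => lft (bcol e m))) => z Az.
  by have [t /he[m em]] := c3 s z Az; exists m; rewrite col_jn -em lft_pr.
rewrite !(lft_pr, rgt_pr) in sc hy.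
have Cb b := branch_in c1 b sc hy.
exists (fun y' => lft (branch (dec y) (bits y'))) => [y1 y2 e|y']; last exact: c2 (Cb _).
apply: bits_inj; apply: (branch_inj sc); exact: (c4 _ _ _ (Cb _) (Cb _) e).
Qed.

Lemma card_is_countable T (A : set T) : countable A -> card_is A (ccard A).
Proof.
move=> /countable_bijP[B AB]; rewrite (ccard_eq AB).
by apply: card_is_eq (card_is_ccard B); rewrite card_eq_sym.
Qed.

Lemma ccard_neq0 T (A : set T) x : countable A -> A x -> ccard A <> Some 0.
Proof.
move=> cA Ax e; have := card_is_countable cA; rewrite e /= II0 card_eq0 => /eqP A0.
by rewrite A0 in Ax.
Qed.

Lemma coded_equiv (R : realType) (X : standardBorel R) (rho : X -> baire) :
  sigma_algebra setT (@borel R X) -> bf (@borel R X) rho ->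
  (forall x, countable [set y | rho x = rho y]) ->
  countable_borel_equiv (fun x y => rho x = rho y) /\ smooth (fun x y : X => rho x = rho y).
Proof.
move=> hX br cr; split.
  split=> //; first by split=> [x|x y ->|x y z -> ->].
  have hP : sigma_algebra setT (prod_borel (@borel R X) (@borel R X)).
    exact: smallest_sigma_algebra.
  apply: (@sa_ext _ (prod_borel (@borel R X) (@borel R X)) (fun p : X * X => forall n, exists k, rho p.1 n = k /\ rho p.2 n = k)).
    move=> p; split=> [h|-> n]; last by exists (rho p.2 n).
    by apply/funext => n; have [k [-> ->]] := h n.
  apply: (sa_all hP) => n; apply: (sa_ex hP) => k; apply: sub_sigma_algebra.
  exists (fun x => rho x n = k); first exact: br.
  by exists (fun x => rho x n = k); first exact: br.
have sN : standard_borel R (trace (@id baire)).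
  apply: standard_of_inj => //.
  by apply: (@sa_ext _ BN (fun=> True)) (sa_cst BNs True) => y; split=> // _; exists y.
exists (StandardBorel sN), rho; split=> // A [B [bB AB]].
by apply: sa_ext (bf_preim hX br bB) => x; rewrite -AB.
Qed.

(* [vld a (n, i, k)] holds when a class of shape [a] has an [i]-th subclass of size [pw n],
   and the latter has a [k]-th element (recall that [0] codes omega). *)
Definition vld (a : baire) (t : nat * nat * nat) :=
  ((a t.1.1 == 0) || (t.1.2.+1 < a t.1.1)) && ((t.1.1 == 0) || (t.2 < t.1.1)).

Section extension.
Context (R : realType) (X : standardBorel R) (E F : X -> X -> Prop).
Context (j : X -> baire) (rE rF : X -> baire).
Hypotheses (ij : injective j) (rj : BN (fun y => exists x, j x = y)) (tj : @borel R X = trace j).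
Hypotheses (bE : bf (@borel R X) rE) (hE : forall x y, E x y <-> rE x = rE y).
Hypotheses (bF : bf (@borel R X) rF) (hF : forall x y, F x y <-> rF x = rF y).
Hypotheses (cE : forall x, countable [set y | E x y]) (cF : forall x, countable [set y | F x y]).
Hypothesis EF : forall x y, E x y -> F x y.
Context (W : baire -> Prop) (g : baire -> baire).
Hypotheses (bW : BN W) (bg : bf BN g).

Definition new_pt := {p : baire * (nat * nat * nat) | W p.1 /\ vld (g p.1) p.2}.
Definition mk_new w t (Ww : W w) (vt : vld (g w) t) : new_pt :=
  exist (fun p : baire * (nat * nat * nat) => W p.1 /\ vld (g p.1) p.2) (w, t) (conj Ww vt).
Definition ext_pt : Type := (X + new_pt)%type.
Implicit Types u v : ext_pt.

Definition ext_j u : baire := match u with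
  | inl x => cns 0 (j x)
  | inr p => cns 1 (pr (sval p).1 (fun=> pickle (sval p).2)) end.
Definition ext_F u : baire := match u with
  | inl x => cns 0 (rF x) | inr p => cns 1 (sval p).1 end.
Definition ext_E u : baire := match u with
  | inl x => cns 0 (rE x) | inr p => cns 1 (pr (sval p).1 (fun=> pickle (sval p).2.1)) end.

Lemma cns_inj k y k' y' : cns k y = cns k' y' -> k = k' /\ y = y'.
Proof. by move=> e; split; [exact: (congr1 (fun f => f 0) e)|exact: (congr1 tl e)]. Qed.

Lemma pr_inj a b a' b' : pr a b = pr a' b' -> a = a' /\ b = b'.
Proof.
by move=> e; split; [rewrite -(lft_pr a b) e lft_pr|rewrite -(rgt_pr a b) e rgt_pr].
Qed.

Lemma cst_inj (I : countType) (i i' : I) :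
  (fun=> pickle i) = (fun=> pickle i') :> baire -> i = i'.
Proof. by move=> e; apply: (pcan_inj pickleK); exact: (congr1 (fun f => f 0) e). Qed.

Lemma ext_j_inj : injective ext_j.
Proof.
move=> [x|[[w t] hp]] [x'|[[w' t'] hp']] /cns_inj[]//= _; first by move=> /ij ->.
by move=> /pr_inj[e /cst_inj e']; congr inr; apply: sval_inj; rewrite /= e e'.
Qed.

Let bt : bf BN tl := bf_tl bf_id.
Let blt : bf BN (fun y => lft (tl y)) := bf_lft bt.
Let brt : bf BN (fun y => rgt (tl y)) := bf_rgt bt.

Lemma ext_j_range : BN (fun y => exists u, ext_j u = y).
Proof.
apply: (@sa_ext _ BN (fun y => (y 0 = 0 /\ exists x, j x = tl y) \/
    (y 0 = 1 /\ (W (lft (tl y)) /\ exists t, vld (g (lft (tl y))) t /\ rgt (tl y) = (fun=> pickle t))))).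
  move=> y; split=> [[[y0 [x e]]|[y0 [Ww [t [vt e]]]]]|[[x|[[w t] [/= Ww vt]]] <-]].
  - by exists (inl x); rewrite /= e -y0 cns_tl.
  - exists (inr (mk_new Ww vt)); by rewrite /= -e pr_eta -y0 cns_tl.
  - by left; split=> //; exists x.
  - by right; rewrite /= lft_pr rgt_pr; split=> //; split=> //; exists t.
apply: (sa_or BNs); apply: (sa_and BNs).
- exact: bf_id.
- exact: (bf_preim BNs bt rj).
- exact: bf_id.
apply: (sa_and BNs); first exact: (bf_preim BNs blt bW).
apply: (sa_exc BNs) => t; apply: (sa_and BNs); last exact: (bf_eq BNs brt (bf_cst BNs _)).
exact: (df_pred BNs (fun k => ((k == 0) || (t.1.2.+1 < k)) && ((t.1.1 == 0) || (t.2 < t.1.1)))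
  (bf_comp BNs bg blt t.1.1)).
Qed.

Definition ext_space : standardBorel R :=
  StandardBorel (standard_of_inj R ext_j_inj ext_j_range).

Let hX' : sigma_algebra setT (@borel R ext_space) := trace_sigma ext_j.

Lemma ext_bf (psi0 psi1 : baire -> baire) (rho : ext_space -> baire) :
  bf BN psi0 -> bf BN psi1 -> (forall x, rho (inl x) = psi0 (j x)) ->
  (forall p, rho (inr p) = psi1 (tl (ext_j (inr p)))) -> bf (@borel R ext_space) rho.
Proof.
move=> b0 b1 h0 h1.
have -> : rho = fun u => if pselect (ext_j u 0 = 0) then psi0 (tl (ext_j u)) else psi1 (tl (ext_j u)).
  by apply/funext => -[x|p]; rewrite ?h0 ?h1; case: pselect.
have bj : bf (@borel R ext_space) ext_j := trace_bf ext_j.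
apply: (bf_if hX'); first exact: bj.
  exact: (bf_comp hX' b0 (bf_tl bj)).
exact: (bf_comp hX' b1 (bf_tl bj)).
Qed.

Lemma ext_F_bf : bf (@borel R ext_space) ext_F.
Proof.
have [psi bp hp] := code_ext ij rj tj bF.
apply: (@ext_bf (fun y => cns 0 (psi y)) (fun y => cns 1 (lft y))).
- by apply: bf_cns => //; apply: df_cst.
- by apply: bf_cns; [exact: df_cst|exact: (bf_lft bf_id)].
- by move=> x; rewrite hp.
- by move=> p; rewrite /= lft_pr.
Qed.

Lemma ext_E_bf : bf (@borel R ext_space) ext_E.
Proof.
have [psi bp hp] := code_ext ij rj tj bE.
pose h q := if (unpickle q : option (nat * nat * nat)) is Some t then pickle t.1 else 0.
apply: (@ext_bf (fun y => cns 0 (psi y)) (fun y => cns 1 (pr (lft y) (fun=> h (rgt y 0))))).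
- by apply: bf_cns => //; apply: df_cst.
- apply: bf_cns; first exact: df_cst.
  apply: bf_pr; first exact: (bf_lft bf_id).
  by move=> n; apply: (df_comp BNs h); exact: (bf_rgt bf_id 0).
- by move=> x; rewrite hp.
- by move=> p; rewrite /= lft_pr rgt_pr /h pickleK.
Qed.

Definition extE (u v : ext_space) := ext_E u = ext_E v.
Definition extF (u v : ext_space) := ext_F u = ext_F v.

Lemma extEF u v : extE u v -> extF u v.
Proof.
case: u v => [x|[[w t] hp]] [x'|[[w' t'] hp']] /cns_inj[]//= _; rewrite /extF /=.
  by move=> /hE/EF/hF ->.
by move=> /pr_inj[-> _].
Qed.

Lemma ext_class_countable u : countable [set v | extF u v].
Proof.
case: u => [x|[[w t] hp]].
  apply: (@sub_countable _ _ _ [set y | F x y]) => //.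
  apply: (@card_le_rel _ _ _ _ (fun u y => u = inl y)).
    by move=> [y|q] /cns_inj[]//= _ /hF e; exists y.
  by move=> u u' y _ _ -> ->.
apply: (@sub_countable _ _ _ [set: nat * nat * nat]); last exact: countableP.
apply: (@card_le_rel _ _ _ _ (fun u t => exists q, u = inr q /\ (sval q).2 = t)).
  by move=> [y|q] /cns_inj[]//= _ e; exists (sval q).2; split=> //; exists q.
move=> u u' s h h' [q [uq qt]] [q' [uq' qt']]; subst u u'; congr inr; apply: sval_inj.
move/cns_inj: h => [_ /= e]; move/cns_inj: h' => [_ /= e'].
by rewrite (surjective_pairing (sval q)) (surjective_pairing (sval q')) -e -e' qt qt'.
Qed.

Lemma ext_equiv : (countable_borel_equiv extE /\ smooth extE) /\
  (countable_borel_equiv extF /\ smooth extF).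
Proof.
split; apply: coded_equiv => //; [exact: ext_E_bf| |exact: ext_F_bf|exact: ext_class_countable].
move=> u; apply: sub_countable (ext_class_countable u).
by apply: subset_card_le => v; apply: extEF.
Qed.

Lemma ext_lfs_old x (C : quot F) (C' : quot extF) : set_val C = [set y | F x y] ->
  set_val C' = [set u | extF (inl x) u] -> lfs extE extF C' = lfs E F C.
Proof.
have [[[eE' _ _] _] [[eF' _ _] _]] := ext_equiv.
have eE : RelationClasses.Equivalence E by split=> [y|y z|y z t]; rewrite !hE// => -> ->.
have eF : RelationClasses.Equivalence F by split=> [y|y z|y z t]; rewrite !hF// => -> ->.
apply: (lfs_emb (phi := inl : X -> ext_space)) => //.
- exact: extEF.
- by move=> y z [].
- by move=> y z; rewrite hE /extE /=; split=> [->//|/cns_inj[]].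
- by move=> y z; rewrite hF /extF /=; split=> [->//|/cns_inj[]].
- by move=> y [z|q] /cns_inj[]//= _ _; exists z.
Qed.

Lemma ext_lfs_new p (C' : quot extF) : set_val C' = [set u | extF (inr p) u] ->
  enc (lfs extE extF C') = g (sval p).1.
Proof.
move=> hC'; have [[[eE' _ _] _] [[eF' _ _] _]] := ext_equiv.
apply/funext => n; rewrite /enc (lfsE (pw n) eE' eF' extEF hC').
have [/= Ww _] := proj2_sig p; set w := (sval p).1 in Ww *.
(* A class for [extE] is parametrized by the third number, whose range [Q] has the size named by the
   first. *)
have cls (q : new_pt) : ccard [set v | extE (inr q) v] = val (pw (sval q).2.1.1).
  apply: ccardE; pose Q k := (((sval q).2.1.1 == 0) || (k < (sval q).2.1.1)) : Prop.
  apply: (@card_is_eq _ _ Q).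
    apply: Cantor_Bernstein.
      apply: (@card_le_rel _ _ _ _ (fun k v => exists q' : new_pt,
          [/\ v = inr q', (sval q').1 = (sval q).1 & (sval q').2 = ((sval q).2.1, k)])).
        move=> k Qk; have [Ww' v'] := proj2_sig q.
        have h : vld (g (sval q).1) ((sval q).2.1, k).
          by move: v'; rewrite /vld /= => /andP[-> _].
        by exists (inr (mk_new Ww' h)); split=> //; exists (mk_new Ww' h).
      by move=> k k' v _ _ [q1 [-> _ e1]] [q2 [[<-] _]]; rewrite e1 => -[].
    apply: (@card_le_rel _ _ _ _ (fun v k => exists q' : new_pt,
        [/\ v = inr q', (sval q').1 = (sval q).1 & (sval q').2 = ((sval q).2.1, k)])).
      move=> [y|q'] /cns_inj[]//= _ /pr_inj[e1 /cst_inj e2].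
      exists (sval q').2.2; split; last first.
        by exists q'; split=> //; rewrite e2; case: ((sval q').2).
      by have [_ /andP[_]] := proj2_sig q'; rewrite /Q e2.
    move=> v v' k _ _ [q1 [-> a1 b1]] [q2 [-> a2 b2]]; congr inr; apply: sval_inj.
    by rewrite (surjective_pairing (sval q1)) (surjective_pairing (sval q2)) a1 a2 b1 b2.
  rewrite /Q; case: ((sval q).2.1.1) => [|m] /=.
    by rewrite (_ : (fun=> _) = [set: nat]) ?card_eqxx//; apply/seteqP; split.
  exact: card_eqxx.
rewrite (_ : [set u | _ /\ _] = [set u | exists q : new_pt, [/\ u = inr q, (sval q).1 = w &
    (sval q).2.1.1 = n]]); last first.
  apply/seteqP; split=> [[y|q] /= [/cns_inj[]//= _ e]|_ [q [-> e <-]]] /=.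
    rewrite cls => e'; exists q; split=> //.
    by move: e'; case: (sval q).2.1.1 n => [|m] [|m']//= [->].
  by rewrite cls; split=> //; rewrite /extF /= e.
pose ix (u : ext_space) := if u is inr q then (sval q).2.1.2 else 0.
rewrite (ccard_eq (ker_card (g := ix) _)); last first.
  move=> _ _ [q [-> e1 e2]] [q' [-> e1' e2']] /=.
  have -> : [set z | extE (inr q) z] = [set z | extE (inr q') z] <-> extE (inr q) (inr q').
    split=> [/(congr1 (fun A => A (inr q')))/= ->//|h].
    by apply/seteqP; split=> v hv; [exact: etrans (esym h) hv|exact: etrans h hv].
  rewrite /extE /=; split=> [/cns_inj[_ /pr_inj[_ /cst_inj ->]]//|e].
  by rewrite e1 e1' (surjective_pairing (sval q).2.1) (surjective_pairing (sval q').2.1) e2 e2' e.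
rewrite (_ : _ @` _ = [set i | (g w n == 0) || (i.+1 < g w n)]).
  (* The shift in [i.+1] undoes the one in [cw], where the number [m] is coded as [m.+1]. *)
  suff -> : ccard [set i | (g w n == 0) || (i.+1 < g w n)] = dw (g w n) by rewrite dwK.
  apply: ccardE; case: (g w n) => [|m] /=; last exact: card_eqxx.
  by rewrite (_ : [set _ | _] = [set: nat]) ?card_eqxx//; apply/seteqP; split.
apply/seteqP; split=> [_ [_ [q [-> e1 e2]] <-]|i /= hi].
  by have [_ /andP[]] := proj2_sig q; rewrite e1 e2.
have h : vld (g w) (n, i, 0) by rewrite /vld /= hi /=; case: n {hi}.
by exists (inr (mk_new Ww h)) => //; exists (mk_new Ww h).
Qed.

End extension.

Section quotient_classes.
Context (R : realType) (X : standardBorel R) (F : X -> X -> Prop).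

Lemma quot_rep (C : quot F) : exists x, set_val C = [set y | F x y].
Proof. by have [x _ e] := set_valP C; exists x. Qed.

Lemma quot_mk x : exists C : quot F, set_val C = [set y | F x y].
Proof. by exists (SigSub (mem_set (ex_intro2 _ _ x I erefl : classes F [set y | F x y]))). Qed.

Lemma quot_eq (r : X -> baire) (C C' : quot F) x x' : (forall x y, F x y <-> r x = r y) ->
  set_val C = [set y | F x y] -> set_val C' = [set y | F x' y] -> r x = r x' -> C = C'.
Proof.
move=> hF e e' h; apply: val_inj; rewrite -[LHS]/(set_val C) -[RHS]/(set_val C') e e'.
by apply/seteqP; split=> t /=; rewrite !hF h.
Qed.

Lemma quot_eq_rel (r : X -> baire) (C : quot F) x x' : (forall x y, F x y <-> r x = r y) ->
  set_val C = [set y | F x y] -> set_val C = [set y | F x' y] -> r x = r x'.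
Proof.
move=> hF -> /(congr1 (fun A => A x')) /= e; apply/hF; rewrite e; exact/hF.
Qed.

End quotient_classes.

(** * Equality of global shapes, and lifts obtained from isomorphisms *)

Section lift.
Context (R : realType) (X : standardBorel R) (E F : X -> X -> Prop).
Context (j : X -> baire) (rE rF : X -> baire).
Hypotheses (ij : injective j) (rj : BN (fun y => exists x, j x = y)) (tj : @borel R X = trace j).
Hypotheses (bE : bf (@borel R X) rE) (hE : forall x y, E x y <-> rE x = rE y).
Hypotheses (bF : bf (@borel R X) rF) (hF : forall x y, F x y <-> rF x = rF y).
Hypotheses (cE : forall x, countable [set y | E x y]) (cF : forall x, countable [set y | F x y]).
Hypothesis EF : forall x y, E x y -> F x y.
Context (L : baire -> baire).
Hypotheses (bL : bf BN L) (hL : forall x (C : quot F), set_val C = [set y | F x y] ->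
  L (rF x) = enc (lfs E F C)).

Definition Zs s z := (exists x, rF x = z) /\ L z = s.

Lemma Zs_borel : BN (fun p => Zs (lft p) (rgt p)).
Proof.
have br : bf BN rgt := bf_rgt bf_id.
apply: (sa_and BNs); first exact: (bf_preim BNs br (Z_borel ij rj tj bF hF cF)).
exact: (bf_eq BNs (bf_comp BNs bL br) (bf_lft bf_id)).
Qed.

Context (W : baire -> Prop) (g : baire -> baire).
Hypotheses (bW : BN W) (bg : bf BN g).
Hypothesis hW : forall w, W w -> ~ enumerable (Zs (g w)).

Let X' := ext_space ij rj bW bg.
Let E' : X' -> X' -> Prop := @extE R X j rE ij rj W g bW bg.
Let F' : X' -> X' -> Prop := @extF R X j rF ij rj W g bW bg.
Let hF' (u v : X') : F' u v <-> ext_F rF u = ext_F rF v. Proof. by []. Qed.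

(** A shape with enumerable fibre receives no new class. Over any other shape the perfect set
    theorem embeds all of Baire space, hence all codes of classes of the enlarged space, into the
    old fibre. *)
Lemma ext_gfs : gfs_eq E F E' F'.
Proof.
have lo x C C' := @ext_lfs_old _ _ _ _ _ _ _ ij rj tj bE hE bF hF cF EF _ _ bW bg x C C'.
have ln p C' := @ext_lfs_new _ _ _ _ _ _ _ ij rj tj bE hE bF hF cF EF _ _ bW bg p C'.
have inl_inj (x x1 : X) : ext_F (W := W) (g := g) rF (inl x) = ext_F rF (inl x1) -> rF x = rF x1.
  by move=> /cns_inj[].
move=> a _; apply: Cantor_Bernstein.
  apply: (@card_le_rel _ _ _ _ (fun C C' => exists x, set_val C = [set y | F x y] /\
      set_val C' = [set u | F' (inl x) u])).
    move=> C; have [x ex] := quot_rep C; have [C' ex'] := quot_mk F' (inl x).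
    by move=> Ca; exists C'; split; [rewrite /lfs_fiber /= (lo x C C')|exists x].
  move=> C C1 C' _ _ [x [e1 e2]] [x1 [e3 e4]]; apply: quot_eq hF e1 e3 _.
  exact/inl_inj/(quot_eq_rel hF' e2 e4).
have [en|nen] := pselect (enumerable (Zs (enc a))).
  apply: (@card_le_rel _ _ _ _ (fun C' C => exists x, set_val C = [set y | F x y] /\
      set_val C' = [set u | F' (inl x) u])).
    move=> C' Ca; have [[x|p] e'] := quot_rep C'.
      have [C e] := quot_mk F x; exists C; split; last by exists x.
      by rewrite /lfs_fiber /= -(lo x C C').
    exfalso; apply: (hW (proj2_sig p).1); rewrite -(ln p C' e').
    by move: Ca; rewrite /lfs_fiber /= => ->.
  move=> C' C1' C _ _ [x [e1 e2]] [x1 [e3 e4]]; apply: quot_eq hF' e2 e4 _ => /=.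
  by rewrite (quot_eq_rel hF e1 e3).
have bZ : BN (Zs (enc a)).
  have := bf_preim BNs (bf_pr (bf_cst BNs (enc a)) bf_id) Zs_borel.
  by apply: sa_ext => z; rewrite lft_pr rgt_pr.
have [f fi fZ] := perfect_set bZ nen.
apply: (@card_le_rel _ _ _ _ (fun C' C => exists u x, [/\ set_val C' = [set v | F' u v],
    set_val C = [set y | F x y] & rF x = f (ext_F rF u)])).
  move=> C' Ca; have [u e'] := quot_rep C'; have [[x ex] Lx] := fZ (ext_F rF u).
  have [C e] := quot_mk F x; exists C; split; last by exists u, x.
  by apply: enc_inj; rewrite -(hL e) ex.
move=> C' C1' C _ _ [u [x [e1 e2 e3]]] [u1 [x1 [e4 e5 e6]]]; apply: quot_eq hF' e1 e4 _.
by apply: fi; rewrite -e3 -e6; apply: quot_eq_rel hF e2 e5.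
Qed.

Lemma lfs_coord_neq1 x (C : quot F) : set_val C = [set y | F x y] ->
  exists n, enc (lfs E F C) n <> 1.
Proof.
move=> Cx; have eE : RelationClasses.Equivalence E by split=> [y|y z|y z t]; rewrite !hE// => -> ->.
have eF : RelationClasses.Equivalence F by split=> [y|y z|y z t]; rewrite !hF// => -> ->.
have /eqP k0 := @ccard_neq0 _ [set y | E x y] x (cE x) ((hE x x).2 erefl).
have [n en] := pw_surj (exist (fun m : natw => m != Some 0) _ k0).
exists n; rewrite /enc -en (lfsE _ eE eF EF Cx); set A := (X in ccard X).
suff : ccard A <> Some 0 by case: (ccard A) => [[|m]|].
apply: (@ccard_neq0 _ _ [set y | E x y]); last by exists x => //; split=> //; apply/hF.
apply: (sub_countable (card_image_le _ _)); apply: sub_countable (cF x).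
by apply: subset_card_le => y [].
Qed.

(** The isomorphism pulls the new class of [w] back to a class in [X] of the same shape [g w], and
    pulls different new classes back to different ones. *)
Lemma lift_exists : borel_isomorphic E F E' F' -> exists H,
  [/\ bf BN H, forall w, W w -> Zs (g w) (H w) &
      forall w w', W w -> W w' -> H w = H w' -> w = w'].
Proof.
move=> [f [[fi fK Kf] bff pE pF]].
have hX := borel_sigma tj.
(* A Borel choice of a point in each new class: the first index whose count is not zero, then
   subclass [0] and element [0]. *)
pose n w := least (fun n => g w n <> 1).
have hn w : W w -> g w (n w) <> 1.
  move=> Ww; apply: (leastP (A := fun n => g w n <> 1) _).1.
  have [z [[x xz] Lz]] : exists z, Zs (g w) z.
    by apply: contrapT => no; apply: (hW Ww); exists w => z' hz; exfalso; apply: no; exists z'.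
  have [C Cx] := quot_mk F x; have [m hm] := lfs_coord_neq1 Cx.
  by exists m; rewrite -Lz -xz (hL Cx).
have dn : df BN n.
  by apply: (df_least BNs) => k; apply: (sa_not BNs); apply: bg.
have vn w : W w -> vld (g w) (n w, 0, 0).
  move=> /hn; rewrite /vld /=; case: (g w (n w)) => [|[|k]] //= _; by case: (n w).
pose c w := cns 1 (pr w (fun=> pickle (n w, 0, 0))).
have bc : bf BN c.
  apply: bf_cns; first exact: df_cst.
  by apply: bf_pr => // k; apply: (df_comp BNs (fun i => pickle (i, 0, 0)) dn).
have [psi bp hp] : exists2 psi, bf BN psi & forall x, psi (j x) = ext_j j (f x).
  apply: (code_ext ij rj tj) => k i.
  exact: (bff (fun u => ext_j j u k = i) (trace_bf (ext_j j (W := W) (g := g)) k i)).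
have [psiF bpF hpF] := code_ext ij rj tj bF.
(* Only [f] is assumed to be Borel; its inverse at the chosen points comes from uniformizing the
   graph. *)
pose K w q := (exists x, j x = q) /\ psi q = c w.
have [| |h bh hh] := @borel_unif K.
- apply: (sa_and BNs); first exact: (bf_preim BNs (bf_rgt bf_id) rj).
  exact: (bf_eq BNs (bf_comp BNs bp (bf_rgt bf_id)) (bf_comp BNs bc (bf_lft bf_id))).
- move=> w q q' [[x <-] e] [[x' <-] e']; congr j; apply: (can_inj fK).
  by apply: (ext_j_inj ij); rewrite -!hp e e'.
pose pt w (Ww : W w) : X' := inr (mk_new Ww (vn w Ww)).
have hx w (Ww : W w) : exists x, f x = pt w Ww /\ h w = j x.
  exists (fi (pt w Ww)); rewrite Kf; split=> //; apply: hh; split; first by eexists.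
  by rewrite hp Kf.
exists (fun w => psiF (h w)); split; first exact: (bf_comp BNs bpF bh).
  move=> w Ww; have [x [fx ->]] := hx w Ww; rewrite hpF; split; first by exists x.
  have [C Cx] := quot_mk F x; have [C' Cx'] := quot_mk F' (f x).
  have [[[eE' _ _] _] [[eF' _ _] _]] := ext_equiv ij rj tj bE hE bF hF cF EF bW bg.
  have eE : RelationClasses.Equivalence E by split=> [y|y z|y z t]; rewrite !hE// => -> ->.
  have eF : RelationClasses.Equivalence F by split=> [y|y z|y z t]; rewrite !hF// => -> ->.
  rewrite (hL Cx) -(lfs_emb (phi := f) eE eF eE' eF' EF _ _ pE pF _ Cx Cx'); first last.
  - by move=> y u _; exists (fi u).
  - exact: can_inj fK.
  - exact: (extEF hE hF EF).
  rewrite fx in Cx'.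
  exact: (ext_lfs_new tj bE hE bF hF cF EF Cx').
move=> w w' Ww Ww'; have [x [fx ->]] := hx w Ww; have [x' [fx' ->]] := hx w' Ww'.
by rewrite !hpF => /hF/pF; rewrite fx fx' => /cns_inj[_ /=].
Qed.

End lift.

(** * From lifts to a Borel parametrization *)

Lemma lift_borel (Z : baire -> baire -> Prop) : BN (fun p => Z (lft p) (rgt p)) ->
  (forall W g, BN W -> bf BN g -> (forall w, W w -> ~ enumerable (Z (g w))) ->
    exists H, [/\ bf BN H, forall w, W w -> Z (g w) (H w) &
      forall w w', W w -> W w' -> H w = H w' -> w = w']) ->
  BN (fun s => enumerable (Z s)).
Proof.
move=> bZ lift; have [C [c1 c2 c3 c4]] := an_proj bZ.
have UZ s : U C s <-> ~ enumerable (Z s).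
  rewrite UP//; split=> h [e he]; apply: h.
    pose t m : baire := xget (fun=> 0) [set q | C (pr s q) /\ lft q = bcol e m].
    exists (jn t) => q Cq; have [m em] := he _ (c2 _ _ Cq); exists m; rewrite col_jn.
    have [Ct et] : [set q | C (pr s q) /\ lft q = bcol e m] (t m) by apply: xgetPex; exists q.
    by apply: (c4 s) => //; rewrite et.
  exists (jn (fun m => lft (bcol e m))) => z Zz.
  by have [t /he[m em]] := c3 s z Zz; exists m; rewrite col_jn -em lft_pr.
suff : BN (fun s => ~ U C s).
  by apply: (@sa_ext _ BN) => s; rewrite UZ; split=> [/contrapT|e /(_ e)].
apply: universal_lift_borel => // W g bW bg hW.
have [w /hW/UZ//|H [bH hH iH]] := lift W g bW bg.
(* Unique witnesses turn a lift into [Z] into a lift into the closed set [C]. *)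
have [| |H' bH' hH'] := @borel_unif (fun w q => C (pr (g w) q) /\ lft q = H w).
- apply: (sa_and BNs).
    apply: (bf_preim BNs (phi := fun p => pr (g (lft p)) (rgt p))); last exact: clos_borel.
    exact: (bf_pr (bf_comp BNs bg (bf_lft bf_id)) (bf_rgt bf_id)).
  exact: (bf_eq BNs (bf_lft (bf_rgt bf_id)) (bf_comp BNs bH (bf_lft bf_id))).
- by move=> w q q' [Cq e] [Cq' e']; apply: (c4 (g w)) => //; rewrite e e'.
have hw w : W w -> C (pr (g w) (H' w)) /\ lft (H' w) = H w.
  by move=> /hH /c3[t Ct]; rewrite (hH' w (pr (H w) t)) ?lft_pr.
exists H'; split=> // [w /hw[]//|w w' Ww Ww' e]; apply: iH => //.
by rewrite -(hw w Ww).2 -(hw w' Ww').2 e.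
Qed.

(** The alternative [th z = f z] or [g (th z) = z] is recorded because any invariant respected by
    both [f] and [g] is then respected by [th]. *)
Lemma borel_csb (A B : baire -> Prop) (f g : baire -> baire) : BN A -> BN B ->
  bf BN f -> bf BN g -> (forall z, A z -> B (f z)) -> (forall w, B w -> A (g w)) ->
  (forall z z', A z -> A z' -> f z = f z' -> z = z') ->
  (forall w w', B w -> B w' -> g w = g w' -> w = w') ->
  exists th, [/\ bf BN th, forall z, A z -> B (th z) /\ (th z = f z \/ g (th z) = z),
    forall z z', A z -> A z' -> th z = th z' -> z = z' &
    forall w, B w -> exists2 z, A z & th z = w].
Proof.
move=> bA bB bff bg fAB gBA fi gi.
have br : bf BN rgt := bf_rgt bf_id; have bl : bf BN lft := bf_lft bf_id.
(* The points whose backward orbit stops in [A], by number of steps; they are Borel because [f] and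
   [g] are injective. *)
pose C := fix C n : baire -> Prop := match n with
  | 0 => fun z => A z /\ ~ exists w, B w /\ g w = z
  | m.+1 => fun z => exists w, C m w /\ g (f w) = z end.
have CA n z : C n z -> A z.
  by case: n z => [z []//|n z [w [+ <-]]]; elim: n w => [w [? _]|n IH w [w' [/IH ? <-]]]; auto.
have bgB : BN (fun p => B (rgt p) /\ g (rgt p) = lft p).
  by apply: (sa_and BNs); [exact: (bf_preim BNs br)|exact: (bf_eq BNs (bf_comp BNs bg br) bl)].
have ug y q q' : B q /\ g q = y -> B q' /\ g q' = y -> q = q'.
  by move=> [? <-] [? e]; apply: gi.
have bC n : BN (C n).
  elim: n => [|n IH] /=.
    by apply: (sa_and BNs) => //; apply: (sa_not BNs); apply: (borel_dom bgB).
  apply: borel_dom => [|y q q' [/CA Aq <-] [/CA Aq' e]].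
    apply: (sa_and BNs); first exact: (bf_preim BNs br).
    exact: (bf_eq BNs (bf_comp BNs bg (bf_comp BNs bff br)) bl).
  by apply: fi => //; apply: gi; auto.
have [h bh hh] := borel_unif bgB ug.
have hg w : B w -> h (g w) = w by move=> Bw; apply: hh.
have gh z : A z -> ~ (exists n, C n z) -> B (h z) /\ g (h z) = z.
  move=> Az nC; have [w [Bw <-]] : exists w, B w /\ g w = z.
    by apply: contrapT => no; apply: nC; exists 0.
  by rewrite hg.
pose th z := if pselect (exists n, C n z) then f z else h z.
have thC n z : C n z -> th z = f z.
  by move=> Cz; rewrite /th; case: pselect => // no; case: no; exists n.
have thN z : ~ (exists n, C n z) -> th z = h z by rewrite /th; case: pselect.
exists th; split.
- by apply: (bf_if BNs) => //; apply: (sa_ex BNs).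
- move=> z Az; have [[n Cz]|nC] := pselect (exists n, C n z).
    by rewrite (thC n)//; split; [exact: fAB|left].
  by rewrite thN//; have [? ?] := gh z Az nC; split=> //; right.
- suff cross n z z' : A z -> A z' -> C n z -> ~ (exists n, C n z') -> th z <> th z'.
    move=> z z' Az Az' e.
    have [[n Cz]|nC] := pselect (exists n, C n z); have [[n' Cz']|nC'] := pselect (exists n, C n z').
    + by apply: fi => //; rewrite -(thC _ _ Cz) -(thC _ _ Cz').
    + by case: (cross n z z').
    + by case: (cross n' z' z).
    + by rewrite -(gh z Az nC).2 -(gh z' Az' nC').2 -!thN ?e.
  move=> Az Az' Cz nC; rewrite (thC _ _ Cz) thN// => e; have [_ ge] := gh z' Az' nC.
  by apply: nC; exists n.+1; exists z; rewrite e.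
move=> w Bw; have [[[|n] /= Cg]|nC] := pselect (exists n, C n (g w)).
- by case: Cg => _ []; exists w.
- have [v [Cv e]] := Cg; exists v; first exact: CA Cv.
  by rewrite (thC _ _ Cv); apply: gi => //; apply: fAB; apply: CA Cv.
- by exists (g w); [exact: gBA|rewrite thN// hg].
Qed.

Definition below (k : natw) i : bool := if k is Some n then i < n else true.

Section uniform_fibres.
Context (D : baire -> Prop) (L : baire -> baire).
Hypotheses (bD : BN D) (bL : bf BN L).
Let Z s z := D z /\ L z = s.
Hypothesis bV : BN (fun s => enumerable (Z s)).

Let bZ : BN (fun p => Z (lft p) (rgt p)).
Proof.
have br : bf BN rgt := bf_rgt bf_id.
apply: (sa_and BNs); first exact: (bf_preim BNs br bD).
exact: (bf_eq BNs (bf_comp BNs bL br) (bf_lft bf_id)).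
Qed.

(** Borelness of the set of enumerable fibres allows restricting to them, so that Lusin-Novikov
    enumerates all at once. A point is numbered by the rank of its first index. *)
Lemma uniform_countable : (forall k, BN (fun s => enumerable (Z s) /\ ccard (Z s) = k)) /\
  exists io, [/\ df BN io,
    forall s z, enumerable (Z s) -> Z s z -> below (ccard (Z s)) (io z),
    forall s z z', enumerable (Z s) -> Z s z -> Z s z' -> io z = io z' -> z = z' &
    forall s i, enumerable (Z s) -> below (ccard (Z s)) i -> exists2 z, Z s z & io z = i].
Proof.
pose K s z := enumerable (Z s) /\ Z s z.
have bK : BN (fun p => K (lft p) (rgt p)).
  by apply: (sa_and BNs) => //; exact: (bf_preim BNs (bf_lft bf_id) bV).
have [s|Y bY hY] := enum_borel bK.
  have [e|ne] := pselect (enumerable (Z s)); first by apply: enumerable_sub e => z [].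
  by exists s => z [].
pose M s m := K s (bcol (Y s) m).
have bM m : BN (M^~ m).
  apply: (@sa_ext _ BN (fun s => K (lft (pr s (bcol (Y s) m))) (rgt (pr s (bcol (Y s) m))))).
    by move=> s; rewrite lft_pr rgt_pr.
  exact: (bf_preim BNs (bf_pr bf_id (bf_col m bY)) bK).
pose fs s := firsts (M s) (bcol (Y s)).
have bfs m : BN (fs^~ m).
  apply: (sa_and BNs) => //; apply: (sa_all BNs) => m'.
  apply: (sa_imp BNs); first exact: sa_cst.
  apply: (sa_imp BNs) => //; apply: (sa_not BNs).
  exact: (bf_eq BNs (bf_col m' bY) (bf_col m bY)).
have cfs s : enumerable (Z s) -> ccard (Z s) = ccard (fs s).
  move=> es; rewrite -(ccard_eq (firsts_card _ _)); congr ccard.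
  apply/seteqP; split=> [z Zz|_ [m [_ ?] <-]//].
  by have [m em] := hY s z (conj es Zz); exists m => //; rewrite /M -em.
split=> [k|].
  apply: (@sa_ext _ BN (fun s => enumerable (Z s) /\ ccard (fs s) = k)).
    by move=> s; split=> -[e]; rewrite cfs.
  by apply: (sa_and BNs) => //; apply: (df_ccard_nat BNs).
pose ix z := least (fun m => z = bcol (Y (L z)) m).
have hix s z : enumerable (Z s) -> Z s z -> fs s (ix z) /\ z = bcol (Y s) (ix z).
  move=> es Zz; have Kz : K s z by [].
  have [|h1 h2] := @leastP (fun m => z = bcol (Y (L z)) m).
    by rewrite Zz.2; apply: hY.
  rewrite -/(ix z) Zz.2 in h1 h2; split=> //; split; first by rewrite /M -h1.
  by move=> m /h2 n1 _ e; apply: n1; rewrite e.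
exists (fun z => cnt (fs (L z)) (ix z)); split.
- apply: (df_eval BNs (phi := fun z => cnt (fs (L z)))) => [n|].
    by apply: (df_cnt BNs) => m; apply: (bf_preim BNs bL (bfs m)).
  apply: (df_least BNs) => m.
  exact: (bf_eq BNs bf_id (bf_col m (bf_comp BNs bY bL))).
- move=> s z es Zz; rewrite cfs// Zz.2; exact: (cnt_image (hix s z es Zz).1).
- move=> s z z' es Zz Zz'; have [f1 e1] := hix s z es Zz; have [f2 e2] := hix s z' es Zz'.
  by rewrite Zz.2 Zz'.2 => /(cnt_inj f1 f2) e; rewrite e1 e2 e.
- move=> s i es; rewrite cfs// => /cnt_onto[m [fm <-]].
  have [[_ Zm] hm] := fm; exists (bcol (Y s) m) => //; rewrite Zm.2; congr cnt.
  apply: least_unique; rewrite Zm.2// => m' lt e; apply: (hm m') => //.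
  by rewrite /M -e.
Qed.

Hypothesis lift : forall W g, BN W -> bf BN g -> (forall w, W w -> ~ enumerable (Z (g w))) ->
  exists H, [/\ bf BN H, forall w, W w -> Z (g w) (H w) &
    forall w w', W w -> W w' -> H w = H w' -> w = w'].

(** The lift of [lft] embeds pairs of a shape and a binary sequence into the fibres; [bits] gives an
    embedding the other way. Both respect the shape, hence so does the bijection from
    [borel_csb]. *)
Lemma uniform_uncountable : exists th, [/\ bf BN th,
  forall s z, ~ enumerable (Z s) -> Z s z -> forall n, th z n <= 1,
  forall s z z', ~ enumerable (Z s) -> Z s z -> Z s z' -> th z = th z' -> z = z' &
  forall s r, ~ enumerable (Z s) -> (forall n, r n <= 1) -> exists2 z, Z s z & th z = r].
Proof.
have br : bf BN rgt := bf_rgt bf_id; have bl : bf BN lft := bf_lft bf_id.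
pose B w := ~ enumerable (Z (lft w)) /\ forall n, rgt w n <= 1.
have bB : BN B.
  apply: (sa_and BNs); first by apply: (sa_not BNs); exact: (bf_preim BNs bl bV).
  by apply: (sa_all BNs) => n; apply: (df_pred BNs (fun k => k <= 1)); apply: br.
have [w []//|H [bH hH iH]] := lift bB bl.
pose A z := D z /\ ~ enumerable (Z (L z)).
have bA : BN A.
  by apply: (sa_and BNs) => //; apply: (sa_not BNs); exact: (bf_preim BNs bL bV).
pose b z : baire := fun n => bits z n.
have bb : bf BN b.
  move=> n; rewrite /b /bits; case: (unpickle n : option (nat * nat)) => [[i k]|]; last exact: df_cst.
  exact: (df_comp BNs (fun m => nat_of_bool (m == k)) (bf_id i)).
have [| | | |th [bth hth ith sth]] := borel_csb bA bB (bf_pr bL bb) bH.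
- by move=> z [Dz nz]; rewrite /B lft_pr rgt_pr; split=> // n; rewrite /b; case: bits.
- by move=> w Bw; have [Dz e] := hH w Bw; split=> //; rewrite e; case: Bw.
- move=> z z' _ _ /pr_inj[_ e]; apply: bits_inj; apply/funext => n.
  by have := congr1 (fun f => f n) e; rewrite /b; do 2 case: bits.
- exact: iH.
have lth z : A z -> lft (th z) = L z.
  move=> Az; have [Bt [->|e]] := hth z Az; first by rewrite lft_pr.
  by rewrite -{2}e (hH _ Bt).2.
have AZ s z : ~ enumerable (Z s) -> Z s z -> A z by move=> ns [Dz e]; split; rewrite ?e.
exists (fun z => rgt (th z)); split; first exact: (bf_rgt bth).
- by move=> s z ns Zz; case: (hth z (AZ s z ns Zz)) => -[].
- move=> s z z' ns Zz Zz' e; apply: ith; [exact: AZ ns Zz|exact: AZ ns Zz'|].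
  by rewrite -(pr_eta (th z)) -(pr_eta (th z')) e (lth _ (AZ _ _ ns Zz)) (lth _ (AZ _ _ ns Zz')) Zz.2 Zz'.2.
move=> s r ns hr; have [|z Az e] := sth (pr s r); first by rewrite /B lft_pr rgt_pr.
exists z; rewrite ?e ?rgt_pr//; split; first by case: Az.
by rewrite -lth// e lft_pr.
Qed.

End uniform_fibres.

Section parametrization.
Context (R : realType) (T : Type) (rq : T -> baire) (D : baire -> Prop) (L : baire -> baire).
Hypotheses (rq_inj : injective rq) (rqD : forall y, D y <-> exists t, rq t = y).
Hypotheses (bD : BN D) (bL : bf BN L).
Let Z s z := D z /\ L z = s.
Hypothesis lift : forall W g, BN W -> bf BN g -> (forall w, W w -> ~ enumerable (Z (g w))) ->
  exists H, [/\ bf BN H, forall w, W w -> Z (g w) (H w) &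
    forall w w', W w -> W w' -> H w = H w' -> w = w'].

Let P (m : cplus) (s : baire) : Prop := match m with
  | countable_card k => enumerable (Z s) /\ ccard (Z s) = val k
  | continuum => ~ enumerable (Z s) end.

Definition fibre_index (m : cplus) (r : baire) : Prop := match m with
  | countable_card k => exists2 i, below (val k) i & r = fun=> i
  | continuum => forall n, r n <= 1 end.

Lemma fibre_index_borel m : BN (fibre_index m).
Proof.
case: m => [k|] /=; last first.
  by apply: (sa_all BNs) => n; apply: (df_pred BNs (fun k => k <= 1)); apply: bf_id.
apply: (@sa_ext _ BN (fun r => exists i, below (val k) i /\ r = fun=> i)).
  by move=> r; split=> -[i]; [case; exists i|exists i].
apply: (sa_ex BNs) => i; apply: (sa_and BNs); first exact: sa_cst.
exact: (bf_eq BNs bf_id (bf_cst BNs _)).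
Qed.

Lemma fibre_index_card m : type_card_is {r | fibre_index m r} m.
Proof.
case: m => [k|] /=.
  have cb k' : card_is [set i | below k' i] k'.
    case: k' => [n|] /=; first exact: card_eqxx.
    by rewrite (_ : [set _ | _] = [set: nat]) ?card_eqxx//; apply/seteqP; split.
  apply: card_is_eq (cb (val k)).
  apply: Cantor_Bernstein.
    apply: (@card_le_rel _ _ _ _ (fun i r => sval r = fun=> i)).
      move=> i /= hi; have hr : fibre_index (countable_card k) (fun=> i) by exists i.
      by exists (exist _ _ hr).
    by move=> i i' r _ _ -> e; exact: (congr1 (fun f => f 0) e).
  apply: (@card_le_rel _ _ _ _ (fun r i => sval r = fun=> i)).
    by move=> r _; have [i hi e] := proj2_sig r; exists i.
  by move=> r r' i _ _ e e'; apply: sval_inj; rewrite e e'.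
apply: Cantor_Bernstein.
  apply: (@card_le_rel _ _ _ _ (fun r A => forall n, A n <-> sval r n = 1)).
    by move=> r _; exists [set n | sval r n = 1].
  move=> r r' A _ _ h h'; apply: sval_inj; apply/funext => n.
  have := proj2_sig r n; have := proj2_sig r' n; have := h n; rewrite h'.
  by case: (sval r n) (sval r' n) => [|[|a]] [|[|b]] //= [h1 h2]; [case: (h1 erefl)|case: (h2 erefl)].
apply: (@card_le_rel _ _ _ _ (fun A r => forall n, A n <-> sval r n = 1)).
  move=> A _; have hr : fibre_index continuum (fun n => `[< A n >]) by move=> n; case: asboolP.
  by exists (exist _ _ hr); split=> // n /=; case: asboolP; split.
by move=> A A' r _ _ h h'; apply/seteqP; split=> n /=; rewrite h h'.
Qed.

Lemma subset_standard (B : baire -> Prop) : BN B -> standard_borel R (trace (sval : {y | B y} -> baire)).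
Proof.
move=> bB; apply: standard_of_inj; first exact: sval_inj.
by apply: (@sa_ext _ BN B) bB => y; split=> [By|[[y' h] <-]//]; exists (exist _ y By).
Qed.

Lemma lifts_parametrize (Dr : T -> T -> Prop) :
  (forall t t', Dr t t' <-> L (rq t) = L (rq t')) -> borel_parametrizable R (trace rq) Dr.
Proof.
move=> hDr; have bZ : BN (fun p => Z (lft p) (rgt p)).
  have br : bf BN rgt := bf_rgt bf_id.
  apply: (sa_and BNs); first exact: (bf_preim BNs br bD).
  exact: (bf_eq BNs (bf_comp BNs bL br) (bf_lft bf_id)).
have bV := lift_borel bZ lift.
have [bk [io [bio io1 io2 io3]]] := uniform_countable bD bL bV.
have [ta [bta ta1 ta2 ta3]] := uniform_uncountable bD bL bV lift.
have bP m : BN (P m) by case: m => [k|]; [exact: bk|exact: (sa_not BNs)].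
have PU m m' s : P m s -> P m' s -> m = m'.
  case: m m' => [k|] [k'|] //=; [|by case|by move=> ne []].
  by move=> [_ ->] [_ e]; congr countable_card; apply: val_inj.
pose th z : baire := if pselect (enumerable (Z (L z))) then (fun=> io z) else ta z.
have bth : bf BN th.
  by apply: (bf_if BNs) => //; exact: (bf_preim BNs bL bV).
have thV s z : enumerable (Z s) -> Z s z -> th z = fun=> io z.
  by move=> es [Dz e]; rewrite /th; case: pselect => //; rewrite e.
have thU s z : ~ enumerable (Z s) -> Z s z -> th z = ta z.
  by move=> es [Dz e]; rewrite /th; case: pselect => //; rewrite e.
have th1 m s z : P m s -> Z s z -> fibre_index m (th z).
  case: m => [k|] /= => [[es ek]|ns] Zz; last by rewrite (thU s)//; apply: ta1 Zz.
  by exists (io z); rewrite ?(thV s)// -ek; apply: io1 Zz.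
have th2 s z z' : Z s z -> Z s z' -> th z = th z' -> z = z'.
  move=> Zz Zz'; have [es|ns] := pselect (enumerable (Z s)).
    rewrite !(thV s)// => e; apply: (io2 s) => //; exact: (congr1 (fun f => f 0) e).
  by rewrite !(thU s)//; apply: (ta2 s).
have th3 m s r : P m s -> fibre_index m r -> exists2 z, Z s z & th z = r.
  case: m => [k|] /= => [[es ek] [i + ->]|ns hr].
    by rewrite -ek => /(io3 s i es)[z Zz <-]; exists z => //; apply: (thV s).
  by have [z Zz <-] := ta3 s r ns hr; exists z => //; apply: (thU s).
have Pex z : D z -> exists m, P m (L z).
  move=> Dz; have [es|ns] := pselect (enumerable (Z (L z))); last by exists continuum.
  (* The fibre contains [z], whose number [io z] cannot be below zero. *)
  have k0 : ccard (Z (L z)) != Some 0.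
    have := io1 (L z) z es (conj Dz erefl); case: (ccard _) => // n.
    by rewrite /below; case: n.
  by exists (countable_card (exist (fun m : natw => m != Some 0) _ k0)).
pose ZZ m := StandardBorel (subset_standard (bP m)).
pose YY m := StandardBorel (subset_standard (fibre_index_borel m)).
(* An element of the disjoint union is determined by its two underlying points, the sets [P m] being
   disjoint; this avoids comparing components of dependent types. *)
pose cL (p : {m & (ZZ m * YY m)%type}) : baire := sval (projT2 p).1.
pose cT (p : {m & (ZZ m * YY m)%type}) : baire := sval (projT2 p).2.
have c_inj p p' : cL p = cL p' -> cT p = cT p' -> p = p'.
  case: p p' => m [[s hs] [r hr]] [m' [[s' hs'] [r' hr']]]; rewrite /cL /cT /= => es er.
  have em : m = m' by apply: (PU _ _ s); rewrite // es.
  by subst m' s' r'; rewrite (Prop_irrelevance hs hs') (Prop_irrelevance hr hr').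
have Drq t : D (rq t) by apply/rqD; exists t.
have /choice[phi hphi] : forall t, exists p, cL p = L (rq t) /\ cT p = th (rq t).
  move=> t; have [m hm] := Pex _ (Drq t).
  by exists (existT _ m (exist _ _ hm, exist _ _ (th1 m _ _ hm (conj (Drq t) erefl)))).
have hT t m : (exists p, phi t = existT _ m p) <-> P m (L (rq t)).
  rewrite -(hphi t).1; split=> [[p ->]|]; first exact: (proj2_sig p.1).
  case: (phi t) => m' p hm; have em : m = m' by apply: (PU _ _ _ hm); exact: (proj2_sig p.1).
  by subst m'; exists p.
exists ZZ, YY, phi; split.
- exact: fibre_index_card.
- have iphi : injective phi.
    move=> t t' e; have [a b] := hphi t; have [a' b'] := hphi t'; rewrite e in a b.
    apply: rq_inj; apply: (th2 (L (rq t))); last by rewrite -b -b'.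
      by split.
    by split=> //; rewrite -a -a'.
  have /choice[psi hpsi] : forall p, exists t, phi t = p.
    move=> p; have [z [/rqD[t <-] e] e'] := th3 _ _ _ (proj2_sig (projT2 p).1) (proj2_sig (projT2 p).2).
    by exists t; apply: c_inj; rewrite ?(hphi t).1 ?(hphi t).2.
  by exists psi => // t; apply: iphi; rewrite hpsi.
- move=> B hB; have hS : sigma_algebra setT (trace rq) := trace_sigma rq.
  have brq : bf (trace rq) rq := trace_bf rq.
  have bLq := bf_comp hS bL brq; have btq := bf_comp hS bth brq.
  have bm m (A : set (ZZ m * YY m)) : prod_borel borel borel A ->
      trace rq (fun t => exists p, phi t = existT _ m p /\ A p).
    have uq t p p' : phi t = existT _ m p -> phi t = existT _ m p' -> p = p'.
      move=> -> e; have := congr1 cL e; have := congr1 cT e; rewrite /cL /cT /=.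
      by case: p p' {e} => [a b] [a' b'] /= /sval_inj -> /sval_inj ->.
    apply: (@smallest_sub _ _ _ [set A | trace rq (fun t => exists p, phi t = existT _ m p /\ A p)]).
      split=> [|A' hA'|A' hA'] /=.
      + by apply: sa_ext (sa_false hS) => t; split=> // -[p []].
      + apply: sa_ext (sa_and hS (bf_preim hS bLq (bP m)) (sa_not hS hA')) => t.
        rewrite -hT; split=> [[[p e] no]|[p [e [_ nA]]]].
          by exists p; split=> //; split=> // Ap; apply: no; exists p.
        by split=> [|[p' [/(uq _ _ _ e) <- //]]]; exists p.
      + apply: sa_ext (sa_ex hS hA') => t; split=> [[n [p [e Ap]]]|[p [e [n _ Ap]]]].
          by exists p; split=> //; exists n.
        by exists n, p.
    move=> _ [A1 [B1 [bB1 h1]] [A2 [B2 [bB2 h2]] <-]] /=.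
    apply: sa_ext (sa_and hS (bf_preim hS bLq (bP m))
      (sa_and hS (bf_preim hS bLq bB1) (bf_preim hS btq bB2))) => t.
    have [<- <-] := hphi t; rewrite [cL _](hphi t).1 -hT.
    split=> [[[p e] []]|[p [e [/h1 a1 /h2 a2]]]].
      by rewrite -(hphi t).1 e => a1 a2; exists p; split=> //; split; [apply/h1|apply/h2].
    by rewrite -(hphi t).1 e; split; first by exists p.
  (* The summands are indexed by [option nat] to obtain a countable union, [None] standing for the
     continuum. *)
  apply: (@sa_ext _ (trace rq) (fun t => exists o : option nat,
      let m := if o is Some n then countable_card (pw n) else continuum in
      exists p, phi t = existT _ m p /\ B (existT _ m p))).
    move=> t; split=> [[o [p [e Bp]]]|]; rewrite /preimage /=; first by rewrite e.
    case e : (phi t) => [[k|] p] Bp; last by exists None, p.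
    by have [n en] := pw_surj k; subst k; exists (Some n), p.
  by apply: (sa_exc hS) => o; apply: bm; apply: hB.
move=> t t'; rewrite hDr -(hphi t).1 -(hphi t').1; split=> [|e].
  case: (phi t) (phi t') => m [[s hs] y] [m' [[s' hs'] y']]; rewrite /cL /tag_pi1 /= => e.
  have em : m = m' by apply: (PU _ _ s); rewrite // e.
  by subst m' s'; rewrite (Prop_irrelevance hs hs').
exact: (congr1 (fun q : {m & ZZ m} => sval (projT2 q)) e).
Qed.

End parametrization.

Theorem theorem6p9 (R : realType) (X : standardBorel R) (E F : X -> X -> Prop)
    (hE : countable_borel_equiv E) (sE : smooth E)
    (hF : countable_borel_equiv F) (sF : smooth F)
    (EF : forall x y, E x y -> F x y)
    (hD : ~ borel_parametrizable R (quot_borel F) (lfs_rel E F)) :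
  exists (X' : standardBorel R) (E' F' : X' -> X' -> Prop),
    [/\ countable_borel_equiv E' /\ smooth E',
        countable_borel_equiv F' /\ smooth F',
        (forall x y, E' x y -> F' x y),
        gfs_eq E F E' F' &
        ~ borel_isomorphic E F E' F'].
Proof.
have [j [ij rj tj]] := sb_code X.
have [rE bE eE] := smooth_code sE; have [rF bF eF] := smooth_code sF.
have [_ _ cE] := hE; have [_ _ cF] := hF.
have [L bL hL] := lfs_code ij rj tj bE eE bF eF cE cF EF.
(* Under [no], every enlargement with the same global shape is isomorphic to the given pair, which
   yields the lifts required by [lifts_parametrize]. *)
apply: contrapT => no; apply: hD.
have /choice[rq hrq] : forall C : quot F, exists y, exists2 x, set_val C = [set y | F x y] & rF x = y.
  by move=> C; have [x Cx] := quot_rep C; exists (rF x), x.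
have rqE x (C : quot F) : set_val C = [set y | F x y] -> rq C = rF x.
  by move=> Cx; have [x' Cx' <-] := hrq C; apply: quot_eq_rel eF Cx' Cx.
have -> : quot_borel F = trace rq.
  by apply/seteqP; split=> B /(quot_borel_code ij rj tj bF eF cF B rqE).
apply: (@lifts_parametrize R _ rq (fun y => exists x, rF x = y) L) => //.
- move=> C C' e; have [x Cx ex] := hrq C; have [x' Cx' ex'] := hrq C'.
  by apply: (quot_eq eF Cx Cx'); rewrite ex ex'.
- move=> y; split=> [[x <-]|[C <-]]; last by have [x _ <-] := hrq C; exists x.
  by have [C Cx] := quot_mk F x; exists C; apply: rqE.
- exact: (Z_borel ij rj tj bF eF cF).
- move=> W g bW bg hW; apply: contrapT => nl; apply: no.
  have [qE qF] := ext_equiv ij rj tj bE eE bF eF cF EF bW bg.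
  exists (ext_space ij rj bW bg), (extE rE (bg := bg)), (extF rF (bg := bg)); split=> //.
  + by move=> u v; apply: (extEF eE eF EF).
  + exact: (ext_gfs ij rj tj bE eE bF eF cF EF bL hL bW bg hW).
  + by move=> iso; apply: nl; apply: (lift_exists tj bE eE bF eF cE cF EF hL hW iso).
move=> C C'; have [x Cx <-] := hrq C; have [x' Cx' <-] := hrq C'.
by rewrite (hL _ _ Cx) (hL _ _ Cx') /lfs_rel; split=> [->//|/enc_inj].
Qed.
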